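(* Let $P$ be a K\''ahler-Einstein Fano polygon of index at most $17$. Then: (1) $P$ is of type $B_\infty$ and $B(P)$ is again K\''ahler-Einstein. (2) If $P$ is not symmetric, then $P$ is a triangle.
   Context: A Fano polygon is a full-dimensional convex lattice polygon $P\subset\mathbb{R}^2$ (lattice $\mathbb{Z}^2$) whose vertices are primitive lattice points and which contains the origin in its interior. The dual polygon is $P^*=\{u\in\mathbb{R}^2 : \langle u,v\rangle\ge -1 \text{ for all } v\in P\}$. The index of $P$ is the smallest positive integer $\ell$ such that $\ell P^*$ is a lattice polygon (the Gorenstein index of the associated toric surface). $P$ is K\''ahler-Einstein if the barycenter (centroid) of $P^*$ is the origin. $P$ is symmetric if the origin is the only lattice point fixed by every automorphism of $P$, where an automorphism of $P$ is an element of $GL_2(\mathbb{Z})$ mapping $P$ onto itself. For a nonzero lattice point $v=(x,y)$ let $I(v)=\gcd(x,y)$. If $P$ is a Fano polygon with vertices $v_1,\dots,v_n$ in counterclockwise order (indices mod $n$), its B-transformation is $B(P)=\mathrm{conv}\{\frac{v_i+v_{i+1}}{I(v_i+v_{i+1})} : i=1,\dots,n\}$; it is a lattice polytope but need not be a Fano polygon. Iterates are $B^0(P)=P$ and $B^{k+1}(P)=B(B^k(P))$, the latter being defined when $B^k(P)$ is a Fano polygon. $P$ is of type $B_m$ if $B^m(P)$ is (defined and) a Fano polygon, and of type $B_\infty$ if it is of type $B_m$ for every positive integer $m$. *)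

(* Defs.v *)
From HB Require Import structures.
From mathcomp Require Import all_boot all_order all_algebra.
From mathcomp Require Import all_classical all_reals all_analysis.

Set Implicit Arguments.
Unset Strict Implicit.
Unset Printing Implicit Defensive.

Import Order.TTheory GRing.Theory Num.Theory.
Import numFieldNormedType.Exports.

Local Open Scope classical_set_scope.
Local Open Scope ring_scope.

Definition lat_gcd (z : int * int) : int := gcdz z.1 z.2.

Definition det2 (a b : int * int) : int := a.1 * b.2 - a.2 * b.1.

Section Polygons.
Variable R : realType.
Implicit Types (P Q : set (R * R)).

Definition lat (z : int * int) : R * R := (z.1%:~R, z.2%:~R).

Definition conv_hull (A : set (R * R)) : set (R * R) :=
  smallest (@convex_set R (R * R)%type) A.

(* Polygons are full-dimensional, hence the nonempty interior. *)
Definition lattice_polygon P : Prop :=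
  (exists S : set (int * int), finite_set S /\ P = conv_hull (lat @` S)) /\
  P° !=set0.

(* Vertices are the extreme points. *)
Definition vertices P : set (R * R) :=
  [set v | P v /\ forall (x y : R * R) (t : R), P x -> P y -> 0 < t < 1 ->
             v = t *: x + (1 - t) *: y -> x = y].

Definition fano_polygon P : Prop :=
  [/\ lattice_polygon P,
      P° 0 &
      forall v, vertices P v -> exists2 z, lat_gcd z = 1 & v = lat z].

Definition dual_polygon P : set (R * R) :=
  [set u | forall v, P v -> -1 <= u.1 * v.1 + u.2 * v.2].

Definition has_index P (l : nat) : Prop :=
  let integral_dilation (k : nat) :=
    (0 < k)%N /\ lattice_polygon ((fun u => k%:R *: u) @` dual_polygon P) in
  integral_dilation l /\ forall k, integral_dilation k -> (l <= k)%N.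

Definition planar_measure := (@lebesgue_measure R \x @lebesgue_measure R)%E.

Definition barycenter Q : R * R :=
  (fine (planar_measure Q))^-1 *:
  (\int[planar_measure]_(u in Q) u.1, \int[planar_measure]_(u in Q) u.2).

Definition kahler_einstein P : Prop := barycenter (dual_polygon P) = 0.

Definition lin_act (A : 'M[int]_2) (v : R * R) : R * R :=
  ((A 0 0)%:~R * v.1 + (A 0 1)%:~R * v.2,
   (A 1 0)%:~R * v.1 + (A 1 1)%:~R * v.2).

Definition automorphism P (A : 'M[int]_2) : Prop :=
  A \in unitmx /\ lin_act A @` P = P.

Definition symmetric_polygon P : Prop :=
  forall z : int * int,
    (forall A, automorphism P A -> lin_act A (lat z) = lat z) -> z = 0.

(* [next s v] is the cyclic successor of [v] in [s]; the last condition says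
   that the whole polygon lies to the left of each directed line from [v] to
   [next s v]. This determines [s] up to rotation. *)
Definition ccw_vertices P (s : seq (int * int)) : Prop :=
  [/\ uniq s, lat @` [set` s] = vertices P &
      forall v w, v \in s -> w \in s -> 0 <= det2 (next s v - v) (w - v)].

Definition B_points P : set (R * R) :=
  [set u | exists s v, [/\ ccw_vertices P s, v \in s &
     u = (lat_gcd (v + next s v))%:~R^-1 *: lat (v + next s v)]].

(* Only meaningful when [P] is a Fano polygon. *)
Definition B_transform P : set (R * R) := conv_hull (B_points P).

(* [B^m(P)] is defined only if all earlier iterates are Fano polygons, so all
   the iterates up to [m] are required to be Fano. *)
Definition type_B P (m : nat) : Prop :=
  forall k, (k <= m)%N -> fano_polygon (iter k B_transform P).

Definition type_B_infty P : Prop := forall m, (0 < m)%N -> type_B P m.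

Definition triangle P : Prop := (vertices P #= `I_3)%card.

End Polygons.

(* Main.v *)
From Stdlib Require Import ZArith Lia.
Require Import Defs.
From HB Require Import structures.
From mathcomp Require Import all_boot all_order all_algebra.
From mathcomp Require Import all_classical all_reals all_analysis.
From mathcomp Require Import measurable_realfun.
From mathcomp Require Import ssrZ zify.
From mathcomp Require Import ring lra.

(** Let [v] run over the vertices of [P] in counterclockwise order, let [v'] be
    the successor of [v] and put [d v = det (v, v')]. Up to a quarter turn the
    dual polygon has the vertices [F v = (v' - v) / d v], one for each edge. Its
    normal cones cut it into triangles, and adding up their first moments shows
    that a Kaehler-Einstein polygon satisfies the balance identity
    [\sum_v det (F v, F v') (F v + F v') = 0] ([barycenter_edges]).

    Cutting the dual polygon into triangles with apex [F e] instead turns this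
    identity into Minkowski's inequality: [det (w, F e) >= -2] for each vertex
    [w], with equality only if [P] is a triangle ([minkowski]). Two consequences
    follow.

    - In a triangle the three inequalities force the three determinants [d v] to
      be equal, so that the vertices add up to zero ([triangle_sum]).

    - If [P] is not a triangle, then each edge of lattice height [h] confines
      [P] to an open strip of width [3 h]. All heights divide the index, which is
      at most 17, so up to [SL_2(Z)] only finitely many polygons remain. Starting
      with an edge of minimal height on a horizontal line, a depth-first search
      lists them all ([zcheck_all]), and each polygon in the list that is balanced
      turns out to be invariant under [-1] or under an integral map of order 3.

    Hence a Kaehler-Einstein polygon of index at most 17 is a triangle with
    vertex sum zero, or it has an integral rotation ([ke_classification]). In the
    first case [B(P) = - P], a polygon of the same kind. In the second case no
    nonzero vector is fixed by the rotation, so that [P] is symmetric; the rotation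
    acts on [B(P)] too, and it moves the points that span [B(P)] around the
    origin, so that the origin stays in the interior ([rotation_invariant_B]).
    Both classes are therefore stable under [B], and both consist of
    Kaehler-Einstein polygons, because their dual polygons are invariant under a
    real linear map of determinant one without nonzero fixed vectors, which has
    to fix the barycenter ([ke_of_rotation]). *)

Set Implicit Arguments.
Unset Strict Implicit.
Unset Printing Implicit Defensive.

(** * Exhaustive search for polygons of small index *)

Section ZSearch.
Local Open Scope Z_scope.
#[local] Arguments Z.mul : simpl never.
#[local] Arguments Z.add : simpl never.
#[local] Arguments Z.sub : simpl never.
#[local] Arguments Z.opp : simpl never.
#[local] Arguments Z.div : simpl never.
#[local] Arguments Z.modulo : simpl never.
#[local] Arguments Z.gcd : simpl never.
#[local] Arguments Z.ltb : simpl never.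
#[local] Arguments Z.leb : simpl never.
#[local] Arguments Z.eqb : simpl never.

Definition zdet (a b : Z * Z) : Z := a.1 * b.2 - a.2 * b.1.

(** The number [d] is the lattice length of the edge times its height, its lattice
    distance from the origin. The two divisibility tests say that the height
    divides [l], and the last test that the height is at least [h0]. *)
Definition zedge_ok (l h0 : Z) (a b : Z * Z) : bool :=
  let ex := b.1 - a.1 in let ey := b.2 - a.2 in let d := zdet a b in
  [&& 0 <? d, (l * ex) mod d =? 0, (l * ey) mod d =? 0 &
      h0 * Z.gcd ex ey <=? d].

(** The strict form of Minkowski's inequality for a vertex [w] off the edge from
    [a] to [b]. *)
Definition zslab (a b w : Z * Z) : bool :=
  let d := zdet a b in let f := zdet w (b.1 - a.1, b.2 - a.2) in
  (- 2 * d <? f) && (f <? d).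

(** Up to a quarter turn this is [l] times the vertex of the dual polygon that
    belongs to the edge; the quotients are exact if [l] is a multiple of the
    height. *)
Definition zdual (l : Z) (ab : (Z * Z) * (Z * Z)) : Z * Z :=
  let d := zdet ab.1 ab.2 in
  ((l * (ab.2.1 - ab.1.1)) / d, (l * (ab.2.2 - ab.1.2)) / d).

Definition zpairs (s : seq (Z * Z)) := zip s (rot 1 s).

(** The first moment of the dual polygon, up to the factor [6 l ^ 3] and a quarter
    turn. *)
Definition zbary (l : Z) (s : seq (Z * Z)) : Z * Z :=
  foldr (fun ef acc => let d := zdet ef.1 ef.2 in
     (d * (ef.1.1 + ef.2.1) + acc.1, d * (ef.1.2 + ef.2.2) + acc.2)) (0, 0)
   (zpairs (map (zdual l) (zpairs s))).

Definition zke (l : Z) (s : seq (Z * Z)) : bool :=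
  let b := zbary l s in (b.1 =? 0) && (b.2 =? 0).

Definition zcentral (s : seq (Z * Z)) : bool :=
  all (fun v => (- v.1, - v.2) \in s) s.

Definition zlin (a b c d : Z) (v : Z * Z) := (a * v.1 + b * v.2, c * v.1 + d * v.2).

(** A rotation of order 3 shifts the cyclic list of vertices by a third of its
    length, so that the images of the first two vertices determine its matrix.
    The quotients by [d] may be inexact; the final tests catch this. *)
Definition zrot3 (s : seq (Z * Z)) : bool :=
  let m := (size s %/ 3)%N in
  let v0 := nth (0, 0) s 0 in let v1 := nth (0, 0) s 1 in
  let w0 := nth (0, 0) s m in let w1 := nth (0, 0) s m.+1 in
  let d := zdet v0 v1 in
  let a11 := (w0.1 * v1.2 - w1.1 * v0.2) / d in
  let a12 := (w1.1 * v0.1 - w0.1 * v1.1) / d in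
  let a21 := (w0.2 * v1.2 - w1.2 * v0.2) / d in
  let a22 := (w1.2 * v0.1 - w0.2 * v1.1) / d in
  [&& a11 * a22 - a12 * a21 =? 1, a11 + a22 =? - 1 &
      all (fun v => zlin a11 a12 a21 a22 v \in s) s].

Definition ztest (l : Z) (s : seq (Z * Z)) : bool :=
  zke l s ==> (zcentral s || zrot3 s).

(** Depth-first search over all ways to continue a chain of vertices, stored in
    reverse order in [rpath], to a closed polygon. The list [cands] holds the
    points that lie in the slabs of the edges used so far. Exhausted fuel gives
    [false], so that the answer [true] certifies that the search was complete. *)
Fixpoint zsearch (n : nat) (l h0 : Z) (v0 : Z * Z) (rpath cands : seq (Z * Z)) : bool :=
  match n, rpath with
  | n'.+1, v :: p =>
    (if (3 < size rpath)%N && zedge_ok l h0 v v0 then ztest l (rev rpath) else true) &&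
    all (fun w => if zedge_ok l h0 v w && all (zslab v w) p
                  then zsearch n' l h0 v0 (w :: rpath) [seq c <- cands | zslab v w c]
                  else true) cands
  | _, _ => false
  end.

Definition zrange (lo hi : Z) : seq Z :=
  [seq lo + Z.of_nat i | i <- iota 0 (Z.to_nat (hi - lo + 1))].

(** The primitive points in the slabs of the edge on the line [y = h0] and of the
    edge from [(a, h0)] to [v2]: the first slab bounds [y], and then the second
    one bounds [x]. *)
Definition zcands (l h0 a : Z) (v2 : Z * Z) : seq (Z * Z) :=
  let d := a * v2.2 - h0 * v2.1 in let m := h0 - v2.2 in let ex := v2.1 - a in
  flatten [seq [seq (x, y) | x <- zrange ((- d - y * ex) / m) ((2 * d - y * ex) / m)
                 & (Z.gcd x y =? 1) && zslab (a, h0) v2 (x, y)]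
          | y <- zrange (- 2 * h0 + 1) (h0 - 1)].

(** All polygons with an edge from [(a + W, h0)] to [(a, h0)] of minimal height
    [h0], followed by the vertex [(x, y)]. The edge to that vertex has a height
    that divides [l] and a lattice length that divides [h0 - y], hence
    [0 < a y - h0 x <= l (h0 - y)]; the slab of that edge contains [(a + W, h0)],
    which bounds [W]. *)
Definition zcheck (l h0 : Z) : bool :=
  all (fun a =>
   all (fun y =>
     all (fun x =>
       if (Z.gcd x y =? 1) && zedge_ok l h0 (a, h0) (x, y) then
         let cands := zcands l h0 a (x, y) in
         all (fun W => if Z.gcd (a + W) h0 =? 1 then
            zsearch 20 l h0 (a + W, h0) [:: (x, y); (a, h0); (a + W, h0)] cands else true)
           (zrange 1 ((3 * (a * y - h0 * x)) / (h0 - y)))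
       else true)
      (zrange ((a * y - l * (h0 - y)) / h0) ((a * y - 1) / h0)))
    (zrange (- 2 * h0 + 1) (h0 - 1)))
   [seq a <- zrange 0 (h0 - 1) | Z.gcd a h0 =? 1].

Definition zcheck_index (l : Z) : bool :=
  all (fun h0 => if l mod h0 =? 0 then zcheck l h0 else true) (zrange 1 l).

Lemma next_cat_cons (T : eqType) (p q : seq T) (a b : T) :
  uniq (p ++ a :: b :: q) -> next (p ++ a :: b :: q) a = b.
Proof.
move=> u; rewrite next_nth mem_cat mem_head orbT.
have : a \notin p.
  by move: u; rewrite cat_uniq => /and3P[_ /hasPn/(_ a)]; rewrite mem_head => /(_ isT).
case: p u => [|y p] u /=; first by rewrite eqxx.
rewrite inE negb_or eq_sym => /andP[/negbTE -> ap].
rewrite index_cat (negbTE ap) /= eqxx addn0 -cat_rcons -[(size p).+1](size_rcons p a).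
by rewrite nth_cat ltnn subnn.
Qed.

Lemma next_rcons (T : eqType) (x v : T) (p : seq T) :
  uniq (x :: rcons p v) -> next (x :: rcons p v) v = x.
Proof.
move=> u; rewrite next_nth inE mem_rcons mem_head orbT.
have : v \notin x :: p.
  by move: u; rewrite -rcons_cons rcons_uniq => /andP[].
rewrite inE negb_or => /andP[/negbTE xv vp] /=.
rewrite eq_sym xv -cats1 index_cat (negbTE vp) /= eqxx addn0 nth_cat.
by rewrite ltnNge leqnSn /= nth_default// subSnn.
Qed.

Definition zvalid (l h0 : Z) (s : seq (Z * Z)) : Prop :=
  [/\ uniq s, forall v, v \in s -> zedge_ok l h0 v (next s v),
      forall v w, v \in s -> w \in s -> w != v -> w != next s v ->
        zslab v (next s v) w &
      forall v, v \in s -> Z.gcd v.1 v.2 = 1].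

(** Induction on the fuel: the next vertex of the polygon is among the candidates
    and passes the tests made before the recursive call, and the vertices after
    it survive the filtering of the candidates. *)
Lemma zsearch_sound n l h0 v0 v p cands rest :
  let s := rev (rcons (v :: p) v0) ++ rest in
  zsearch n l h0 v0 (rcons (v :: p) v0) cands -> {subset rest <= cands} ->
  zvalid l h0 s -> (3 < size s)%N -> ztest l s.
Proof.
elim: n v p cands rest => [|n IH] v p cands rest //= /andP[closed ext] sub val sz.
have [us eok slab _] := val.
case: rest => [|w rest] in sub val sz us eok slab *.
  have sE : rev (v :: rcons p v0) = v0 :: rcons (rev p) v.
    by rewrite rev_cons rev_rcons.
  move: us eok sz closed; rewrite cats0 sE => us eok sz.
  have := eok v; rewrite next_rcons// inE mem_rcons mem_head orbT => /(_ isT) ->.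
  by rewrite andbT; move: sz; rewrite /= !size_rcons size_rev => ->.
have wc : w \in cands by apply: sub; rewrite mem_head.
have sE : rev (v :: rcons p v0) ++ w :: rest = rev (rcons p v0) ++ v :: w :: rest.
  by rewrite rev_cons cat_rcons.
have nv : next (rev (v :: rcons p v0) ++ w :: rest) v = w.
  by rewrite sE next_cat_cons// -sE.
have vs : v \in rev (v :: rcons p v0) ++ w :: rest by rewrite sE mem_cat mem_head orbT.
have := allP ext _ wc; rewrite -{1}nv eok//.
have -> : all (zslab v w) (rcons p v0).
  apply/allP => x xp; rewrite -{1}nv; apply: slab => //.
  - by rewrite mem_cat mem_rev inE xp orbT.
  - apply/eqP => xv; move: us; rewrite cat_uniq rev_uniq /= => /andP[/andP[+ _] _].
    by rewrite -xv xp.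
  - rewrite nv; apply/eqP => xw; move: us; rewrite cat_uniq => /and3P[_ /hasPn/(_ w)].
    by rewrite mem_head mem_rev inE -xw xp orbT => /(_ isT).
rewrite /= => /(IH w (v :: p) _ rest).
have -> : rev (rcons [:: w, v & p] v0) ++ rest = rev (v :: rcons p v0) ++ w :: rest.
  by rewrite /= rev_cons cat_rcons.
apply=> //.
move=> x xr; rewrite mem_filter sub ?inE ?xr ?orbT// andbT.
rewrite -{1}nv; apply: slab => //.
- by rewrite mem_cat inE xr !orbT.
- apply/eqP => xv; move: us; rewrite cat_uniq => /and3P[_ /hasPn/(_ x)].
  by rewrite inE xr orbT mem_rev inE xv eqxx => /(_ isT).
- rewrite nv; apply/eqP => xw; move: us; rewrite cat_uniq /= => /and3P[_ _ /andP[]].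
  by rewrite -xw xr.
Qed.

#[local] Arguments zsearch : simpl never.

Lemma zdiv_range m u v q : 0 < m -> u <= m * q -> m * q <= v -> u / m <= q <= v / m.
Proof.
by move=> m0 h1 h2; split;
  [exact: Z.div_le_upper_bound|exact: Z.div_le_lower_bound].
Qed.

Lemma mem_zrange lo hi x : lo <= x <= hi -> x \in zrange lo hi.
Proof.
move=> h; apply/mapP; exists (Z.to_nat (x - lo)); last by lia.
by rewrite mem_iota add0n; apply/andP; split => //; apply/ltP; lia.
Qed.

Lemma zcheck_sound l h0 a W v2 rest :
  let s := [:: (a + W, h0), (a, h0), v2 & rest] in
  0 < l -> 0 <= a < h0 -> 1 <= W -> zcheck l h0 -> zvalid l h0 s ->
  (3 < size s)%N -> ztest l s.
Proof.
move=> s l0 a0 W0 chk val sz; have [us eok slab prim] := val.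
case: v2 => x y in s us eok slab prim val sz *.
have n0 : next s (a + W, h0) = (a, h0) by apply: (@next_cat_cons _ [::]).
have n1 : next s (a, h0) = (x, y) by apply: (@next_cat_cons _ [:: (a + W, h0)]).
have s0 : (a + W, h0) \in s by rewrite mem_head.
have s1 : (a, h0) \in s by rewrite !inE eqxx orbT.
have s2 : (x, y) \in s by rewrite !inE eqxx !orbT.
have rows p : p \in (x, y) :: rest -> - 2 * h0 < p.2 < h0.
  move=> pr; have := slab (a + W, h0) p s0; rewrite n0.
  have ps : p \in s by rewrite /s 2!in_cons pr !orbT.
  have pn : p \notin [:: (a + W, h0); (a, h0)].
    move: us; rewrite /s -[X in uniq X]/([:: (a + W, h0); (a, h0)] ++ (x, y) :: rest).
    rewrite cat_uniq => /and3P[_ /hasPn h _].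
    exact: h.
  move: pn; rewrite !inE negb_or => /andP[p1 p2] /(_ ps p1 p2).
  rewrite /zslab /zdet /= => /andP[/Z.ltb_lt h1 /Z.ltb_lt h2].
  have W1 : 0 < W by clear -W0; lia.
  by split; apply/(Z.mul_lt_mono_pos_r W _ _ W1); clear -h1 h2; lia.
have yr := rows _ (mem_head _ _); rewrite /= in yr.
have e1 := eok _ s1; rewrite n1 in e1.
have /and4P[/Z.ltb_lt d0 /Z.eqb_eq _ /Z.eqb_eq dy _] := e1.
rewrite /zdet /= in d0 dy.
(* the determinant divides [l] times both coordinates of the edge *)
have dle : a * y - h0 * x <= l * (h0 - y).
  apply: Z.divide_pos_le; first by clear -l0 yr; nia.
  have : (a * y - h0 * x | l * (y - h0)) by apply/Z.mod_divide => //; clear -d0; lia.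
  by case=> k hk; exists (- k); clear -hk; lia.
have e0 := slab (a, h0) (a + W, h0) s1 s0; rewrite n1 in e0.
have /andP[/Z.ltb_lt w1 _] : zslab (a, h0) (x, y) (a + W, h0).
  apply: e0; first by apply/eqP => -[]; clear -W0; lia.
  by apply/eqP => -[]; clear -yr; lia.
rewrite /zdet /= in w1.
have g2 := prim _ s2; have g1 := prim _ s1; have g0 := prim _ s0; rewrite /= in g0 g1 g2.
have /allP/(_ a) := chk; rewrite mem_filter g1 mem_zrange ?Z.eqb_refl; last by clear -a0; lia.
move=> /(_ isT)/allP/(_ y); rewrite mem_zrange; last by clear -yr; lia.
move=> /(_ isT)/allP/(_ x); rewrite mem_zrange; last first.
  by apply: zdiv_range; clear -a0 yr d0 dle; lia.
move=> /(_ isT); rewrite g2 Z.eqb_refl e1 /= => /allP/(_ W); rewrite mem_zrange; last first.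
  split => //; apply: Z.div_le_lower_bound; clear -yr w1; lia.
move=> /(_ isT); rewrite g0 Z.eqb_refl.
move/(@zsearch_sound 20 l h0 (a + W, h0) (x, y) [:: (a, h0)] _ rest); apply => //.
move=> [x' y'] pr.
have pr' : (x', y') \in (x, y) :: rest by rewrite inE pr orbT.
have pr2 : (x', y') \in s by rewrite !inE pr !orbT.
have yr' := rows _ pr'; rewrite /= in yr'.
have sl : zslab (a, h0) (x, y) (x', y').
  rewrite -n1; apply: slab => //.
    by apply/eqP => -[]; clear -yr'; lia.
  rewrite n1; apply/eqP => e; move: us; rewrite /s /= -e pr /= !andbF //.
apply/flattenP; exists [seq (x0, y') | x0 <- zrange ((- (a * y - h0 * x) - y' * (x - a)) / (h0 - y))
    ((2 * (a * y - h0 * x) - y' * (x - a)) / (h0 - y))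
                 & (Z.gcd x0 y' =? 1) && zslab (a, h0) (x, y) (x0, y')].
  by apply/mapP; exists y' => //; apply: mem_zrange; clear -yr'; lia.
apply/mapP; exists x' => //; rewrite mem_filter sl (prim _ pr2) /= mem_zrange//.
have /andP[/Z.ltb_lt q1 /Z.ltb_lt q2] := sl; rewrite /zdet /= in q1 q2.
by apply: zdiv_range; clear -yr q1 q2; lia.
Qed.

(** The case distinction by computation, over all indices up to 17 and all minimal
    heights. The slabs leave finitely many candidates in each case. *)
Lemma zcheck_all : all zcheck_index (zrange 1 17).
Proof. by vm_compute. Qed.

(** * Reduction to the searched normal form *)

#[local] Arguments zcheck : simpl never.

(** The list is invariant under [-1] or under an integral matrix of determinant 1
    and trace [-1], which has order 3 by the Cayley-Hamilton theorem. *)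
Definition zrotation (s : seq (Z * Z)) : Prop :=
  exists a b c d, [/\ a * d - b * c = 1,
    [/\ a = -1, b = 0, c = 0 & d = -1] \/ a + d = -1 &
    forall v, v \in s -> zlin a b c d v \in s].

Lemma ztest_rotation l s : ztest l s -> zke l s -> zrotation s.
Proof.
move=> /implyP h /h /orP[/allP c|/and3P[/Z.eqb_eq d1 /Z.eqb_eq tr /allP m]].
  exists (-1), 0, 0, (-1); split; [by []|by left|].
  move=> v /c; rewrite /zlin; congr (is_true (_ \in s)); congr pair; lia.
by do 4 eexists; split; [exact: d1|by right|exact: m].
Qed.

Definition zheight (a b : Z * Z) : Z := zdet a b / Z.gcd (b.1 - a.1) (b.2 - a.2).

Record zpoly (l : Z) (s : seq (Z * Z)) : Prop := ZPoly {
  zp_uniq : uniq s;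
  zp_det : forall v, v \in s -> 0 < zdet v (next s v);
  zp_div : forall v, v \in s -> (zdet v (next s v) | l * ((next s v).1 - v.1))
     /\ (zdet v (next s v) | l * ((next s v).2 - v.2));
  zp_slab : forall v w, v \in s -> w \in s -> w != v -> w != next s v ->
        zslab v (next s v) w;
  zp_prim : forall v, v \in s -> Z.gcd v.1 v.2 = 1 }.

Section Transform.
Variables (a b c d : Z).
Hypothesis det1 : a * d - b * c = 1.
Local Notation A := (zlin a b c d).

Lemma zlin_det x y : zdet (A x) (A y) = zdet x y.
Proof.
rewrite /zdet /zlin /=; transitivity ((a * d - b * c) * (x.1 * y.2 - x.2 * y.1)); first lia.
by rewrite det1; lia.
Qed.

Lemma zlinK : cancel A (zlin d (- b) (- c) a).
Proof.
move=> [x y]; rewrite /zlin /=; congr pair.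
  transitivity ((a * d - b * c) * x); [lia|rewrite det1; lia].
transitivity ((a * d - b * c) * y); [lia|rewrite det1; lia].
Qed.

Lemma zlin_gcd x y : Z.gcd (a * x + b * y) (c * x + d * y) = Z.gcd x y.
Proof.
apply: Z.gcd_unique; first exact: Z.gcd_nonneg.
- by apply: Z.divide_add_r; apply: Z.divide_mul_r; [exact: Z.gcd_divide_l|exact: Z.gcd_divide_r].
- by apply: Z.divide_add_r; apply: Z.divide_mul_r; [exact: Z.gcd_divide_l|exact: Z.gcd_divide_r].
move=> q q1 q2; apply: Z.gcd_greatest.
  have -> : x = d * (a * x + b * y) + - b * (c * x + d * y).
    transitivity ((a * d - b * c) * x); [rewrite det1; lia|lia].
  by apply: Z.divide_add_r; apply: Z.divide_mul_r.
have -> : y = - c * (a * x + b * y) + a * (c * x + d * y).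
  transitivity ((a * d - b * c) * y); [rewrite det1; lia|lia].
by apply: Z.divide_add_r; apply: Z.divide_mul_r.
Qed.

Lemma zlin_inj : injective A. Proof. exact: can_inj zlinK. Qed.

Lemma zlin_diff x y : ((A y).1 - (A x).1 = a * (y.1 - x.1) + b * (y.2 - x.2)) /\
  ((A y).2 - (A x).2 = c * (y.1 - x.1) + d * (y.2 - x.2)).
Proof. by rewrite /zlin /=; split; lia. Qed.

Lemma zlin_slab x y w : zslab (A x) (A y) (A w) = zslab x y w.
Proof.
rewrite /zslab zlin_det; have [-> ->] := zlin_diff x y.
by rewrite -[(_, _) in LHS]/(A (y.1 - x.1, y.2 - x.2)) zlin_det.
Qed.

Lemma zpoly_map l s : zpoly l s -> zpoly l (map A s).
Proof.
case=> us dt dv sl pr; split.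
- by rewrite map_inj_uniq//; exact: zlin_inj.
- by move=> _ /mapP[v vs ->]; rewrite (next_map zlin_inj us) zlin_det; exact: dt.
- move=> _ /mapP[v vs ->]; rewrite (next_map zlin_inj us).
  rewrite zlin_det; have [-> ->] := zlin_diff v (next s v); have [d1 d2] := dv v vs.
  split.
    have -> : l * (a * ((next s v).1 - v.1) + b * ((next s v).2 - v.2)) =
      a * (l * ((next s v).1 - v.1)) + b * (l * ((next s v).2 - v.2)) by lia.
    by apply: Z.divide_add_r; apply: Z.divide_mul_r.
  have -> : l * (c * ((next s v).1 - v.1) + d * ((next s v).2 - v.2)) =
    c * (l * ((next s v).1 - v.1)) + d * (l * ((next s v).2 - v.2)) by lia.
  by apply: Z.divide_add_r; apply: Z.divide_mul_r.
- move=> _ _ /mapP[v vs ->] /mapP[w ws ->]; rewrite (next_map zlin_inj us).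
  by rewrite !(inj_eq zlin_inj) zlin_slab; exact: sl.
by move=> _ /mapP[v vs ->]; rewrite /zlin /= zlin_gcd; exact: pr.
Qed.

Lemma rot1_next (T : eqType) (s : seq T) : uniq s -> rot 1 s = map (next s) s.
Proof.
case: s => // x s us; rewrite rot1_cons; apply: (@eq_from_nth _ x).
  by rewrite size_rcons size_map.
move=> i; rewrite size_rcons ltnS => il; rewrite (nth_map x)//.
rewrite next_nth mem_nth// index_uniq// nth_rcons; move: il; rewrite leq_eqVlt.
case/orP => [/eqP ->|il]; first by rewrite ltnn eqxx nth_default.
by rewrite il; exact: set_nth_default.
Qed.

Lemma zpairs_next (s : seq (Z * Z)) : uniq s -> zpairs s = [seq (v, next s v) | v <- s].
Proof.
by move=> us; rewrite /zpairs rot1_next//; move: (next s) => f; elim: s {us} => //= x t ->.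
Qed.

Lemma zdiv_linear m p q x y k1 k2 D : D <> 0 -> m * x = k1 * D -> m * y = k2 * D ->
  (m * (p * x + q * y)) / D = p * k1 + q * k2.
Proof.
move=> D0 e1 e2; rewrite -(Z.div_mul (p * k1 + q * k2) D)//; congr (_ / _).
transitivity (p * (m * x) + q * (m * y)); first by lia.
by rewrite e1 e2; lia.
Qed.

(** A map of determinant 1 preserves the determinants in the balance identity and
    carries dual vertices to dual vertices, up to the quarter turn, so that the
    moment is mapped by the same matrix. *)
Lemma zke_map l s : zpoly l s -> zke l s -> zke l (map A s).
Proof.
move=> ps; have us := zp_uniq ps; have pA := zpoly_map ps.
rewrite /zke /zbary.
have -> : map (zdual l) (zpairs (map A s)) = map A (map (zdual l) (zpairs s)).
  rewrite !zpairs_next//; last exact: zp_uniq pA.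
  rewrite -!map_comp; apply/eq_in_map => v vs /=; rewrite (next_map zlin_inj us).
  have [k1 k2] := zp_div ps vs; have dt := zp_det ps vs.
  rewrite /zdual /= zlin_det; have [-> ->] := zlin_diff v (next s v).
  case: k1 => k1 e1; case: k2 => k2 e2; set D := zdet _ _ in dt e1 e2 *.
  have D0 : D <> 0 by lia.
  rewrite (zdiv_linear _ _ D0 e1 e2) (zdiv_linear _ _ D0 e1 e2).
  by rewrite e1 e2 !Z.div_mul.
move: (map _ _) => es.
have -> : zpairs (map A es) = map (fun p => (A p.1, A p.2)) (zpairs es).
  rewrite /zpairs -map_rot; move: (rot 1 es) => es'.
  by elim: es es' => [|x t IH] [|y t'] //=; rewrite IH.
set f := (X in foldr X); move: (zpairs es) => ps'.
have -> : foldr f (0, 0) (map (fun p => (A p.1, A p.2)) ps') = A (foldr f (0, 0) ps').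
  elim: ps' => [|[[x1 x2] [y1 y2]] ps' IH] /=; first by rewrite /zlin /=; congr pair; lia.
  rewrite IH /f /= zlin_det; case: (foldr _ _ _) => u1 u2.
  by rewrite /zlin /=; congr pair; lia.
case: (foldr _ _ _) => u1 u2 /= /andP[/Z.eqb_eq -> /Z.eqb_eq ->].
by apply/andP; split; apply/Z.eqb_eq; lia.
Qed.

Lemma zrotation_map s : zrotation (map A s) -> zrotation s.
Proof.
case=> [p [q [r [t [dt kind mem]]]]].
pose a' := d * (p * a + q * c) - b * (r * a + t * c).
pose b' := d * (p * b + q * d) - b * (r * b + t * d).
pose c' := - c * (p * a + q * c) + a * (r * a + t * c).
pose d' := - c * (p * b + q * d) + a * (r * b + t * d).
exists a', b', c', d'; split.
- transitivity ((a * d - b * c) * (a * d - b * c) * (p * t - q * r)); first by rewrite /a' /b' /c' /d'; lia.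
  by rewrite det1 dt.
- case: kind => [[p1 q0 r0 t1]|tr]; last first.
    right; transitivity ((a * d - b * c) * (p + t)); first by rewrite /a' /d'; lia.
    by rewrite det1 tr.
  by left; rewrite /a' /b' /c' /d' p1 q0 r0 t1; split; lia.
move=> v vs; have := mem _ (map_f A vs) => /mapP[w ws e].
suff -> : zlin a' b' c' d' v = w by [].
rewrite -[w]zlinK -e; case: v {vs e} => x y; rewrite /zlin /a' /b' /c' /d' /=.
by congr pair; lia.
Qed.

End Transform.

(** A Bezout relation for the primitive direction of the edge from [v0] to [v1]
    gives a matrix in [SL_2(Z)] that makes this edge horizontal at its height
    [h0]; a shear then moves the abscissa of [v1] into the range from 0 to
    [h0 - 1]. As the height of this edge is minimal, the search applies. *)
Lemma zpoly_rotation l v0 v1 v2 rest :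
  let s := [:: v0, v1, v2 & rest] in
  1 <= l <= 17 -> (3 < size s)%N -> zpoly l s -> zke l s ->
  (forall v, v \in s -> zheight v0 v1 <= zheight v (next s v)) -> zrotation s.
Proof.
move=> s ll sz ps ke hmin.
have us := zp_uniq ps.
have s0 : v0 \in s by rewrite mem_head.
have n0 : next s v0 = v1 by apply: (@next_cat_cons _ [::]).
have dt0 := zp_det ps s0; rewrite n0 in dt0.
have gpos v w : 0 < zdet v w -> 0 < Z.gcd (w.1 - v.1) (w.2 - v.2).
  move=> h; have := Z.gcd_nonneg (w.1 - v.1) (w.2 - v.2).
  case: (Z.eq_dec (Z.gcd (w.1 - v.1) (w.2 - v.2)) 0) => [/Z.gcd_eq_0[e1 e2]|]; last lia.
  exfalso; move: h; rewrite /zdet.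
  have -> : w.1 = v.1 by lia.
  have -> : w.2 = v.2 by lia.
  lia.
have gdiv v w : (Z.gcd (w.1 - v.1) (w.2 - v.2) | zdet v w).
  have -> : zdet v w = v.1 * (w.2 - v.2) - v.2 * (w.1 - v.1) by rewrite /zdet; lia.
  by apply: Z.divide_sub_r; apply: Z.divide_mul_r; [exact: Z.gcd_divide_r|exact: Z.gcd_divide_l].
have W0 := gpos _ _ dt0.
pose W := Z.gcd (v1.1 - v0.1) (v1.2 - v0.2).
rewrite -/W in W0.
have [px ex] : (W | v1.1 - v0.1) := Z.gcd_divide_l _ _.
have [py ey] : (W | v1.2 - v0.2) := Z.gcd_divide_r _ _.
have [u [v bez]] : exists u v, u * px + v * py = 1.
  have [u [v e]] := Z.gcd_bezout (v1.1 - v0.1) (v1.2 - v0.2) W erefl.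
  exists u, v; apply: (Z.mul_reg_r _ _ W); first by clear -W0; lia.
  by rewrite ex ey in e; clear -e; lia.
pose h0 := py * v0.1 - px * v0.2.
have d0E : zdet v0 v1 = h0 * W.
  have -> : zdet v0 v1 = v0.1 * (v1.2 - v0.2) - v0.2 * (v1.1 - v0.1) by rewrite /zdet; clear; lia.
  by rewrite ex ey /h0; clear; lia.
have h00 : 0 < h0 by rewrite d0E in dt0; clear -dt0 W0; nia.
have hE : zheight v0 v1 = h0 by rewrite /zheight -/W d0E Z.div_mul//; clear -W0; lia.
(* the matrix with rows [(- u, - v)] and [(py, - px)] maps the direction
   [(px, py)] to [(-1, 0)]; [k] is the parameter of the shear *)
pose a' := - u * v0.1 - v * v0.2 - W.
pose k := a' / h0.
pose A := zlin (- u - k * py) (- v + k * px) py (- px).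
have det1 : (- u - k * py) * (- px) - (- v + k * px) * py = 1 by clear -bez; lia.
have Av0 : A v0 = (a' mod h0 + W, h0).
  rewrite /A /zlin; congr pair; last by rewrite /h0; clear; lia.
  have := Z.div_mod a' h0; rewrite -/k => e.
  have -> : a' mod h0 = a' - h0 * k by clear -e h00; lia.
  by rewrite /a' /h0; clear; lia.
have Av1 : A v1 = (a' mod h0, h0).
  have [] := zlin_diff (- u - k * py) (- v + k * px) py (- px) v0 v1.
  rewrite -/A Av0 ex ey => e1 e2; rewrite [LHS]surjective_pairing.
  move: (A v1).1 (A v1).2 e1 e2 => X Y /= e1 e2; congr pair; last by clear -e2; lia.
  have : X - (a' mod h0 + W) = - (u * px + v * py) * W by rewrite e1; clear; lia.
  by rewrite bez; clear; lia.
have pA := zpoly_map det1 ps; rewrite -/A in pA.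
have sA : map A s = [:: (a' mod h0 + W, h0), (a' mod h0, h0), A v2 & map A rest].
  by rewrite /s /= Av0 Av1.
have h0l : (h0 | l).
  have [] := zp_div ps s0; rewrite n0 ex ey d0E => -[q1 f1] [q2 f2].
  have g1 : l * px = q1 * h0 by apply: (Z.mul_reg_r _ _ W); [clear -W0; lia|clear -f1; lia].
  have g2 : l * py = q2 * h0 by apply: (Z.mul_reg_r _ _ W); [clear -W0; lia|clear -f2; lia].
  exists (u * q1 + v * q2).
  transitivity (u * (l * px) + v * (l * py)); last by rewrite g1 g2; clear; lia.
  transitivity (l * (u * px + v * py)); last by clear; lia.
  by rewrite bez; clear; lia.
have h0le : h0 <= l by apply: Z.divide_pos_le => //; clear -ll; lia.
have chk : zcheck l h0.
  have := zcheck_all => /allP/(_ l); rewrite mem_zrange// => /(_ isT)/allP/(_ h0).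
  rewrite mem_zrange; last by clear -h00 h0le; lia.
  by move=> /(_ isT); rewrite (proj2 (Z.mod_divide l h0 _) h0l) ?Z.eqb_refl//; clear -h00; lia.
apply: (zrotation_map det1); rewrite -/A.
apply: (@ztest_rotation l); last by apply: zke_map.
rewrite sA; apply: zcheck_sound chk _ _.
- by clear -ll; lia.
- exact: Z.mod_pos_bound.
- by clear -W0; lia.
- rewrite -sA; split; [exact: zp_uniq pA| |exact: zp_slab pA|exact: zp_prim pA].
  move=> _ /mapP[w ws ->].
  have As : A w \in map A s by exact: map_f.
  have [d1 d2] := zp_div pA As; have dt := zp_det pA As.
  apply/and4P; split.
  + exact/Z.ltb_lt.
  + by apply/Z.eqb_eq/Z.mod_divide => //; clear -dt; lia.
  + by apply/Z.eqb_eq/Z.mod_divide => //; clear -dt; lia.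
  apply/Z.leb_le; move: dt; rewrite (next_map (zlin_inj det1) us).
  rewrite zlin_det// => dt.
  have [-> ->] := zlin_diff (- u - k * py) (- v + k * px) py (- px) w (next s w).
  rewrite zlin_gcd//.
  have := hmin _ ws; rewrite hE /zheight; have [q qE] := gdiv w (next s w).
  have g0 := gpos _ _ dt.
  rewrite qE Z.div_mul; last by clear -g0; lia.
  by move: g0; set g := Z.gcd _ _; clear; nia.
by rewrite -sA size_map.
Qed.

End ZSearch.

Import Order.TTheory GRing.Theory Num.Theory.
Import numFieldNormedType.Exports.
Local Open Scope classical_set_scope.
Local Open Scope ring_scope.

(** * Planar Lebesgue measure under shears and swaps *)

Section Measure.
Variable R : realType.
Local Notation leb := (@lebesgue_measure R).
Local Notation mu := (@planar_measure R).
Local Notation RR := (measurableTypeR R).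

(** The translated measure agrees with the Lebesgue measure on half-open
    intervals, and these determine it. *)
Lemma lebesgue_translation (c : R) (A : set RR) : measurable A ->
  leb [set x | A (x + c)] = leb A.
Proof.
have mt : measurable_fun setT (fun x : RR => (x + c : RR)).
  exact: measurable_funD.
pose tm := isMeasurableFun.Build _ _ _ _ _ mt.
pose t : {mfun RR >-> RR} := HB.pack (fun x : RR => (x + c : RR)) tm.
move=> mA; suff -> : leb A = pushforward leb t A by [].
apply: lebesgue_measure_unique => // _ [[a b]] _ <-.
transitivity (leb `](a - c), (b - c)]%classic); last first.
  by congr (leb _); apply/seteqP; split=> x/=; rewrite !in_itv/= ltrBlDr lerBrDr.
rewrite !lebesgue_measure_itv/= !lte_fin ltrD2r -!EFinD.
by case: ifP => // _; congr (_%:E); lra.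
Qed.

Lemma measurable_coord_lin (a b : R) :
  measurable_fun setT (fun u : RR * RR => (a * u.1 + b * u.2 : RR)).
Proof.
by apply: measurable_funD; apply: measurable_funM.
Qed.

Lemma measurable_linear_map (a b c d : R) :
  measurable_fun setT
   (fun u : RR * RR => ((a * u.1 + b * u.2, c * u.1 + d * u.2) : RR * RR)).
Proof. by apply: measurable_fun_pair; exact: measurable_coord_lin. Qed.

Lemma planar_shear_snd (c : R) (A : set (RR * RR)) : measurable A ->
  mu [set u | A (u.1, u.2 + c * u.1)] = mu A.
Proof.
move=> mA; rewrite /planar_measure /product_measure1.
apply: eq_integral => x _ /=.
rewrite -[RHS](lebesgue_translation (c * x)); last exact: measurable_xsection.
by congr (leb _); apply/seteqP; split => y /=; rewrite /xsection/= !inE.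
Qed.

Lemma planar_swap (A : set (RR * RR)) : measurable A ->
  mu [set u | A (u.2, u.1)] = mu A.
Proof.
have mt : measurable_fun setT (fun u : RR * RR => ((u.2, u.1) : RR * RR)).
  by apply: measurable_fun_pair; [exact: measurable_snd|exact: measurable_fst].
pose tm := isMeasurableFun.Build _ _ _ _ _ mt.
pose t : {mfun (RR * RR)%type >-> (RR * RR)%type} :=
  HB.pack (fun u : RR * RR => ((u.2, u.1) : RR * RR)) tm.
move=> mA; suff -> : mu A = pushforward mu t A by [].
apply: product_measure_unique => // X Y mX mY; rewrite /pushforward.
transitivity (mu (Y `*` X)); last by rewrite [LHS]product_measure1E// muleC.
by congr (mu _); apply/seteqP; split=> -[x y] /= [].
Qed.

End Measure.

(** * Planar Lebesgue measure under maps of determinant one *)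

Section Linear.
Variable R : realType.
Local Notation leb := (@lebesgue_measure R).
Local Notation mu := (@planar_measure R).
Local Notation RR := (measurableTypeR R).

Definition lin2 (a b c d : R) (u : R * R) : R * R :=
  (a * u.1 + b * u.2, c * u.1 + d * u.2).

Lemma measurable_lin2 (a b c d : R) (A : set (RR * RR)) :
  measurable A -> measurable [set u : RR * RR | A (lin2 a b c d u)].
Proof.
move=> mA; rewrite -[X in measurable X]setTI.
exact: (measurable_linear_map a b c d).
Qed.

Lemma planar_shear_fst (c : R) (A : set (RR * RR)) : measurable A ->
  mu [set u | A (u.1 + c * u.2, u.2)] = mu A.
Proof.
move=> mA; pose B := [set u : RR * RR | A (u.2, u.1)].
have mB : measurable B.
  have := measurable_lin2 0 1 1 0 mA; congr (measurable _).
  by apply/funext => u; rewrite /lin2 /B/= !mul0r !mul1r add0r addr0.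
rewrite -[RHS](planar_swap mA) -/B -[RHS](planar_shear_snd c mB).
rewrite -[RHS]planar_swap; last first.
  have := measurable_lin2 1 0 c 1 mB; congr (measurable _).
  by apply/funext => u; rewrite /lin2/= mul0r !mul1r addr0 addrC.
by [].
Qed.

(** With a nonzero lower left entry [c], the matrix is the product of three
    shears. *)
Lemma planar_linear_aux (a b c d : R) (A : set (RR * RR)) :
  a * d - b * c = 1 -> c != 0 -> measurable A ->
  mu [set u | A (lin2 a b c d u)] = mu A.
Proof.
move=> abcd c0 mA.
rewrite -[RHS](planar_shear_fst ((a - 1) / c)) //.
rewrite -[RHS](planar_shear_snd c); last first.
  have := measurable_lin2 1 ((a - 1) / c) 0 1 mA; congr (measurable _).
  by apply/funext => u; rewrite /lin2/= mul0r !mul1r add0r.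
rewrite -[RHS](planar_shear_fst ((d - 1) / c)); last first.
  have := measurable_lin2 (1 + (a - 1) / c * c) ((a - 1) / c) c 1 mA.
  congr (measurable _); apply/funext => u; rewrite /lin2/=; congr (A (_, _)); ring.
congr (mu _); apply/funext => u; rewrite /lin2/=; congr (A (_, _)); last by field.
have -> : b = (a * d - 1) / c by rewrite -abcd; field.
by field.
Qed.

(** A further shear makes the lower left entry nonzero. *)
Lemma planar_linear (a b c d : R) (A : set (RR * RR)) :
  a * d - b * c = 1 -> measurable A ->
  mu [set u | A (lin2 a b c d u)] = mu A.
Proof.
move=> abcd mA; have [c0|c0] := eqVneq c 0; last exact: planar_linear_aux.
have a0 : a != 0.
  by apply/eqP => a0; move: abcd; rewrite a0 c0; lra.
have mB := measurable_lin2 1 0 (-1) 1 mA.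
rewrite -[RHS](planar_shear_snd (-1)) //.
rewrite -[RHS](@planar_linear_aux a b (a + c) (b + d)).
- by congr (mu _); apply/funext => u; rewrite /lin2/=; congr (A (_, _)); ring.
- by rewrite -abcd; ring.
- by rewrite c0 addr0.
- have := mB; congr (measurable _); apply/funext => u.
  by rewrite /lin2/= mul0r !mul1r addr0 addrC.
Qed.

Lemma Rintegral_preserved (t : RR * RR -> RR * RR) (D : set (RR * RR))
    (f : RR * RR -> R) :
  measurable_fun setT t ->
  (forall A : set (RR * RR), measurable A -> mu (t @^-1` A) = mu A) ->
  measurable D -> measurable_fun setT f ->
  mu.-integrable (t @^-1` D) (EFin \o (f \o t)) ->
  \int[mu]_(u in D) f u = \int[mu]_(u in t @^-1` D) f (t u).
Proof.
move=> mt pt mD mf intf; rewrite /Rintegral; congr fine.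
have mEf : measurable_fun setT (EFin \o f) by exact/measurable_EFinP.
apply: etrans (integral_pushforward mt mEf intf mD).
by apply: eq_measure_integral => A mA _; exact/esym/pt.
Qed.

(** The triangle that a line cuts off from the first quadrant. The free parameters
    [a] and [b] make maps of determinant one sufficient to reach every triangle
    with a vertex at the origin. *)
Definition corner (a b : R) : set (R * R) :=
  [set u | [/\ 0 <= u.1, 0 <= u.2 & a * u.1 + b * u.2 <= 1]].

Lemma measurable_halfplane (a b c : R) :
  measurable [set u : RR * RR | a * u.1 + b * u.2 <= c].
Proof.
have := measurable_coord_lin a b; move=> /(_ measurableT `]-oo, c]%classic).
rewrite setTI => h; have := h (measurable_itv _); congr (measurable _).
Qed.

Lemma measurable_corner (a b : R) : measurable (corner a b : set (RR * RR)).
Proof.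
have := measurableI _ _ (measurableI _ _ (measurable_halfplane (-1) 0 0)
  (measurable_halfplane 0 (-1) 0)) (measurable_halfplane a b 1).
congr (measurable _); apply/seteqP; split => u /=.
  by case=> -[]; rewrite !mul0r addr0 add0r !mulN1r !oppr_le0.
by case=> *; rewrite !mul0r addr0 add0r !mulN1r !oppr_le0.
Qed.

(** The integrand is [x] times the length of the vertical slice of the corner
    triangle at abscissa [x]. *)
Lemma integral_cubic (a b : R) : 0 < a -> 0 < b ->
  (\int[leb]_(x in `[0%R, a^-1%R]) (x * ((1 - a * x) / b))%R%:E
   = ((6 * a ^+ 2 * b)^-1)%R%:E)%E.
Proof.
move=> a0 b0.
pose F (x : R) : R := x ^+ 2 / (2 * b) - a * x ^+ 3 / (3 * b).
have dF (x : R) : is_derive x 1 F (x * ((1 - a * x) / b)).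
  rewrite /F; apply: is_derive_eq.
  rewrite /= /GRing.scale/=; field.
  by rewrite gt_eqF.
have cF : continuous F.
  by move=> x; apply: differentiable_continuous; apply/derivable1_diffP; have [] := dF x.
rewrite (@continuous_FTC2 _ _ F).
- rewrite /F -EFinB; congr (_%:E); field.
  by rewrite !gt_eqF.
- by rewrite invr_gt0.
- apply: continuous_subspaceT => x.
  apply: cvgM; first exact: cvg_id.
  apply: cvgM; last exact: cvg_cst.
  by apply: cvgB; [exact: cvg_cst|apply: cvgM; [exact: cvg_cst|exact: cvg_id]].
- split.
  + by move=> x _; have [] := dF x.
  + by apply: cvg_at_right_filter; exact: cF.
  + by apply: cvg_at_left_filter; exact: cF.
- by move=> x _; rewrite derive1E; have [] := dF x.
Qed.

End Linear.

(** * Moments of a corner triangle *)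

Section Corner.
Variable R : realType.
Local Notation leb := (@lebesgue_measure R).
Local Notation mu := (@planar_measure R).
Local Notation RR := (measurableTypeR R).

Lemma corner_slice (a b x : R) : 0 < a -> 0 < b ->
  (\int[leb]_y (((fun u : RR * RR => (u.1)%:E) \_ (corner a b)) (x, y))
   = ((fun x : RR => (x * ((1 - a * x) / b))%R%:E) \_ `[0%R, a^-1%R]) x)%E.
Proof.
move=> a0 b0; rewrite [RHS]patchE; case: ifPn => [|xN].
  rewrite inE/= in_itv/= => /andP[x0 xa].
  have ax1 : a * x <= 1 by rewrite mulrC -ler_pdivlMr// mul1r.
  transitivity (\int[leb]_(y in `[0%R, ((1 - a * x) / b)%R]) (cst x%:E y))%E.
    rewrite [RHS]integral_mkcond; apply: eq_integral => y _.
    rewrite !patchE; congr (if _ then _ else _); apply/idP/idP; rewrite !inE/= /corner/= in_itv/=.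
      by case=> _ -> h; rewrite ler_pdivlMr//; lra.
    by move=> /andP[y0]; rewrite ler_pdivlMr// => h; split=> //; lra.
  rewrite integral_cst//= lebesgue_measure_itv/= lte_fin.
  case: ifPn => [_|]; first by rewrite -EFinD -EFinM subr0.
  rewrite -leNgt => h; rewrite mule0; congr (_%:E).
  have : 0 <= (1 - a * x) / b by rewrite divr_ge0 ?subr_ge0// ltW.
  by move=> h2; rewrite (@le_anti _ _ ((1 - a * x) / b) 0) ?h ?h2 ?mulr0.
rewrite integral0_eq// => y _; rewrite patchE; case: ifPn => //.
rewrite inE /corner/= => -[x0 y0 h]; exfalso; move/negP: xN; apply.
rewrite inE/= in_itv/= x0/= -[a^-1]mul1r ler_pdivlMr//.
by have := mulr_ge0 (ltW b0) y0; lra.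
Qed.

Lemma corner_moment1 (a b : R) : 0 < a -> 0 < b ->
  \int[mu]_(u in corner a b) u.1 = (6 * a ^+ 2 * b)^-1.
Proof.
move=> a0 b0; rewrite /Rintegral.
rewrite integral_mkcond /planar_measure fubini_tonelli1; last 2 first.
- apply/(measurable_restrictT _ (measurable_corner a b)).
  apply/measurable_EFinP; apply: measurable_funTS; exact: measurable_fst.
- by move=> u; rewrite patchE; case: ifPn => //; rewrite inE lee_fin => -[].
transitivity (fine (\int[leb]_(x in `[0%R, a^-1%R]) (x * ((1 - a * x) / b))%R%:E)%E).
  congr fine; rewrite [RHS]integral_mkcond; apply: eq_integral => x _.
  by rewrite /fubini_F corner_slice.
by rewrite integral_cubic.
Qed.

Lemma lin2_bounded_integrable (D : set (RR * RR)) (p q M : R) :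
  measurable D -> (forall u, D u -> `|u.1| <= M /\ `|u.2| <= M) ->
  mu.-integrable D (EFin \o (fun u : RR * RR => p * u.1 + q * u.2)).
Proof.
move=> mD bD; apply: measurable_bounded_integrable => //.
- apply: (@le_lt_trans _ _ (mu (`[- M, M] `*` `[- M, M]))).
    apply: le_measure; rewrite ?inE//; first exact: measurableX.
    move=> u /bD; rewrite /= !in_itv/= !ler_norml => -[-> ->] //.
  rewrite [X in (X < _)%E]product_measure1E//.
  have fM : (leb [set` `[(- M)%R, M]] < +oo)%E.
    by rewrite lebesgue_measure_itv/=; case: ifP => _; rewrite ?ltry// -EFinD ltry.
  by apply: lte_mul_pinfty => //; by rewrite ge0_fin_numE.
- by apply: measurable_funTS; exact: measurable_coord_lin.
exists ((`|p| + `|q|) * `|M|); split; first exact: num_real.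
move=> x xM u /bD[u1 u2] /=; apply: le_trans (ltW xM).
rewrite (le_trans (ler_normD _ _))// mulrDl !normrM lerD// ler_wpM2l//.
  by rewrite (le_trans u1)// ler_norm.
by rewrite (le_trans u2)// ler_norm.
Qed.

Lemma corner_bounded (a b : R) u : 0 < a -> 0 < b -> corner a b u ->
  `|u.1| <= a^-1 + b^-1 /\ `|u.2| <= a^-1 + b^-1.
Proof.
move=> a0 b0 [u1 u2 h]; rewrite !ger0_norm//.
have ai : 0 < a^-1 by rewrite invr_gt0.
have bi : 0 < b^-1 by rewrite invr_gt0.
have h1 := mulr_ge0 (ltW a0) u1; have h2 := mulr_ge0 (ltW b0) u2.
split.
  by apply: ler_wpDr; [exact: ltW|rewrite -[a^-1]mul1r ler_pdivlMr//; lra].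
by apply: ler_wpDl; [exact: ltW|rewrite -[b^-1]mul1r ler_pdivlMr//; lra].
Qed.

(** Swapping the coordinates exchanges the two parameters. *)
Lemma corner_moment2 (a b : R) : 0 < a -> 0 < b ->
  \int[mu]_(u in corner a b) u.2 = (6 * a * b ^+ 2)^-1.
Proof.
move=> a0 b0.
have -> : 6 * a * b ^+ 2 = 6 * b ^+ 2 * a by ring.
rewrite -(corner_moment1 b0 a0).
have e : corner a b = [set u | corner b a (u.2, u.1)].
  by apply/seteqP; split=> u; rewrite /corner/= addrC => -[].
rewrite [RHS](@Rintegral_preserved R (fun u => (u.2, u.1))).
- by rewrite e.
- by apply: measurable_fun_pair; [exact: measurable_snd|exact: measurable_fst].
- exact: planar_swap.
- exact: measurable_corner.
- exact: measurable_fst.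
- rewrite [X in _.-integrable X _](_ : _ = corner a b) ?e//.
  have := @lin2_bounded_integrable (corner a b) 0 1 _ (measurable_corner a b)
    (fun u => @corner_bounded a b u a0 b0).
  by rewrite e; congr (mu.-integrable _ _); apply/funext => u /=; rewrite mul0r mul1r add0r.
Qed.

End Corner.

(** * Counterclockwise polygons and the moments of a normal wedge *)

(** On integers this is the determinant [det2]. *)
Definition cross (T : realDomainType) (a b : T * T) : T := a.1 * b.2 - a.2 * b.1.

(** The strict inequalities make every entry a vertex and keep the origin off the
    edges. *)
Definition convex_ccw (T : realDomainType) (s : seq (T * T)) : Prop :=
  [/\ uniq s, (2 < size s)%N,
      forall v, v \in s -> 0 < cross v (next s v) &
      forall v w, v \in s -> w \in s -> w != v -> w != next s v ->
        0 < cross (next s v - v) (w - v)].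

Section ConvexCcw.
Variables (T : realDomainType) (s : seq (T * T)).
Hypothesis cs : convex_ccw s.

Let us : uniq s. Proof. by case: cs. Qed.

Lemma next_neq v : v \in s -> next s v != v.
Proof.
case: cs => _ _ h _ vs; apply/eqP => e; have := h v vs.
by rewrite e /cross mulrC subrr ltxx.
Qed.

Lemma prev_neq v : v \in s -> prev s v != v.
Proof.
move=> vs; have := @next_neq (prev s v); rewrite mem_prev => /(_ vs).
by rewrite (next_prev us) eq_sym.
Qed.

Lemma prev_neq_next v : v \in s -> prev s v != next s v.
Proof.
move=> vs; apply/eqP => e; have := cs => -[_ _ h _].
have := h v vs; have := h (prev s v); rewrite mem_prev => /(_ vs).
by rewrite (next_prev us) e /cross; lra.
Qed.

Lemma cross_corner v : v \in s -> 0 < cross (next s v - v) (prev s v - v).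
Proof.
move=> vs; have := cs => -[_ _ _ h]; apply: h => //; first by rewrite mem_prev.
  exact: prev_neq.
exact: prev_neq_next.
Qed.

Lemma left_of_next v w : v \in s -> w \in s -> 0 <= cross (next s v - v) (w - v).
Proof.
move=> vs ws; have [->|wv] := eqVneq w v; first by rewrite subrr /cross/= !mulr0 subrr.
have [->|wn] := eqVneq w (next s v); first by rewrite /cross mulrC subrr.
by have := cs => -[_ _ _ h]; exact/ltW/h.
Qed.

Lemma left_of_prev v w : v \in s -> w \in s -> 0 <= cross (w - v) (prev s v - v).
Proof.
move=> vs ws; have := @left_of_next (prev s v) w.
rewrite mem_prev (next_prev us) => /(_ vs ws); rewrite /cross/=; lra.
Qed.

End ConvexCcw.

Lemma argmin_seq (T : eqType) (R : realDomainType) (f : T -> R) (s : seq T) :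
  s != [::] -> exists2 w, w \in s & forall v, v \in s -> f w <= f v.
Proof.
elim: s => // x s IH _; have [->|/IH[w ws hw]] := eqVneq s [::].
  by exists x => [|v]; rewrite !inE// => /eqP ->.
have [h|h] := leP (f x) (f w).
  exists x; rewrite ?mem_head// => v; rewrite inE => /orP[/eqP->//|/hw].
  exact: le_trans.
exists w; rewrite ?inE ?ws ?orbT// => v; rewrite inE => /orP[/eqP->|/hw//].
exact: ltW.
Qed.

Section Moments.
Variable R : realType.
Local Notation leb := (@lebesgue_measure R).
Local Notation mu := (@planar_measure R).
Local Notation RR := (measurableTypeR R).

Definition dot (u v : R * R) : R := u.1 * v.1 + u.2 * v.2.

(** The part of the dual polygon on which the vertex [w] with neighbours [p] and
    [n] attains the minimum among all vertices: a triangle with a vertex at the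
    origin. *)
Definition wedge (p w n : R * R) : set (R * R) :=
  [set u | [/\ -1 <= dot u w, 0 <= dot u (n - w) & 0 <= dot u (p - w)]].

(** The coordinates [<u, n - w>] and [<u, p - w> / D] have determinant one and
    carry the wedge to a corner triangle, because [- <u, w>] is a combination of
    them with the positive coefficients [cross p w / D] and [cross w n]. *)
Lemma wedge_moment (p w n : R * R) (c1 c2 : R) :
  let D := cross (n - w) (p - w) in
  0 < cross p w -> 0 < cross w n -> 0 < D ->
  \int[mu]_(u in wedge p w n) (c1 * u.1 + c2 * u.2) =
  D / (6 * cross p w * cross w n) *
   (c2 * ((w - p).1 / cross p w + (n - w).1 / cross w n)
    - c1 * ((w - p).2 / cross p w + (n - w).2 / cross w n)).
Proof.
move=> D p0 w0 D0.
pose m11 := (n - w).1; pose m12 := (n - w).2.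
pose m21 := (p - w).1 / D; pose m22 := (p - w).2 / D.
have Dn0 : D != 0 by rewrite gt_eqF.
have De : D = m11 * (p - w).2 - m12 * (p - w).1 by [].
have detM : m11 * m22 - m12 * m21 = 1.
  by rewrite /m22 /m21 !mulrA -mulrBl -De divff.
pose a := cross p w / D; pose b := cross w n.
have a0 : 0 < a by rewrite divr_gt0.
pose g1 := c1 * m22 - c2 * m21; pose g2 := c2 * m11 - c1 * m12.
have wE : wedge p w n = [set u | corner a b (lin2 m11 m12 m21 m22 u)].
  have key u : a * (m11 * u.1 + m12 * u.2) + b * (m21 * u.1 + m22 * u.2) = - dot u w.
    rewrite /a /b /m11 /m12 /m21 /m22 /dot; apply: (mulIf Dn0).
    transitivity (cross p w * ((n - w).1 * u.1 + (n - w).2 * u.2) + cross w n * ((p - w).1 * u.1 + (p - w).2 * u.2)).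
      by field.
    by rewrite De /m11 /m12 /cross/=; ring.
  have k2 u : m21 * u.1 + m22 * u.2 = dot u (p - w) / D.
    by rewrite /m21 /m22 /dot; ring.
  apply/seteqP; split=> u; rewrite /wedge /corner /lin2/= key.
    by case=> h1 h2 h3; split; rewrite ?k2 ?divr_ge0//; move: h1 h2; rewrite /dot/= /m11 /m12 /=; lra.
  case=> h1 h2 h3; split; [by lra|by move: h1; rewrite /dot /m11 /m12; lra|].
  by move: h2; rewrite k2 pmulr_lge0// invr_gt0.
transitivity (\int[mu]_(v in corner a b) (g1 * v.1 + g2 * v.2)).
  rewrite [RHS](@Rintegral_preserved R (lin2 m11 m12 m21 m22)).
  - rewrite wE; apply: eq_Rintegral => u _; rewrite /g1 /g2 /lin2/=.
    transitivity ((m11 * m22 - m12 * m21) * (c1 * u.1 + c2 * u.2)); last by ring.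
    by rewrite detM mul1r.
  - exact: measurable_linear_map.
  - by move=> A mA; exact: planar_linear.
  - exact: measurable_corner.
  - exact: measurable_coord_lin.
  - rewrite (_ : EFin \o _ = EFin \o (fun u : RR * RR => c1 * u.1 + c2 * u.2)).
      pose M := a^-1 + b^-1.
      apply: (@lin2_bounded_integrable R _ _ _ ((`|m22| + `|m12| + `|m21| + `|m11|) * M)).
        exact: (measurable_lin2 m11 m12 m21 m22 (measurable_corner a b)).
      move=> u /corner_bounded-/(_ a0 w0); rewrite -/M /lin2/=.
      set al := m11 * u.1 + _; set be := m21 * u.1 + _ => -[la lb].
      have -> : u.1 = m22 * al - m12 * be.
        by rewrite -[LHS]mul1r -detM /al /be; ring.
      have -> : u.2 = m11 * be - m21 * al.
        by rewrite -[LHS]mul1r -detM /al /be; ring.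
      have M0 : 0 <= M by exact: le_trans la.
      have h (x y : R) : `|y| <= M -> `|x * y| <= `|x| * M.
        by move=> ?; rewrite normrM ler_wpM2l.
      have h2 (x : R) := mulr_ge0 (normr_ge0 x) M0.
      have := h m22 _ la; have := h m12 _ lb; have := h m11 _ lb; have := h m21 _ la.
      have := h2 m22; have := h2 m12; have := h2 m11; have := h2 m21.
      move=> *; split; apply: le_trans (ler_normB _ _) _; lra.
    apply/funext => u /=; congr (_%:E); rewrite /g1 /g2 /lin2/=.
    transitivity ((m11 * m22 - m12 * m21) * (c1 * u.1 + c2 * u.2)); first by ring.
    by rewrite detM mul1r.
have int1 (c d : R) : mu.-integrable (corner a b) (EFin \o (fun u => c * u.1 + d * u.2)).
  apply: lin2_bounded_integrable; first exact: measurable_corner.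
  by move=> u; exact: corner_bounded.
have i1 : mu.-integrable (corner a b) (EFin \o fst).
  by have := int1 1 0; congr (mu.-integrable _ _); apply/funext => u /=; rewrite mul0r mul1r addr0.
have i2 : mu.-integrable (corner a b) (EFin \o snd).
  by have := int1 0 1; congr (mu.-integrable _ _); apply/funext => u /=; rewrite mul0r mul1r add0r.
have mS := measurable_corner a b.
rewrite RintegralD//; last 2 first.
- by have := int1 g1 0; congr (mu.-integrable _ _); apply/funext => u /=; rewrite mul0r addr0.
- by have := int1 0 g2; congr (mu.-integrable _ _); apply/funext => u /=; rewrite mul0r add0r.
rewrite !RintegralZl// corner_moment1// corner_moment2//.
rewrite /g1 /g2 /m11 /m12 /m21 /m22 /a /b; set x1 := cross p w; set x2 := cross w n.
rewrite /=; field; by rewrite !gt_eqF.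
Qed.

End Moments.

(** * Moments of a dual polygon *)

Section PolygonMoment.
Variable R : realType.
Local Notation leb := (@lebesgue_measure R).
Local Notation mu := (@planar_measure R).
Local Notation RR := (measurableTypeR R).

Lemma measurable_line (a b : R) :
  measurable [set u : RR * RR | a * u.1 + b * u.2 = 0].
Proof.
have := measurableI _ _ (measurable_halfplane a b 0) (measurable_halfplane (- a) (- b) 0).
congr (measurable _); apply/seteqP; split => u /=; first by case; lra.
by move=> h; split; lra.
Qed.

Lemma line_null_aux (a b : R) : b != 0 ->
  mu [set u | a * u.1 + b * u.2 = 0] = 0%E.
Proof.
move=> b0; rewrite /planar_measure /product_measure1.
rewrite integral0_eq// => x _ /=.
rewrite (_ : xsection _ _ = [set - (a * x) / b]) ?lebesgue_measure_set1//.
apply/seteqP; split => y /=; rewrite /xsection/= inE/=.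
  by move=> h; apply: (mulIf b0); rewrite mulfVK//; lra.
by move=> ->; field.
Qed.

(** The vertical slices of a line that is not vertical are points; a vertical line
    is swapped to a horizontal one. *)
Lemma line_null (a b : R) : (a, b) != 0 ->
  mu [set u | a * u.1 + b * u.2 = 0] = 0%E.
Proof.
move=> ab0; have [b0|] := eqVneq b 0; last exact: line_null_aux.
have a0 : a != 0 by apply: contra_neq ab0 => ->; rewrite b0.
rewrite -[RHS](line_null_aux b a0) -[LHS]planar_swap; last exact: measurable_line.
by congr (mu _); apply/funext => u /=; rewrite addrC.
Qed.

Variable s : seq (R * R).
Hypothesis cs : convex_ccw s.
Let us : uniq s. Proof. by case: cs. Qed.

Definition dual_of : set (R * R) := [set u | forall v, v \in s -> -1 <= dot u v].

Definition wedge_at (w : R * R) := wedge (prev s w) w (next s w).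

(** Minimality against the two neighbours suffices: by convexity [v - w] is a
    combination of [n - w] and [p - w] with nonnegative coefficients. *)
Lemma wedge_min w v u : w \in s -> v \in s -> wedge_at w u -> dot u w <= dot u v.
Proof.
move=> ws vs [_ hn hp].
have D0 := cross_corner cs ws.
have h1 := left_of_next cs ws vs; have h2 := left_of_prev cs ws vs.
rewrite -subr_ge0 -(pmulr_rge0 _ D0).
have -> : cross (next s w - w) (prev s w - w) * (dot u v - dot u w) =
  cross (v - w) (prev s w - w) * dot u (next s w - w) +
  cross (next s w - w) (v - w) * dot u (prev s w - w).
  by rewrite /cross /dot/=; ring.
by rewrite addr_ge0// mulr_ge0.
Qed.

Lemma measurable_dot (v : R * R) (c : R) : measurable [set u : RR * RR | c <= dot u v].
Proof.
have := measurable_halfplane (- v.1) (- v.2) (- c); congr (measurable _).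
by apply/seteqP; split=> u /=; rewrite /dot; lra.
Qed.

Lemma measurable_wedge p w n : measurable (wedge p w n : set (RR * RR)).
Proof.
have := measurableI _ _ (measurableI _ _ (measurable_dot w (-1))
  (measurable_dot (n - w) 0)) (measurable_dot (p - w) 0).
by congr (measurable _); apply/seteqP; split=> u /=; [case=> -[]|case].
Qed.

Lemma measurable_dual_of : measurable (dual_of : set (RR * RR)).
Proof.
rewrite (_ : dual_of = \bigcap_(v in [set` s]) [set u | -1 <= dot u v]).
  by apply: fin_bigcap_measurable => // v _; exact: measurable_dot.
by apply/seteqP; split=> u /= h v; exact: h.
Qed.

(** Every functional attains its minimum at some vertex, so that the wedges cover
    the dual polygon; it attains it at two vertices only on finitely many lines,
    which are null sets. *)
Lemma polygon_moment (M c1 c2 : R) :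
  (forall u, dual_of u -> `|u.1| <= M /\ `|u.2| <= M) ->
  \int[mu]_(u in dual_of) (c1 * u.1 + c2 * u.2) =
  \sum_(w <- s) \int[mu]_(u in wedge_at w) (c1 * u.1 + c2 * u.2).
Proof.
move=> bK; pose f (u : RR * RR) := c1 * u.1 + c2 * u.2.
have wK w : w \in s -> wedge_at w `<=` dual_of.
  move=> ws u wu v vs; have [h _ _] := wu.
  exact: le_trans (wedge_min ws vs wu).
have iw w : w \in s -> mu.-integrable (wedge_at w) (EFin \o f).
  move=> ws; apply: lin2_bounded_integrable; first exact: measurable_wedge.
  by move=> u wu; apply: bK; exact: wK wu.
have iT w : mu.-integrable setT ((EFin \o f) \_ (if w \in s then wedge_at w else set0)).
  case: ifP => ws; last exact/(integrable_mkcond _ measurable0)/integrable_set0.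
  apply/(integrable_mkcond _ (measurable_wedge _ _ _)); exact: iw.
have mf : measurable_fun setT (EFin \o f).
  by apply/measurable_EFinP; exact: measurable_coord_lin.
(* the points where two vertices agree as functionals *)
pose prs := [seq (v, w) | v <- s, w <- s].
pose N : set (RR * RR) := \bigcup_k let q := nth 0 prs k in
  if q.1 == q.2 then set0
  else [set u : RR * RR | (q.1 - q.2).1 * u.1 + (q.1 - q.2).2 * u.2 = 0].
have N0 : mu.-negligible N.
  apply: negligible_bigcup => k /=; case: (nth 0 prs k) => -[a b] [c d] /=.
  case: eqP => [_|/eqP ne]; first exact: negligible_set0.
  apply/negligibleP; first exact: measurable_line.
  by apply: line_null; apply: contraNneq ne => -[/subr0_eq-> /subr0_eq->].
have NP v w u : v \in s -> w \in s -> v != w -> dot u v = dot u w -> N u.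
  move=> vs ws vw e; exists (index (v, w) prs) => //=.
  rewrite nth_index; last by apply/allpairsP; exists (v, w).
  by rewrite (negbTE vw) /=; move: e; rewrite /dot; lra.
have E : (\int[mu]_(u in dual_of) (f u)%:E = \sum_(w <- s) \int[mu]_(u in wedge_at w) (f u)%:E)%E.
  transitivity (\int[mu]_u (\sum_(w <- s | true) ((EFin \o f) \_ (if w \in s then wedge_at w else set0)) u))%E.
    rewrite integral_mkcond; apply: ae_eq_integral => //.
    - apply/(measurable_restrictT _ measurable_dual_of); exact: measurable_funTS.
    - apply: emeasurable_sum => w; apply/measurable_int/iT.
    - apply: (negligibleS _ N0) => u /= h; apply: contrapT => Nu; apply: h => _.
      have [w0 w0s hw0] : exists2 w, w \in s & forall v, v \in s -> dot u w <= dot u v.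
        by apply: argmin_seq; have := cs => -[_]; case: (s).
      rewrite (bigD1_seq w0)//= w0s [X in (_ + X)%E]big1_seq ?adde0; last first.
        move=> w /andP[ww0 ws]; rewrite ws patchE; case: ifPn => //; rewrite inE => wu.
        have e : dot u w = dot u w0 by apply/le_anti; rewrite hw0// wedge_min.
        by case: Nu; exact: NP e.
      rewrite !patchE; congr (if _ then _ else _); apply/idP/idP; rewrite !inE.
        move=> Ku; split; first exact: Ku.
          have := hw0 (next s w0); rewrite mem_next => /(_ w0s).
          by rewrite /dot/=; lra.
        have := hw0 (prev s w0); rewrite mem_prev => /(_ w0s).
        by rewrite /dot/=; lra.
      exact: wK.
  rewrite integral_sum// big_seq [RHS]big_seq; apply: eq_bigr => w ws.
  by rewrite ws -integral_mkcond.
rewrite /Rintegral E -[RHS]/(fine (\sum_(w <- s) fine (\int[mu]_(u in wedge_at w) (f u)%:E))%:E).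
rewrite -sumEFin; congr fine; rewrite big_seq [RHS]big_seq; apply: eq_bigr => w ws.
rewrite fineK//; apply: integrable_fin_num; [exact: measurable_wedge|exact: iw].
Qed.

End PolygonMoment.

(** * Barycenters of dual polygons *)

Section EdgeVectors.
Variables (F : realFieldType) (s : seq (F * F)).
Hypothesis cs : convex_ccw s.
Let us : uniq s. Proof. by case: cs. Qed.

(** The vertex of the dual polygon that belongs to the edge starting at [v], turned
    by a quarter turn: the scalar product with it becomes [cross], and
    [cross v (dual_vertex s v) = cross (next s v) (dual_vertex s v) = 1]. *)
Definition dual_vertex (s : seq (F * F)) (v : F * F) : F * F :=
  ((next s v - v).1 / cross v (next s v), (next s v - v).2 / cross v (next s v)).

Lemma sum_next (V : nmodType) (G : F * F -> V) :
  \sum_(v <- s) G (next s v) = \sum_(v <- s) G v.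
Proof.
rewrite -(big_map (next s) xpredT); apply: perm_big; apply: uniq_perm => //.
  by rewrite map_inj_in_uniq// => x y _ _; apply: can_inj (prev_next us) _ _.
move=> v; apply/mapP/idP => [[w ws ->]|vs]; first by rewrite mem_next.
by exists (prev s v); rewrite ?mem_prev// (next_prev us).
Qed.

End EdgeVectors.

Section KE.
Variable R : realType.
Local Notation leb := (@lebesgue_measure R).
Local Notation mu := (@planar_measure R).
Local Notation RR := (measurableTypeR R).

Lemma polygon_moment_edges (s : seq (R * R)) (M c1 c2 : R) : convex_ccw s ->
  (forall u, dual_of s u -> `|u.1| <= M /\ `|u.2| <= M) ->
  6 * \int[mu]_(u in dual_of s) (c1 * u.1 + c2 * u.2) =
  \sum_(v <- s) cross (dual_vertex s v) (dual_vertex s (next s v)) *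
    (c2 * ((dual_vertex s v).1 + (dual_vertex s (next s v)).1)
     - c1 * ((dual_vertex s v).2 + (dual_vertex s (next s v)).2)).
Proof.
move=> cs bK; have us : uniq s by case: cs.
rewrite (polygon_moment cs _ _ bK) mulr_sumr -[LHS](sum_next cs).
rewrite big_seq [RHS]big_seq; apply: eq_bigr => v vs.
rewrite /wedge_at wedge_moment; last 3 first.
- by rewrite (prev_next us); case: cs => _ _ h _; exact: h.
- by case: cs => _ _ h _; apply: h; rewrite mem_next.
- by apply: cross_corner => //; rewrite mem_next.
have d1 : cross v (next s v) != 0 by case: cs => _ _ h _; rewrite gt_eqF// h.
have d2 : cross (next s v) (next s (next s v)) != 0.
  by case: cs => _ _ h _; rewrite gt_eqF// h// mem_next.
rewrite !(prev_next us) /dual_vertex; set w := next s v in d1 d2 *; set z := next s w in d2 *.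
set e1 := cross v w in d1 *; set e2 := cross w z in d2 *.
rewrite /cross/=; field; by apply/andP.
Qed.

Lemma integrable_coords (D : set (RR * RR)) (M : R) : measurable D ->
  (forall u, D u -> `|u.1| <= M /\ `|u.2| <= M) ->
  mu.-integrable D (EFin \o fst) /\ mu.-integrable D (EFin \o snd).
Proof.
move=> mD bD; split.
  have := lin2_bounded_integrable 1 0 mD bD; congr (mu.-integrable _ _).
  by apply/funext => u /=; rewrite mul0r mul1r addr0.
have := lin2_bounded_integrable 0 1 mD bD; congr (mu.-integrable _ _).
by apply/funext => u /=; rewrite mul0r mul1r add0r.
Qed.

Lemma Rintegral_linear_form (D : set (RR * RR)) (M c1 c2 : R) : measurable D ->
  (forall u, D u -> `|u.1| <= M /\ `|u.2| <= M) ->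
  \int[mu]_(u in D) (c1 * u.1 + c2 * u.2) =
  c1 * \int[mu]_(u in D) u.1 + c2 * \int[mu]_(u in D) u.2.
Proof.
move=> mD bD; have [i1 i2] := integrable_coords mD bD.
rewrite RintegralD ?RintegralZl//.
  have := lin2_bounded_integrable c1 0 mD bD; congr (mu.-integrable _ _).
  by apply/funext => u /=; rewrite mul0r addr0.
have := lin2_bounded_integrable 0 c2 mD bD; congr (mu.-integrable _ _).
by apply/funext => u /=; rewrite mul0r add0r.
Qed.

(** The vector of first moments is fixed by the map, and [2 - (a + d)] is the
    determinant of the difference of the identity and the map, so that 0 is the
    only fixed vector. *)
Lemma barycenter_invariant (D : set (RR * RR)) (M a b c d : R) : measurable D ->
  (forall u, D u -> `|u.1| <= M /\ `|u.2| <= M) ->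
  a * d - b * c = 1 -> a + d != 2 ->
  (forall u, D (lin2 a b c d u) <-> D u) ->
  barycenter D = 0.
Proof.
move=> mD bD abcd tr inv.
have DE : lin2 a b c d @^-1` D = D by apply/seteqP; split => u /inv.
have h c1 c2 : \int[mu]_(u in D) (c1 * u.1 + c2 * u.2) =
    \int[mu]_(u in D) ((c1 * a + c2 * c) * u.1 + (c1 * b + c2 * d) * u.2).
  rewrite (@Rintegral_preserved R (lin2 a b c d)).
  - rewrite DE; apply: eq_Rintegral => u _; rewrite /lin2/=; ring.
  - exact: measurable_linear_map.
  - by move=> A mA; exact: planar_linear.
  - exact: mD.
  - exact: measurable_coord_lin.
  - rewrite DE.
    have := lin2_bounded_integrable (c1 * a + c2 * c) (c1 * b + c2 * d) mD bD.
    congr (mu.-integrable _ _).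
    apply/funext => u /=; rewrite /lin2/=; congr (_%:E); ring.
have := h 1 0; have := h 0 1; rewrite !(Rintegral_linear_form _ _ mD bD).
rewrite /barycenter; set I1 := \int[mu]_(u in D) u.1; set I2 := \int[mu]_(u in D) u.2.
move=> e2 e1; have tr' : 2 - (a + d) != 0 by rewrite subr_eq0 eq_sym.
have z1 : I1 = 0.
  apply: (mulIf tr'); rewrite mul0r.
  have -> : I1 * (2 - (a + d)) = (I1 - (a * I1 + b * I2)) * (1 - d) + b * (I2 - (c * I1 + d * I2)) - (1 - (a * d - b * c)) * -I1 by ring.
  rewrite abcd subrr mul0r subr0.
  have -> : I1 - (a * I1 + b * I2) = 0 by lra.
  have -> : I2 - (c * I1 + d * I2) = 0 by lra.
  by rewrite mul0r mulr0 addr0.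
have z2 : I2 = 0.
  apply: (mulIf tr'); rewrite mul0r.
  have -> : I2 * (2 - (a + d)) = (I2 - (c * I1 + d * I2)) * (1 - a) + c * (I1 - (a * I1 + b * I2)) - (1 - (a * d - b * c)) * -I2 by ring.
  rewrite abcd subrr mul0r subr0.
  have -> : I1 - (a * I1 + b * I2) = 0 by lra.
  have -> : I2 - (c * I1 + d * I2) = 0 by lra.
  by rewrite mul0r mulr0 addr0.
by rewrite z1 z2; congr pair; rewrite /= ?scaler0.
Qed.

Lemma box_measure (M : R) : 0 < M ->
  mu ([set` `[- M, M]] `*` [set` `[- M, M]]) = (4 * M ^+ 2)%:E.
Proof.
move=> M0; rewrite [LHS]product_measure1E//.
have E : leb [set` `[- M, M]] = (2 * M)%:E.
  rewrite lebesgue_measure_itv/= lte_fin gtrN// -EFinD; congr (_%:E); ring.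
transitivity ((2 * M)%:E * (2 * M)%:E)%E; first by congr (_ * _)%E; exact: E.
by rewrite -EFinM; congr (_%:E); ring.
Qed.

(** The dual polygon is bounded and contains a small square, so that its area is a
    positive real number; were it infinite, [fine] would turn it into 0 and the
    barycenter would say nothing about the moments. *)
Lemma dual_of_measure (s : seq (R * R)) (M : R) :
  (forall u, dual_of s u -> `|u.1| <= M /\ `|u.2| <= M) ->
  fine (mu (dual_of s)) != 0.
Proof.
move=> bK.
pose N := 1 + \sum_(v <- s) (`|v.1| + `|v.2|).
have N0 : 0 < N by rewrite ltr_wpDr//; apply: sumr_ge0 => v _; exact: addr_ge0.
have m0 : 0 < N^-1 by rewrite invr_gt0.
have sub : [set` `[- N^-1, N^-1]] `*` [set` `[- N^-1, N^-1]] `<=` dual_of s.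
  move=> u [/=]; rewrite !in_itv/= -!ler_norml => u1 u2 v vs.
  have vN : `|v.1| + `|v.2| <= N.
    rewrite /N (big_rem v)//= addrCA lerDl; apply: addr_ge0 => //.
    by apply: sumr_ge0 => w _; exact: addr_ge0.
  have : `|dot u v| <= 1.
    rewrite (le_trans (ler_normD _ _))// !normrM.
    apply: (@le_trans _ _ (N^-1 * (`|v.1| + `|v.2|))).
      by rewrite mulrDr lerD// ler_wpM2r.
    by rewrite mulrC ler_pdivrMr// mul1r.
  by rewrite ler_norml => /andP[].
have mK := measurable_dual_of s.
have M0 : 0 <= M.
  have [] := bK 0; last by move=> h _; apply: le_trans h.
  by move=> v vs; rewrite /dot/= !mul0r addr0 lerN10.
have M1 : 0 < M + 1 by rewrite ltr_wpDl.
have fin : mu (dual_of s) \is a fin_num.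
  rewrite ge0_fin_numE//; apply: (@le_lt_trans _ _ (4 * (M + 1) ^+ 2)%:E); last exact: ltry.
  rewrite -box_measure//; apply: le_measure; rewrite ?inE//; first exact: measurableX.
  move=> u /bK; rewrite /= !in_itv/= -!ler_norml => -[h1 h2].
  by split; [apply: le_trans h1 _|apply: le_trans h2 _]; rewrite lerDl.
rewrite gt_eqF// -lte_fin fineK//.
apply: (@lt_le_trans _ _ (4 * (N^-1) ^+ 2)%:E).
  by rewrite lte_fin mulr_gt0// exprn_gt0.
rewrite -box_measure//; apply: le_measure; rewrite ?inE//; exact: measurableX.
Qed.

(** The balance identity: the sum over the vertices of the moments of the wedges,
    rewritten in terms of the vertices of the dual polygon. *)
Lemma barycenter_edges (s : seq (R * R)) (M : R) : convex_ccw s ->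
  (forall u, dual_of s u -> `|u.1| <= M /\ `|u.2| <= M) ->
  barycenter (dual_of s) = 0 ->
  \sum_(v <- s) cross (dual_vertex s v) (dual_vertex s (next s v)) *:
    (dual_vertex s v + dual_vertex s (next s v)) = 0 :> R * R.
Proof.
move=> cs bK; rewrite /barycenter => -[/eqP + /eqP].
have K0 := dual_of_measure bK.
rewrite !mulf_eq0 !invr_eq0 !(negbTE K0) /= => /eqP i1 /eqP i2.
have := polygon_moment_edges 0 1 cs bK; have := polygon_moment_edges 1 0 cs bK.
rewrite !(Rintegral_linear_form _ _ (measurable_dual_of s) bK) i1 i2 !mulr0 addr0 mulr0 => e1 e2.
apply/eqP; rewrite -pair_eqE; apply/andP; split; apply/eqP.
  rewrite (raddf_sum fst); apply: etrans (esym e2).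
  by apply: eq_bigr => v _; rewrite mul1r mul0r subr0.
rewrite (raddf_sum snd); apply: (oppr_inj); rewrite -sumrN oppr0; apply: etrans (esym e1).
by apply: eq_bigr => v _; rewrite mul1r mul0r sub0r mulrN.
Qed.

End KE.

(** * The Minkowski inequality *)

Section Minkowski.
Variables (F : realFieldType) (s : seq (F * F)).
Hypothesis cs : convex_ccw s.
Let us : uniq s. Proof. by case: cs. Qed.
Local Notation E := (dual_vertex s).
Local Notation nx := (next s).

Lemma cross_edge v w : v \in s -> cross w (E v) = (cross v (nx v) - cross (nx v - v) (w - v)) / cross v (nx v).
Proof. by move=> vs; rewrite /dual_vertex {1}/cross/= !mulrA -mulrBl; congr (_ / _); rewrite /cross/=; ring. Qed.

Lemma cross_edge_l v : v \in s -> cross v (E v) = 1.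
Proof.
move=> vs; rewrite cross_edge// subrr [X in _ - X]/cross/= !mulr0 subrr subr0 divff//.
by rewrite gt_eqF//; case: cs => _ _ h _; exact: h.
Qed.

Lemma cross_edge_r v : v \in s -> cross (nx v) (E v) = 1.
Proof.
move=> vs; rewrite cross_edge// (_ : cross (nx v - v) (nx v - v) = 0) ?subr0 ?divff//; last by rewrite /cross mulrC subrr.
by rewrite gt_eqF//; case: cs => _ _ h _; exact: h.
Qed.

Lemma cross_edge_le1 v w : v \in s -> w \in s -> cross w (E v) <= 1.
Proof.
move=> vs ws; rewrite cross_edge// ler_pdivrMr; last by case: cs => _ _ h _; exact: h.
by rewrite mul1r gerBl; exact: left_of_next.
Qed.

Lemma cross_edge_lt1 v w : v \in s -> w \in s -> w != v -> w != nx v -> cross w (E v) < 1.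
Proof.
move=> vs ws wv wn; rewrite cross_edge// ltr_pdivrMr; last by case: cs => _ _ h _; exact: h.
by rewrite mul1r gtrBl; case: cs => _ _ _ h; exact: h.
Qed.

(** The dual polygon is convex as well. *)
Lemma cross_edges_gt0 v : v \in s -> 0 < cross (E v) (E (nx v)).
Proof.
move=> vs; have ns : nx v \in s by rewrite mem_next.
have := cross_corner cs ns; rewrite (prev_next us) => h.
have [_ _ d _] := cs; have d1 := d _ vs; have d2 := d _ ns.
have -> : cross (E v) (E (nx v)) = cross (nx (nx v) - nx v) (v - nx v) / (cross v (nx v) * cross (nx v) (nx (nx v))).
  rewrite /dual_vertex; move: d1 d2; set e1 := cross v _; set e2 := cross (nx v) _ => d1 d2.
  by rewrite {1 2}/cross/=; field; rewrite !gt_eqF.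
by rewrite divr_gt0// mulr_gt0.
Qed.

(** Both [a] and [b] lie on the line where [cross n] equals 1, so that the areas of
    the triangles over the segment from [a] to [b] with apex [q] and with apex 0
    are in the ratio of the distances of [q] and of 0 from that line. *)
Lemma fan_area (n a b q : F * F) : cross n a = 1 -> cross n b = 1 ->
  cross (a - q) (b - q) = cross a b * (1 - cross n q).
Proof.
move=> na nb.
have e : cross a b * cross n q = cross (a - b) q.
  have -> : cross a b * cross n q = cross n b * cross a q - cross n a * cross b q by rewrite /cross; ring.
  by rewrite na nb /cross/=; ring.
by rewrite mulrBr mulr1 e /cross/=; ring.
Qed.

(** The terms added when the apex moves from 0 to [q] telescope along the polygon.
    This is the identity [q * cross a b = a * cross q b - b * cross q a] in
    disguise. *)
Lemma fan_term (q a b : F * F) : cross (a - q) (b - q) *: (a + b + q) =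
  cross a b *: (a + b) + (cross q a *: (a + q) - cross q b *: (b + q)).
Proof.
case: q a b => q1 q2 [a1 a2] [b1 b2]; apply/eqP; rewrite -pair_eqE.
by apply/andP; split; apply/eqP; rewrite /cross /= /GRing.scale/=; ring.
Qed.

Hypothesis KE : \sum_(v <- s) cross (E v) (E (nx v)) *: (E v + E (nx v)) = 0 :> F * F.

Lemma fan_identity (q : F * F) :
  \sum_(v <- s) cross (E v - q) (E (nx v) - q) *: (E v + E (nx v) + q) = 0 :> F * F.
Proof.
pose G (x : F * F) : F * F := cross q x *: (x + q).
transitivity (\sum_(v <- s) (cross (E v) (E (nx v)) *: (E v + E (nx v)) + (G (E v) - G (E (nx v))))).
  by apply: eq_bigr => v _; exact: fan_term.
rewrite big_split/= KE add0r sumrB (sum_next cs (fun v => G (E v))) subrr//.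
Qed.

(** Apply the functional [cross w] to the fan identity with apex at the dual vertex
    of [v0]. Each triangle contributes its area times the sum of the values at its
    three corners, and these values are at most 1, 1 and -2. As the sum vanishes,
    all values are extreme, and then every vertex off the edge is [w]. *)
Lemma minkowski_aux v0 w : v0 \in s -> w \in s -> cross w (E v0) <= -2 ->
  cross w (E v0) = -2 /\ size s = 3%N.
Proof.
move=> v0s ws hw.
(* six times the integral of [cross w] over the triangle of the fan that is
   opposite to the apex in the edge dual to the vertex [next s v] *)
pose t v := cross (E v) (E (nx v)) * (1 - cross (nx v) (E v0)) *
   (cross w (E v) + cross w (E (nx v)) + cross w (E v0)).
have t0 : \sum_(v <- s) t v = 0.
  have h := fan_identity (E v0).
  have : cross w (\sum_(v <- s) cross (E v - E v0) (E (nx v) - E v0) *: (E v + E (nx v) + E v0)) = 0.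
    by rewrite h /cross/= !mulr0 subrr.
  rewrite {1}/cross (raddf_sum fst) (raddf_sum snd) !mulr_sumr -sumrB => e0.
  apply: etrans e0; rewrite big_seq [RHS]big_seq; apply: eq_bigr => v vs.
  rewrite /t (fan_area (n := nx v)); last 2 first.
  - exact: cross_edge_r.
  - by apply: cross_edge_l; rewrite mem_next.
  move: (E v) (E (nx v)) (E v0) (nx v) => [a1 a2] [b1 b2] [q1 q2] n.
  by rewrite /cross /= /GRing.scale/=; ring.
have tle v : v \in s -> 0 <= - t v.
  move=> vs; have ns : nx v \in s by rewrite mem_next.
  rewrite /t -mulrN; apply: mulr_ge0.
    apply: mulr_ge0; first exact/ltW/cross_edges_gt0.
    by rewrite subr_ge0 cross_edge_le1.
  by have := cross_edge_le1 vs ws; have := cross_edge_le1 ns ws; lra.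
have tz v : v \in s -> t v = 0.
  move=> vs; apply/eqP; rewrite -oppr_eq0; have : \sum_(v <- s) - t v == 0 by rewrite sumrN t0 oppr0.
  rewrite big_seq psumr_eq0//.
  by move/allP => /(_ _ vs); rewrite vs.
have other x : x \in s -> x != v0 -> x != nx v0 -> x = w /\ cross w (E v0) = -2.
  move=> xs xv xn; have ps : prev s x \in s by rewrite mem_prev.
  have /eqP := tz _ ps; rewrite /t (next_prev us).
  have := cross_edges_gt0 ps; rewrite (next_prev us) => c0.
  have c1 : 0 < 1 - cross x (E v0) by rewrite subr_gt0 cross_edge_lt1.
  rewrite mulf_eq0 (gt_eqF (mulr_gt0 c0 c1))/= => /eqP e.
  have l1 := cross_edge_le1 ps ws; have l2 := cross_edge_le1 xs ws.
  split; last by lra.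
  have e1 : cross w (E (prev s x)) = 1 by lra.
  have e2 : cross w (E x) = 1 by lra.
  apply/eqP/negPn/negP => xw; have wx : w != x by rewrite eq_sym.
  have wp : w = prev s x.
    apply/eqP/negPn/negP => wp; have := cross_edge_lt1 ps ws wp.
    by rewrite (next_prev us) e1 ltxx => /(_ wx).
  have wn : w = nx x.
    by apply/eqP/negPn/negP => wn; have := cross_edge_lt1 xs ws wx wn; rewrite e2 ltxx.
  by have := prev_neq_next cs xs; rewrite -wp -wn eqxx.
have sub : {subset s <= [:: v0; nx v0; w]}.
  move=> x xs; rewrite !inE; have [//|xv/=] := eqVneq x v0.
  by have [//|xn] := eqVneq x (nx v0); have [-> _] := other x xs xv xn; rewrite eqxx.
have sz : size s = 3%N.
  apply/eqP; rewrite eqn_leq; have [_ -> _ _] := cs; rewrite andbT.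
  by have := uniq_leq_size us sub.
split=> //.
have [x xs /andP[xv xn]] : exists2 x, x \in s & (x != v0) && (x != nx v0).
  apply/hasP/negPn/negP => /hasPn h.
  suff : (size s <= 2)%N by rewrite sz.
  have -> : 2%N = size [:: v0; nx v0] by [].
  apply: uniq_leq_size => // x /h; rewrite negb_and !negbK !inE => /orP[->|->]//.
  by rewrite orbT.
by have [] := other x xs xv xn.
Qed.

Lemma minkowski v w : v \in s -> w \in s -> -2 <= cross w (E v).
Proof.
move=> vs ws; rewrite leNgt; apply/negP => h.
by have [e _] := minkowski_aux vs ws (ltW h); rewrite e ltxx in h.
Qed.

Lemma minkowski_strict v w : size s <> 3%N -> v \in s -> w \in s -> -2 < cross w (E v).
Proof.
move=> s3 vs ws; rewrite ltNge; apply/negP => h.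
by have [_ e] := minkowski_aux vs ws h.
Qed.

End Minkowski.

(** * Balanced integer polygons have rotations *)

Definition toZ (v : int * int) : Z * Z := (Z_of_int v.1, Z_of_int v.2).

Lemma toZ_inj : injective toZ.
Proof. by move=> [a b] [c d] [/(can_inj Z_of_intK)-> /(can_inj Z_of_intK)->]. Qed.

Definition ilin (a b c d : int) (v : int * int) : int * int :=
  (a * v.1 + b * v.2, c * v.1 + d * v.2).

Definition irotation (s : seq (int * int)) : Prop :=
  exists a b c d : int, [/\ a * d - b * c = 1,
    [/\ a = -1, b = 0, c = 0 & d = -1] \/ a + d = -1 &
    forall v, v \in s -> ilin a b c d v \in s].

Lemma zrotation_int (s : seq (int * int)) : zrotation (map toZ s) -> irotation s.
Proof.
case=> a [b [c [d [dt kind mem]]]].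
exists (int_of_Z a), (int_of_Z b), (int_of_Z c), (int_of_Z d); split.
- by lia.
- by case: kind => [[-> -> -> ->]|tr]; [left|right; lia].
move=> v vs; have := mem _ (map_f toZ vs) => /mapP[w ws e].
suff -> : ilin (int_of_Z a) (int_of_Z b) (int_of_Z c) (int_of_Z d) v = w by [].
case: v w {vs ws} e => [x y] [x' y']; rewrite /zlin /toZ /ilin /= => -[e1 e2].
by congr pair; lia.
Qed.

(** The integral data handed to the search; [E] is [l] times the dual vertex. *)
Record int_polygon (l : int) (E : int * int -> int * int) (s : seq (int * int)) : Prop := IntPolygon {
  ip_uniq : uniq s;
  ip_det : forall v, v \in s -> 0 < det2 v (next s v);
  ip_dual : forall v, v \in s ->
    l * (next s v - v).1 = (E v).1 * det2 v (next s v) /\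
    l * (next s v - v).2 = (E v).2 * det2 v (next s v);
  ip_slab : forall v w, v \in s -> w \in s -> w != v -> w != next s v ->
    - 2 * det2 v (next s v) < det2 w (next s v - v) < det2 v (next s v);
  ip_prim : forall v, v \in s -> lat_gcd v = 1;
  ip_bary : \sum_(v <- s) det2 (E v) (E (next s v)) * ((E v).1 + (E (next s v)).1) = 0 /\
    \sum_(v <- s) det2 (E v) (E (next s v)) * ((E v).2 + (E (next s v)).2) = 0 }.

Lemma int_polygon_rot l E s n : int_polygon l E s -> int_polygon l E (rot n s).
Proof.
case=> us dt du sl pr [b1 b2]; have nr v : next (rot n s) v = next s v by exact: next_rot.
split.
- by rewrite rot_uniq.
- by move=> v; rewrite mem_rot nr; exact: dt.
- by move=> v; rewrite mem_rot nr; exact: du.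
- by move=> v w; rewrite !mem_rot nr; exact: sl.
- by move=> v; rewrite mem_rot; exact: pr.
have pe : perm_eq (rot n s) s by rewrite perm_rot.
split; [rewrite -[RHS]b1|rewrite -[RHS]b2]; rewrite (perm_big _ pe)/=;
  by apply: eq_bigr => v _; rewrite nr.
Qed.

Lemma int_polygon_zpoly l E s : int_polygon l E s -> zpoly (Z_of_int l) (map toZ s).
Proof.
case=> us dt du sl pr _.
have nm v : next (map toZ s) (toZ v) = toZ (next s v) by exact: (next_map toZ_inj us v).
have dZ v w : zdet (toZ v) (toZ w) = Z_of_int (det2 v w) by rewrite /zdet /det2 /toZ /=; lia.
split.
- by rewrite map_inj_uniq//; exact: toZ_inj.
- by move=> _ /mapP[v vs ->]; rewrite nm dZ; have := dt v vs; lia.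
- move=> _ /mapP[v vs ->]; rewrite nm dZ; have [e1 e2] := du v vs.
  by split; [exists (Z_of_int (E v).1)|exists (Z_of_int (E v).2)]; rewrite /toZ /=; move: e1 e2 => /= ; lia.
- move=> _ _ /mapP[v vs ->] /mapP[w ws ->]; rewrite nm !(inj_eq toZ_inj) => n1 n2.
  have := sl v w vs ws n1 n2; rewrite /zslab dZ.
  have -> : zdet (toZ w) (Z.sub (toZ (next s v)).1 (toZ v).1, Z.sub (toZ (next s v)).2 (toZ v).2) = Z_of_int (det2 w (next s v - v)).
    by rewrite /zdet /det2 /toZ /=; lia.
  move=> /andP[h1 h2]; apply/andP; split; apply/Z.ltb_lt; lia.
by move=> _ /mapP[v vs ->]; have := pr v vs; rewrite /lat_gcd /toZ /=; lia.
Qed.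

Lemma int_polygon_zke l E s : int_polygon l E s -> zke (Z_of_int l) (map toZ s).
Proof.
move=> ps; have zp := int_polygon_zpoly ps; case: ps => us dt du sl pr [b1 b2].
have nm v : next (map toZ s) (toZ v) = toZ (next s v) by exact: (next_map toZ_inj us v).
have dZ v w : zdet (toZ v) (toZ w) = Z_of_int (det2 v w) by rewrite /zdet /det2 /toZ /=; lia.
rewrite /zke /zbary (zpairs_next (zp_uniq zp)).
have -> : map (zdual (Z_of_int l)) [seq (v, next (map toZ s) v) | v <- map toZ s] = map (toZ \o E) s.
  rewrite -!map_comp; apply/eq_in_map => v vs /=; rewrite nm /zdual /= dZ.
  have [e1 e2] := du v vs; have d0 := dt v vs.
  move: e1 e2 d0; set d := det2 _ _ => e1 e2 d0.
  have dn0 : Z_of_int d <> Z0 by lia.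
  rewrite /toZ /=; congr pair.
    rewrite -(Z.div_mul (Z_of_int (E v).1) _ dn0); congr (Z.div _ _).
    by move: e1 => /=; lia.
  rewrite -(Z.div_mul (Z_of_int (E v).2) _ dn0); congr (Z.div _ _).
  by move: e2 => /=; lia.
rewrite /zpairs -map_rot rot1_next//.
have -> : zip (map (toZ \o E) s) (map (toZ \o E) (map (next s) s)) =
   [seq (toZ (E v), toZ (E (next s v))) | v <- s].
  by move: (next s) => f; elim: s {us dt du sl pr b1 b2 zp nm} => //= v t ->.
move: (next s) b1 b2 => f b1 b2.
set g := (X in foldr X).
have -> : foldr g (Z0, Z0) [seq (toZ (E v), toZ (E (f v))) | v <- s] =
  toZ (\sum_(v <- s) det2 (E v) (E (f v)) * ((E v).1 + (E (f v)).1),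
       \sum_(v <- s) det2 (E v) (E (f v)) * ((E v).2 + (E (f v)).2)).
  elim: (s) => [|v t IH] /=; first by rewrite !big_nil.
  rewrite IH !big_cons /g /= dZ /toZ /=.
  by congr pair; lia.
by rewrite b1 b2.
Qed.

(** The search expects the edge of minimal height first, so the cyclic list is
    rotated. *)
Lemma int_polygon_rotation l E s : 1 <= l <= 17 -> (3 < size s)%N -> int_polygon l E s -> irotation s.
Proof.
move=> ll sz ps.
pose f v := Z.to_nat (zheight (toZ v) (toZ (next s v))).
have [v0 v0s v0min] : exists2 w, w \in s & forall v, v \in s -> (f w <= f v)%N.
  have [|w ws wmin] := @argmin_seq _ int (fun v => (f v)%:Z) s; first by case: (s) sz.
  by exists w => // v /wmin; rewrite lez_nat.
have [i s' sE] := rot_to v0s.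
have pr := int_polygon_rot i ps; have us := ip_uniq ps.
have sz' : (3 < size (rot i s))%N by rewrite size_rot.
suff [a [b [c [d [dt kind mem]]]]] : irotation (rot i s).
  by exists a, b, c, d; split => // v; rewrite -(mem_rot i) => /mem; rewrite mem_rot.
apply: zrotation_int.
have zp := int_polygon_zpoly pr; have zk := int_polygon_zke pr.
have hmin v : v \in rot i s -> Z.le (zheight (toZ v0) (toZ (next s v0))) (zheight (toZ v) (toZ (next s v))).
  rewrite mem_rot => vs; have := v0min v vs; rewrite /f.
  have : Z.le Z0 (zheight (toZ v) (toZ (next s v))).
    have vz : toZ v \in map toZ (rot i s) by rewrite map_f// mem_rot.
    have := zp_det zp vz; rewrite (next_map toZ_inj) ?rot_uniq// next_rot// => h.
    by apply: Z_div_nonneg_nonneg; [lia|exact: Z.gcd_nonneg].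
  by lia.
move: sE sz' zp zk hmin; case: s' => [|v1 [|v2 rest]] sE; rewrite ?sE// => sz' zp zk hmin.
have us' : uniq [:: v0, v1, v2 & rest] by rewrite -sE rot_uniq.
have n0 : next s v0 = v1 by rewrite -(next_rot i us) sE; exact: (@next_cat_cons _ [::]).
apply: (@zpoly_rotation (Z_of_int l) (toZ v0) (toZ v1) (toZ v2) (map toZ rest)) => //.
- by lia.
- by rewrite /= size_map.
move=> _ /(@mapP _ _ toZ [:: v0, v1, v2 & rest])[v vs ->].
rewrite -[X in next X]/(map toZ [:: v0, v1, v2 & rest]) (next_map toZ_inj us').
by rewrite -[in next _]sE next_rot// -n0; exact: hmin.
Qed.

(** * Convex hulls and interiors in the plane *)

Section ConvexHull.
Variable R : realType.
Implicit Types (A B : set (R * R)).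

Lemma convex_setP A : convex_set A <->
  (forall x y t, 0 <= t -> t <= 1 -> A x -> A y -> A (t *: x + (1 - t) *: y)).
Proof.
split=> [cA x y t t0 t1 Ax Ay|h x y t].
  have := cA x y (Itv01 t0 t1); rewrite !inE => /(_ Ax Ay).
  by [].
rewrite !inE => Ax Ay; exact: h.
Qed.

Lemma conv_hull_sub A : A `<=` conv_hull A.
Proof. by move=> x Ax B [_]; exact. Qed.

Lemma conv_hull_convex A : convex_set (conv_hull A).
Proof.
apply/convex_setP => x y t t0 t1 hx hy B [cB AB].
by move/convex_setP : (cB); apply => //; [exact: hx|exact: hy].
Qed.

Lemma conv_hull_min A B : convex_set B -> A `<=` B -> conv_hull A `<=` B.
Proof. by move=> cB AB x; apply. Qed.

Lemma conv_hull_mono A B : A `<=` B -> conv_hull A `<=` conv_hull B.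
Proof.
move=> AB; apply: conv_hull_min; first exact: conv_hull_convex.
by move=> x /AB; exact: conv_hull_sub.
Qed.

Lemma conv_hullE A x y t : 0 <= t -> t <= 1 -> conv_hull A x -> conv_hull A y ->
  conv_hull A (t *: x + (1 - t) *: y).
Proof. by move: x y t; apply/convex_setP; exact: conv_hull_convex. Qed.

Lemma convex3 A x y z l m n : convex_set A -> A x -> A y -> A z ->
  0 <= l -> 0 <= m -> 0 <= n -> l + m + n = 1 -> A (l *: x + m *: y + n *: z).
Proof.
move=> /convex_setP cA Ax Ay Az l0 m0 n0 e.
have [l1|l1] := eqVneq l 1.
  have -> : m = 0 by lra.
  have -> : n = 0 by lra.
  by rewrite l1 !scale0r !addr0 scale1r.
have l1' : 0 < 1 - l by rewrite lt_neqAle subr_ge0 eq_sym subr_eq0 eq_sym l1/=; lra.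
have l1n : 1 - l != 0 by rewrite gt_eqF.
have -> : l *: x + m *: y + n *: z =
    l *: x + (1 - l) *: ((m / (1 - l)) *: y + (1 - m / (1 - l)) *: z).
  rewrite scalerDr !scalerA addrA; congr (_ *: _ + _ *: _ + _ *: _); first by field.
  have nE : n = 1 - l - m by lra.
  by rewrite nE; field.
apply: (cA x) => //; first by lra.
apply: (cA y) => //; first by rewrite divr_ge0 // ltW.
by rewrite ler_pdivrMr//; lra.
Qed.

Lemma hull_halfplane A (a b c : R) : (forall x, A x -> c <= a * x.1 + b * x.2) ->
  forall x, conv_hull A x -> c <= a * x.1 + b * x.2.
Proof.
move=> h; apply: (@conv_hull_min A [set x | c <= a * x.1 + b * x.2]) => //.
apply/convex_setP => x y t t0 t1 /= hx hy.
have := ler_wpM2l t0 hx; have t1' : 0 <= 1 - t by lra.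
have := ler_wpM2l t1' hy; rewrite /GRing.scale/=; lra.
Qed.

Lemma lin2_comb (a b c d t : R) x y :
  lin2 a b c d (t *: x + (1 - t) *: y) = t *: lin2 a b c d x + (1 - t) *: lin2 a b c d y.
Proof. by rewrite /lin2 /=; apply/eqP; rewrite -pair_eqE; apply/andP; split; apply/eqP; rewrite /= /GRing.scale/=; ring. Qed.

Lemma hull_lin2 A B (a b c d : R) : (forall x, A x -> B (lin2 a b c d x)) ->
  forall x, conv_hull A x -> conv_hull B (lin2 a b c d x).
Proof.
move=> h; apply: (@conv_hull_min A [set x | conv_hull B (lin2 a b c d x)]); last first.
  by move=> x /h; exact: conv_hull_sub.
apply/convex_setP => x y t t0 t1 /= hx hy; rewrite lin2_comb.
exact: conv_hullE.
Qed.

(** Removing an extreme point from a convex set leaves a convex set. *)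
Lemma vertices_hull A v : vertices (conv_hull A) v -> A v.
Proof.
move=> [hv ext]; apply: contrapT => nAv.
suff : conv_hull A `<=` conv_hull A `\ v by move=> /(_ v hv)[_]; exact.
apply: conv_hull_min; last first.
  by move=> x Ax; split; [exact: conv_hull_sub|move=> /= xv; apply: nAv; rewrite -xv].
apply/convex_setP => x y t t0 t1 [hx xv] [hy yv]; split; first exact: conv_hullE.
move=> /= e; have [tz|t0'] := eqVneq t 0.
  by apply: yv; rewrite -e tz scale0r add0r subr0 scale1r.
have [to|t1'] := eqVneq t 1.
  by apply: xv; rewrite -e to subrr scale0r addr0 scale1r.
have xy : x = y.
  by apply: (ext x y t) => //; apply/andP; split; rewrite lt_neqAle ?t0 ?t1 ?andbT// eq_sym.
by apply: xv; rewrite -e xy -scalerDl addrC subrK scale1r.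
Qed.

Lemma interior0P A : A° 0 <->
  exists2 e : R, 0 < e & forall u : R * R, `|u.1| < e -> `|u.2| < e -> A u.
Proof.
split=> [/nbhs_ballP[e /= e0 h]|[e e0 h]].
  exists e => // u u1 u2; apply: h; split => /=; rewrite /ball/= sub0r normrN//.
apply/nbhs_ballP; exists e => //= u [/=]; rewrite /ball/= !sub0r !normrN.
exact: h.
Qed.

(** The origin is a combination of [p], [q] and [- k (p + q)] with positive
    coefficients, and small vectors change these coefficients only slightly. *)
Lemma interior_triangle A p q k : convex_set A -> A p -> A q -> 0 < k ->
  A (- k *: (p + q)) -> cross p q != 0 -> A° 0.
Proof.
move=> cA Ap Aq k0 Ar c0; apply/interior0P.
set c := cross p q in c0.
(* if [u = al p + be q] with [|al|] and [|be|] at most [dl], then all three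
   coefficients of [u] are nonnegative *)
pose dl := k / (1 + 4 * k); pose M := 1 + (`|p.1| + `|p.2| + `|q.1| + `|q.2|).
have M0 : 0 < M by rewrite ltr_wpDr// !addr_ge0.
have k40 : 0 < 1 + 4 * k by lra.
have dl0 : 0 < dl by exact: divr_gt0.
have dlE : dl * (1 + 4 * k) = k by rewrite /dl mulfVK// gt_eqF.
have c0' : 0 < `|c| by rewrite normr_gt0.
exists (dl * `|c| / M); first by rewrite divr_gt0// mulr_gt0.
move=> u; set e := _ / M => u1 u2.
pose al := cross u q / c; pose be := cross p u / c.
have uE : u = al *: p + be *: q.
  have cE : c = p.1 * q.2 - p.2 * q.1 by [].
  case: u @al @be {u1 u2} => x y al be; apply/eqP; rewrite -pair_eqE /al /be /cross/=.
  by apply/andP; split; apply/eqP; rewrite /= /GRing.scale/= cE; field; rewrite -cE.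
have bnd (x1 x2 : R) : `|x1| + `|x2| <= M -> `|u.1 * x1 + u.2 * x2| / `|c| <= dl.
  move=> hM; rewrite ler_pdivrMr//; apply: (@le_trans _ _ (e * M)).
    rewrite (le_trans (ler_normD _ _))// !normrM.
    apply: (@le_trans _ _ (e * (`|x1| + `|x2|))).
      by rewrite mulrDr lerD// ler_wpM2r// ltW.
    by rewrite ler_wpM2l// ltW// (le_lt_trans _ u1).
  by rewrite /e mulfVK// gt_eqF.
have al1 : `|al| <= dl.
  rewrite /al normrM normfV; have := bnd q.2 (- q.1); rewrite normrN /cross.
  have -> : u.1 * q.2 - u.2 * q.1 = u.1 * q.2 + u.2 * - q.1 by ring.
  apply; rewrite /M; have := normr_ge0 p.1; have := normr_ge0 p.2; lra.
have be1 : `|be| <= dl.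
  rewrite /be normrM normfV; have := bnd (- p.2) p.1; rewrite normrN /cross.
  have -> : p.1 * u.2 - p.2 * u.1 = u.1 * - p.2 + u.2 * p.1 by ring.
  apply; rewrite /M; have := normr_ge0 q.1; have := normr_ge0 q.2; lra.
move: al1 be1; rewrite !ler_norml => /andP[a1 a2] /andP[b1 b2].
have k20 : 0 < 1 + 2 * k by lra.
have k2n : 1 + 2 * k != 0 by rewrite gt_eqF.
pose nu := (1 - al - be) / (1 + 2 * k).
have dk : dl * (1 + 2 * k) <= k * (1 - 2 * dl) by lra.
have dl1 : 2 * dl <= 1 by rewrite -(ler_pM2r k40); lra.
have nu0 : (1 - 2 * dl) / (1 + 2 * k) <= nu by rewrite /nu ler_pM2r ?invr_gt0//; lra.
have knu : dl <= k * nu.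
  apply: (@le_trans _ _ (k * ((1 - 2 * dl) / (1 + 2 * k)))); last by rewrite ler_wpM2l// ltW.
  by rewrite mulrA ler_pdivlMr.
have nup : 0 <= nu.
  by apply: le_trans nu0; rewrite divr_ge0 ?(ltW k20)//; lra.
have -> : u = (al + k * nu) *: p + (be + k * nu) *: q + nu *: (- k *: (p + q)).
  rewrite [LHS]uE; case: (p) (q) => p1 p2 [q1 q2].
  by apply/eqP; rewrite -pair_eqE /=; apply/andP; split; apply/eqP; rewrite /= /GRing.scale/=; ring.
apply: convex3 => //; [lra|lra|].
by rewrite /nu; field.
Qed.

(** Near the origin the functional takes negative values. *)
Lemma interior_halfplane A (a b c : R) : A° 0 -> (a, b) != 0 ->
  (forall x, A x -> c <= a * x.1 + b * x.2) -> c < 0.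
Proof.
move=> /interior0P[e e0 h] ab0 hA.
pose M := 1 + (`|a| + `|b|).
have M0 : 0 < M by rewrite ltr_wpDr// !addr_ge0.
pose t := e / M / 2.
have t0 : 0 < t by rewrite !divr_gt0.
have small (x : R) : `|x| <= M -> `|- t * x| < e.
  move=> xM; rewrite mulNr normrN normrM gtr0_norm//.
  apply: (@le_lt_trans _ _ (t * M)); first by rewrite ler_wpM2l// ltW.
  have -> : t * M = e / 2 by rewrite /t; field; rewrite gt_eqF.
  lra.
have := hA (- t * a, - t * b); move=> /(_ _)/wrap[].
  apply: h => /=; apply: small; rewrite /M; have := normr_ge0 a; have := normr_ge0 b; lra.
rewrite /= => hc; apply: le_lt_trans hc _.
have -> : a * (- t * a) + b * (- t * b) = - (t * (a ^+ 2 + b ^+ 2)) by ring.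
rewrite oppr_lt0 mulr_gt0// lt_neqAle addr_ge0 ?sqr_ge0// andbT eq_sym.
apply: contra_neq ab0 => /eqP; rewrite paddr_eq0 ?sqr_ge0// !sqrf_eq0 => /andP[/eqP-> /eqP->].
by [].
Qed.

End ConvexHull.

(** * Counterclockwise order of extreme lattice points *)

Section Hull.
Variable R : realType.
Local Notation lat := (@lat R).
Local Notation hull s := (conv_hull (lat @` [set` s])).

Lemma lat_inj : injective lat.
Proof. by move=> [a b] [c d] [/intr_inj-> /intr_inj->]. Qed.

Lemma cross_lat (v w : int * int) : cross (lat v) (lat w) = (cross v w)%:~R.
Proof. by rewrite /cross /lat /= rmorphB !rmorphM. Qed.

Lemma latB (v w : int * int) : lat (v - w) = lat v - lat w.
Proof. by apply/eqP; rewrite -pair_eqE; apply/andP; split; apply/eqP; rewrite /= rmorphB. Qed.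

Definition minimal_points (T : seq (int * int)) : Prop :=
  uniq T /\ forall p, p \in T -> ~ hull (rem p T) (lat p).

(** Points in the hull of the others are discarded one after the other. *)
Lemma minimal_points_exist (S : seq (int * int)) :
  exists2 T, minimal_points T & hull T = hull S.
Proof.
have [n] := ubnP (size S); elim: n S => // n IH S; rewrite ltnS => sz.
have [[p pS hp]|h] := pselect (exists2 p, p \in undup S & hull (rem p (undup S)) (lat p)).
  have [|T mT hT] := IH (rem p (undup S)).
    rewrite size_rem//; apply: leq_trans sz; rewrite prednK ?size_undup//.
    by case: (undup S) pS.
  exists T => //; rewrite hT; apply/seteqP; split.
    apply: conv_hull_mono => _ [x xs <-]; exists x => //.
    by move: xs => /= /mem_rem; rewrite mem_undup.
  apply: conv_hull_min; first exact: conv_hull_convex.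
  move=> _ [x xs <-]; have [->//|xp] := eqVneq x p.
  apply: conv_hull_sub; exists x => //=.
  by rewrite mem_rem_uniq ?undup_uniq// inE xp /= mem_undup.
exists (undup S).
  by split=> [|p pS hp]; [exact: undup_uniq|apply: h; exists p].
by congr (conv_hull (_ @` _)); apply/seteqP; split => x /=; rewrite mem_undup.
Qed.

Section Ccw.
Variable T : seq (int * int).
Hypothesis mT : minimal_points T.

(** Minimality in integral form: a point is not a weighted mean of other
    points. *)
Lemma minimal_not_comb (p x y z : int * int) (l m n : int) :
  p \in T -> x \in T -> y \in T -> z \in T -> x != p -> y != p -> z != p ->
  0 <= l -> 0 <= m -> 0 <= n -> 0 < l + m + n ->
  l * x.1 + m * y.1 + n * z.1 = (l + m + n) * p.1 ->
  l * x.2 + m * y.2 + n * z.2 = (l + m + n) * p.2 -> False.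
Proof.
move=> pT xT yT zT xp yp zp l0 m0 n0 k0 e1 e2; have [uT] := mT; move=> /(_ p pT); apply.
pose k : R := (l + m + n)%:~R.
have kp : 0 < k by rewrite ltr0z.
have kn : k != 0 by rewrite gt_eqF.
have kE : k = l%:~R + m%:~R + n%:~R by rewrite /k !rmorphD.
have kn' : l%:~R + m%:~R + n%:~R != 0 :> R by rewrite -kE.
have f1 : k * p.1%:~R = l%:~R * x.1%:~R + m%:~R * y.1%:~R + n%:~R * z.1%:~R.
  by rewrite /k -!rmorphM -!rmorphD e1.
have f2 : k * p.2%:~R = l%:~R * x.2%:~R + m%:~R * y.2%:~R + n%:~R * z.2%:~R.
  by rewrite /k -!rmorphM -!rmorphD e2.
have -> : lat p = (l%:~R / k) *: lat x + (m%:~R / k) *: lat y + (n%:~R / k) *: lat z.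
  apply/eqP; rewrite -pair_eqE /=; apply/andP; split; apply/eqP; apply: (mulfI kn); rewrite /GRing.scale/=.
    by rewrite f1; field.
  by rewrite f2; field.
have mem u : u \in T -> u != p -> hull (rem p T) (lat u).
  move=> uT' up; apply: conv_hull_sub; exists u => //=.
  by rewrite mem_rem_uniq// inE up.
apply: convex3; [exact: conv_hull_convex|exact: mem|exact: mem|exact: mem| | | |].
- by rewrite divr_ge0 ?ler0z// ltW.
- by rewrite divr_ge0 ?ler0z// ltW.
- by rewrite divr_ge0 ?ler0z// ltW.
by rewrite kE; field.
Qed.

(** The lexicographic order. Vectors from the lexicographically smallest point to
    the other points are positive, and on positive vectors the sign of [cross] is
    a transitive relation; this allows sorting by angle. *)
Definition lexpos (d : int * int) : bool := (0 < d.1) || (d.1 == 0) && (0 < d.2).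

Lemma lexposP d : lexpos d -> 0 < d.1 \/ d.1 = 0 /\ 0 < d.2.
Proof. by case/orP => [|/andP[/eqP]]; [left|right]. Qed.

Lemma lexmin_exists : T != [::] ->
  exists2 v0, v0 \in T & forall x, x \in T -> x != v0 -> lexpos (x - v0).
Proof.
move=> T0; have [m mT0 hm] := argmin_seq (fun x : int * int => x.1) T0.
have [|v0] := @argmin_seq _ _ (fun x : int * int => x.2) [seq x <- T | x.1 == m.1].
  by apply/eqP => e; have := mem_filter (fun x => x.1 == m.1) m T; rewrite e eqxx mT0.
rewrite mem_filter => /andP[/eqP e vT] hv; exists v0 => // x xT xv.
rewrite /lexpos /=; have := hm x xT; rewrite -e le_eqVlt => /orP[/eqP e1|]; last first.
  by rewrite -subr_gt0 => ->.
have := hv x; rewrite mem_filter xT -e e1 eqxx => /(_ isT).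
rewrite subrr ltxx eqxx /= subr_gt0 le_eqVlt => /orP[/eqP e2|//].
by move: xv; case: (x) (v0) e1 e2 => [a b] [c d] /= -> ->; rewrite eqxx.
Qed.

Lemma cross_lexpos_trans (a b c : int * int) : lexpos a -> lexpos b -> lexpos c ->
  0 <= cross a b -> 0 <= cross b c -> 0 <= cross a c.
Proof.
move=> /lexposP + /lexposP + /lexposP; rewrite /cross.
case: a b c => [a1 a2] [b1 b2] [c1 c2] /= la lb lc ab bc.
have a0 : 0 <= a1 by lia.
have c0 : 0 <= c1 by lia.
have [b1p|b1n] := ltrP 0 b1.
  rewrite -(pmulr_rge0 _ b1p).
  have -> : b1 * (a1 * c2 - a2 * c1) = a1 * (b1 * c2 - b2 * c1) + c1 * (a1 * b2 - a2 * b1) by ring.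
  by rewrite addr_ge0// mulr_ge0.
have b10 : b1 = 0 by lia.
have b2p : 0 < b2 by lia.
have c10 : c1 = 0 by move: bc; rewrite b10; clear -c0 b2p; nia.
by rewrite c10 mulr0 subr0 mulr_ge0//; lia.
Qed.

Section Sorted.
Variable v0 : int * int.
Hypotheses (v0T : v0 \in T) (lex : forall x : int * int, x \in T -> x != v0 -> lexpos (x - v0)).

(** Otherwise one of [x] and [y] would lie between the other one and [v0]. *)
Lemma cross_base_neq0 (x y : int * int) : x \in T -> y \in T -> x != v0 -> y != v0 -> x != y ->
  cross (x - v0) (y - v0) != 0.
Proof.
move=> xT yT xv yv xy; apply/negP => /eqP c0.
have lx := lexposP (lex xT xv); have ly := lexposP (lex yT yv).
have v0x : v0 != x by rewrite eq_sym.
have v0y : v0 != y by rewrite eq_sym.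
have yx : y != x by rewrite eq_sym.
have {}xy' : ~ (x.1 = y.1 /\ x.2 = y.2).
  by move=> [e1 e2]; move: xy; rewrite [x]surjective_pairing e1 e2 -surjective_pairing eqxx.
have A := @minimal_not_comb x y y v0; have B := @minimal_not_comb y x x v0.
move: lx ly c0; rewrite /cross /= => lx ly c0; move: A B => A B.
have [x1|x1] := ltrP 0 (x.1 - v0.1).
  have y1 : 0 < y.1 - v0.1.
    rewrite ltNge; apply/negP => y1; have y10 : y.1 - v0.1 = 0 by clear -ly y1; lia.
    have y2 : 0 < y.2 - v0.2 by lia.
    by move: c0; rewrite y10 mulr0 subr0; have := mulr_gt0 x1 y2; lia.
  have [h|h] := lerP (x.1 - v0.1) (y.1 - v0.1).
    by apply: (A (x.1 - v0.1) 0 (y.1 - x.1)) => //; clear -x1 y1 h c0; lia.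
  by apply: (B (y.1 - v0.1) 0 (x.1 - y.1)) => //; clear -x1 y1 h c0; lia.
have x10 : x.1 = v0.1 by clear -lx x1; lia.
have x2 : 0 < x.2 - v0.2 by clear -lx x1; lia.
have y10 : y.1 = v0.1.
  have : (y.1 - v0.1) * (x.2 - v0.2) = 0 by move: c0; rewrite x10; clear; lia.
  by move/eqP; rewrite mulf_eq0 (gt_eqF x2) orbF subr_eq0 => /eqP.
have y2 : 0 < y.2 - v0.2 by clear -ly y10; lia.
have [h|h] := lerP (x.2 - v0.2) (y.2 - v0.2).
  by apply: (A (x.2 - v0.2) 0 (y.2 - x.2)) => //; rewrite ?x10 ?y10; clear -x2 y2 h; lia.
by apply: (B (y.2 - v0.2) 0 (x.2 - y.2)) => //; rewrite ?x10 ?y10; clear -x2 y2 h; lia.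
Qed.

(** Otherwise [b] would lie in the triangle with corners [v0], [a] and [c]. *)
Lemma cross_triangle (a b c : int * int) : a \in T -> b \in T -> c \in T ->
  v0 != b -> a != b -> c != b ->
  0 < cross (a - v0) (b - v0) -> 0 < cross (b - v0) (c - v0) -> 0 < cross (a - v0) (c - v0) ->
  0 < cross (a - v0) (b - v0) + cross (b - v0) (c - v0) - cross (a - v0) (c - v0).
Proof.
move=> aT bT cT vb ab cb h1 h2 h3; rewrite ltNge; apply/negP => h.
apply: (@minimal_not_comb b a c v0 (cross (b - v0) (c - v0)) (cross (a - v0) (b - v0))
  (cross (a - v0) (c - v0) - cross (a - v0) (b - v0) - cross (b - v0) (c - v0))) => //; try lia.
  by rewrite /cross /=; ring.
by rewrite /cross /=; ring.
Qed.

Let r (x y : int * int) := 0 <= cross (x - v0) (y - v0).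
Let t := sort r (rem v0 T).

Lemma mem_sorted (x : int * int) : (x \in t) = (x \in T) && (x != v0).
Proof. by rewrite mem_sort mem_rem_uniq ?(proj1 mT)// inE andbC. Qed.

Lemma sorted_pairwise_crs : pairwise (fun x y => 0 < cross (x - v0) (y - v0)) t.
Proof.
have ut : uniq t by rewrite sort_uniq rem_uniq// (proj1 mT).
have al : all (fun x => lexpos (x - v0)) (rem v0 T).
  by apply/allP => x; rewrite -(mem_sort r) mem_sorted => /andP[xT xv]; exact: lex.
have st : sorted r t.
  apply: (sort_sorted_in _ al) => x y _ _; rewrite /r.
  have -> : cross (y - v0) (x - v0) = - cross (x - v0) (y - v0) by rewrite /cross /=; ring.
  by rewrite oppr_ge0; exact: le_total.
have al' : all (fun x => lexpos (x - v0)) t by rewrite all_sort.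
have pw : pairwise r t.
  rewrite -(@sorted_pairwise_in _ (fun x => lexpos (x - v0)) r)//.
  by move=> y x z ly lx lz; exact: cross_lexpos_trans.
have aT : all (fun x => (x \in T) && (x != v0)) t.
  by apply/allP => x; rewrite mem_sorted.
move: (t) ut pw aT => u; elim: u => //= x u IH /andP[xu uu] /andP[rx pu] /andP[/andP[xT xv] au].
rewrite IH// andbT; apply/allP => y yu.
have /andP[yT yv] := allP au y yu.
have rxy : 0 <= cross (x - v0) (y - v0) := allP rx y yu.
rewrite lt_neqAle rxy andbT eq_sym cross_base_neq0//.
by apply: contraNneq xu => ->.
Qed.

Lemma sorted_ccw (v w : int * int) : v \in v0 :: t -> w \in v0 :: t -> w != v -> w != next (v0 :: t) v ->
  0 < cross (next (v0 :: t) v - v) (w - v).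
Proof.
have pw := sorted_pairwise_crs; have mt := mem_sorted.
have us : uniq (v0 :: t).
  by rewrite /= mt eqxx andbF sort_uniq rem_uniq// (proj1 mT).
move: (t) us mt pw => u us mt pw.
rewrite inE => /orP[/eqP->|vu].
  case: u us mt pw => [|h u] us mt pw.
    by rewrite inE => /eqP ->; rewrite eqxx.
  have -> : next [:: v0, h & u] v0 = h by apply: (@next_cat_cons _ [::]).
  rewrite !inE => /orP[/eqP->|/orP[/eqP->|wu]]; rewrite ?eqxx//.
  by move=> _ _; move: pw => /= /andP[/allP + _]; apply.
case/splitPr: vu us mt pw => u1 u2; case: u2 => [|y u2] us mt pw.
  rewrite cats1 in us *; rewrite next_rcons//.
  rewrite inE mem_rcons inE => /orP[/eqP->|/orP[/eqP->|wu]]; rewrite ?eqxx//.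
  move=> _ _; move: pw; rewrite pairwise_cat => /and3P[/allrelP pw _ _].
  have := pw w v wu (mem_head _ _).
  by congr (_ < _); rewrite /cross /=; ring.
have nE : next (v0 :: u1 ++ [:: v, y & u2]) v = y by apply: (@next_cat_cons _ (v0 :: u1)).
rewrite nE.
have vT : v \in T by have := mt v; rewrite mem_cat mem_head orbT => /esym/andP[].
have yT : y \in T by have := mt y; rewrite mem_cat !inE eqxx !orbT => /esym/andP[].
have vv : v0 != v by have := mt v; rewrite mem_cat mem_head orbT eq_sym => /esym/andP[].
have yv : v0 != y by have := mt y; rewrite mem_cat !inE eqxx !orbT eq_sym => /esym/andP[].
move: pw; rewrite pairwise_cat => /and3P[/allrelP pw1 _ /= /and3P[/andP[vy /allP pv] /allP py _]].
move: us; rewrite /= cat_uniq => /and4P[_ _ h12 /= /andP[nv /andP[ny _]]].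
have vny : v != y by apply: contraNneq nv => ->; rewrite mem_head.
rewrite inE mem_cat => /orP[/eqP->|/orP[wu|]].
- by move=> _ _; move: vy; congr (_ < _); rewrite /cross /=; ring.
- move=> wv wy.
  have wT : w \in T by have := mt w; rewrite mem_cat wu => /esym/andP[].
  have h1 : 0 < cross (w - v0) (v - v0) by apply: pw1 => //; rewrite mem_head.
  have h2 : 0 < cross (w - v0) (y - v0) by apply: pw1 => //; rewrite !inE eqxx orbT.
  have yv' : y != v by rewrite eq_sym.
  have := cross_triangle wT vT yT vv wv yv' h1 vy h2.
  by congr (_ < _); rewrite /cross /=; ring.
rewrite !inE => /orP[/eqP->|/orP[/eqP->|wu]]; rewrite ?eqxx// => wv wy.
have wT : w \in T by have := mt w; rewrite mem_cat !inE wu !orbT => /esym/andP[].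
have := cross_triangle vT yT wT yv vny wy vy (py _ wu) (pv _ wu).
by congr (_ < _); rewrite /cross /=; ring.
Qed.

End Sorted.

(** Sorting the other points by their angle at the lexicographically smallest one.
    All points lie to the left of each edge, and the origin, being an interior
    point, strictly so. *)
Lemma convex_ccw_exists : (hull T)° 0 ->
  exists2 s, perm_eq s T & convex_ccw s.
Proof.
move=> i0; have uT := proj1 mT.
have T0 : T != [::].
  apply/eqP => e; have := interior_subset i0; rewrite e.
  have sub : hull [::] `<=` set0.
    by apply: conv_hull_min => [x y l|_ [x]] //; rewrite inE.
  by move/sub.
have [v0 v0T lex] := lexmin_exists T0.
pose s := v0 :: sort (fun x y => 0 <= cross (x - v0) (y - v0)) (rem v0 T).
have ps : perm_eq s T.
  rewrite perm_sym (perm_trans (perm_to_rem v0T))// perm_cons perm_sym.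
  exact/permEl/perm_sort.
have us : uniq s by rewrite (perm_uniq ps).
have left v w : v \in s -> w \in s -> 0 <= cross (next s v - v) (w - v).
  move=> vs ws; have [->|wv] := eqVneq w v; first by rewrite subrr /cross/= !mulr0 subrr.
  have [->|wn] := eqVneq w (next s v); first by rewrite /cross mulrC subrr.
  by apply/ltW/(sorted_ccw v0T lex).
(* the origin is an interior point of the hull *)
have flat (a b c : int) : (a, b) != 0 -> (forall v, v \in T -> a * v.1 + b * v.2 = c) -> False.
  move=> ab0 h.
  have R0 : (a%:~R : R, b%:~R : R) != 0.
    by apply: contra_neq ab0 => -[/eqP + /eqP]; rewrite !intr_eq0 => /eqP-> /eqP->.
  have R1 : (- a%:~R : R, - b%:~R : R) != 0.
    apply: contra_neq R0 => -[/eqP + /eqP]; rewrite !oppr_eq0 => /eqP-> /eqP->//.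
  have : (c%:~R : R) < 0.
    apply: (interior_halfplane i0 R0) => x; apply: hull_halfplane => _ [v vT <-] /=.
    by rewrite -(h v vT) rmorphD !rmorphM.
  have : (- c%:~R : R) < 0.
    apply: (interior_halfplane i0 R1) => x; apply: hull_halfplane => _ [v vT <-] /=.
    by rewrite -(h v vT) rmorphD !rmorphM /=; lra.
  lra.
have sz : (2 < size s)%N.
  rewrite ltnNge; apply/negP => sz.
  have [w hw] : exists w, {subset s <= [:: v0; w]}.
    rewrite /s in sz *; case: (sort _ _) sz => [|w [|//]] _; first by exists v0; move=> x; rewrite !inE orbF => ->.
    by exists w.
  have memT v : v \in T -> v = v0 \/ v = w.
    by rewrite -(perm_mem ps) => /hw; rewrite !inE => /orP[/eqP|/eqP]; [left|right].
  have [e|wv] := eqVneq w v0.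
    apply: (@flat 1 0 v0.1) => // v /memT[->|->]; rewrite ?e mul1r mul0r addr0 //.
  apply: (@flat (w.2 - v0.2) (v0.1 - w.1) ((w.2 - v0.2) * v0.1 + (v0.1 - w.1) * v0.2)).
    apply: contra_neq wv => -[/subr0_eq e1 /subr0_eq e2].
    by rewrite [w]surjective_pairing e1 -e2 -surjective_pairing.
  by move=> v /memT[->|->] //; ring.
exists s => //; split=> //; last by move=> v w *; exact: (sorted_ccw v0T lex).
move=> v vs; have vn : next s v != v.
  apply/eqP => e; have : forall w, w \in s -> w = v.
    move=> w ws; apply/eqP/negPn/negP => wv.
    have := @sorted_ccw v0 v0T lex v w vs ws wv; rewrite -/s e => /(_ wv).
    by rewrite subrr /cross /= !mul0r subrr ltxx.
  move=> all1; move: sz; rewrite ltnNge => /negP; apply.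
  apply: (@leq_trans (size [:: v])) => //; apply: uniq_leq_size => // w /all1 ->.
  by rewrite mem_head.
set n := next s v in vn *.
have := @interior_halfplane R _ (- (n - v).2%:~R) ((n - v).1%:~R) (cross (n - v) v)%:~R i0.
have -> : cross v n = - cross (n - v) v by rewrite /cross /=; ring.
rewrite oppr_gt0 -(ltrz0 R); apply.
  apply: contra_neq vn => -[/eqP + /eqP]; rewrite oppr_eq0 !intr_eq0 !subr_eq0 => /eqP e2 /eqP e1.
  by rewrite [n]surjective_pairing e1 e2 -surjective_pairing.
move=> x; apply: hull_halfplane => _ [w wT <-] /=.
have ws : w \in s by rewrite (perm_mem ps).
have := left v w vs ws; rewrite -/n -(ler0z R) -!rmorphN -!rmorphM -rmorphD ler_int => h.
have : 0 <= cross (n - v) (w - v) by rewrite -(ler0z R).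
by rewrite /cross /=; lra.
Qed.

End Ccw.
End Hull.

(** * Fano polygons, their vertices and their duals *)

Section Fano.
Variable R : realType.
Local Notation lat := (@lat R).
Local Notation hull s := (conv_hull (lat @` [set` s])).

Lemma next_lat s (v : int * int) : uniq s -> next (map lat s) (lat v) = lat (next s v).
Proof. by move=> us; exact: (next_map (@lat_inj R) us v). Qed.

Lemma prev_lat s (v : int * int) : uniq s -> prev (map lat s) (lat v) = lat (prev s v).
Proof. by move=> us; exact: (prev_map (@lat_inj R) us v). Qed.

Lemma convex_ccw_lat s : convex_ccw s -> convex_ccw (map lat s).
Proof.
case=> us sz dt left; split.
- by rewrite map_inj_uniq//; exact: lat_inj.
- by rewrite size_map.
- by move=> _ /mapP[v vs ->]; rewrite next_lat// cross_lat ltr0z dt.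
move=> _ _ /mapP[v vs ->] /mapP[w ws ->]; rewrite next_lat// !(inj_eq (@lat_inj R)) => wv wn.
by rewrite -!latB cross_lat ltr0z left.
Qed.

(** At a listed point the two functionals that define the adjacent edges are
    nonnegative on the polygon and vanish together only there, so that it is
    extreme. *)
Lemma vertices_ccw (s : seq (int * int)) : convex_ccw s -> vertices (hull s) = lat @` [set` s].
Proof.
move=> cs; apply/seteqP; split; first by move=> v; exact: vertices_hull.
move=> _ [v vs <-]; split; first by apply: conv_hull_sub; exists v.
have us : uniq s by case: cs.
have csR := convex_ccw_lat cs.
have vR : lat v \in map lat s by rewrite map_f.
have D0 := cross_corner csR vR; rewrite next_lat// prev_lat// in D0.
set n := lat (next s v) in D0; set p := lat (prev s v) in D0; set c := lat v in D0 *.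
pose L1 (x : R * R) := cross (n - c) (x - c); pose L2 (x : R * R) := cross (x - c) (p - c).
have h1 x : hull s x -> 0 <= L1 x.
  move=> hx; rewrite -[0](subrr (cross (n - c) c)) lerBlDr.
  have -> : L1 x + cross (n - c) c = - (n - c).2 * x.1 + (n - c).1 * x.2 by rewrite /L1 /cross /=; ring.
  apply: hull_halfplane hx => _ [w ws <-].
  have wR : lat w \in map lat s by rewrite map_f.
  by have := left_of_next csR vR wR; rewrite next_lat// -/n -/c /cross /=; lra.
have h2 x : hull s x -> 0 <= L2 x.
  move=> hx; rewrite -[0](subrr (cross c (p - c))) lerBlDr.
  have -> : L2 x + cross c (p - c) = (p - c).2 * x.1 + (- (p - c).1) * x.2 by rewrite /L2 /cross /=; ring.
  apply: hull_halfplane hx => _ [w ws <-].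
  have wR : lat w \in map lat s by rewrite map_f.
  by have := left_of_prev csR vR wR; rewrite prev_lat// -/p -/c /cross /=; lra.
have zero x : L1 x = 0 -> L2 x = 0 -> x = c.
  move=> z1 z2; apply/subr0_eq/eqP; rewrite -pair_eqE /=.
  have Dn : cross (n - c) (p - c) != 0 by rewrite gt_eqF.
  apply/andP; split; apply/eqP; apply: (mulIf Dn); rewrite mul0r.
    have -> : (x.1 - c.1) * cross (n - c) (p - c) = L2 x * (n - c).1 + L1 x * (p - c).1.
      by rewrite /L1 /L2 /cross /=; ring.
    by rewrite z1 z2 !mul0r addr0.
  have -> : (x.2 - c.2) * cross (n - c) (p - c) = L2 x * (n - c).2 + L1 x * (p - c).2.
    by rewrite /L1 /L2 /cross /=; ring.
  by rewrite z1 z2 !mul0r addr0.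
move=> x y t hx hy /andP[t0 t1] e.
have t1' : 0 < 1 - t by lra.
have sp (a b : R) : 0 <= a -> 0 <= b -> t * a + (1 - t) * b = 0 -> a = 0 /\ b = 0.
  move=> a0 b0 ab; have A0 := mulr_ge0 (ltW t0) a0; have B0 := mulr_ge0 (ltW t1') b0.
  have a1 : t * a = 0 by lra.
  have b1 : (1 - t) * b = 0 by lra.
  split; first by apply: (mulfI (negbT (gt_eqF t0))); rewrite mulr0.
  by apply: (mulfI (negbT (gt_eqF t1'))); rewrite mulr0.
have e1 : c.1 = t * x.1 + (1 - t) * y.1 by rewrite e.
have e2 : c.2 = t * x.2 + (1 - t) * y.2 by rewrite e.
have [] := sp _ _ (h1 x hx) (h1 y hy).
  have -> : t * L1 x + (1 - t) * L1 y = (n - c).1 * (t * x.2 + (1 - t) * y.2 - c.2) - (n - c).2 * (t * x.1 + (1 - t) * y.1 - c.1).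
    by rewrite /L1 /cross /=; ring.
  by rewrite -e1 -e2 !subrr !mulr0 subrr.
move=> x1 y1; have [] := sp _ _ (h2 x hx) (h2 y hy).
  have -> : t * L2 x + (1 - t) * L2 y = (t * x.1 + (1 - t) * y.1 - c.1) * (p - c).2 - (t * x.2 + (1 - t) * y.2 - c.2) * (p - c).1.
    by rewrite /L2 /cross /=; ring.
  by rewrite -e1 -e2 !subrr !mul0r subrr.
by move=> x2 y2; rewrite (zero x)// (zero y).
Qed.

Lemma fano_ccw (P : set (R * R)) : fano_polygon P ->
  exists s, [/\ convex_ccw s, ccw_vertices P s, P = hull s &
    forall v, v \in s -> lat_gcd v = 1].
Proof.
case=> -[[S [/finite_seqP[S0 SE] PE]] _] i0 prim.
have [T mT hT] := @minimal_points_exist R S0.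
have PT : P = hull T by rewrite PE SE hT.
rewrite PT in i0; have [s ps cs] := convex_ccw_exists mT i0.
have Ps : P = hull s.
  by rewrite PT; congr (conv_hull (_ @` _)); apply/seteqP; split => x /=; rewrite (perm_mem ps).
exists s; split => //.
- split; first by case: cs.
    by rewrite Ps vertices_ccw.
  by move=> v w vs ws; exact: left_of_next.
move=> v vs; have : vertices P (lat v) by rewrite Ps vertices_ccw//; exists v.
by move/prim => [z pz /lat_inj ->].
Qed.

Lemma dual_hull (s : seq (int * int)) : dual_polygon (hull s) = dual_of (map lat s).
Proof.
apply/seteqP; split => u /=.
  by move=> h _ /mapP[v vs ->]; rewrite /dot; apply: h; apply: conv_hull_sub; exists v.
move=> h v; apply: hull_halfplane => _ [w ws <-].
by apply: (h (lat w)); rewrite map_f.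
Qed.

Lemma dual_bounded (P : set (R * R)) : P° 0 ->
  exists M : R, forall u, dual_polygon P u -> `|u.1| <= M /\ `|u.2| <= M.
Proof.
move=> /interior0P[e e0 h]; exists (2 / e) => u hu.
have e2 : 0 < e / 2 by lra.
have el : e / 2 < e by lra.
have key (x : R) : -1 <= x * (e / 2) -> -1 <= x * - (e / 2) -> `|x| <= 2 / e.
  move=> a b; rewrite ler_norml; apply/andP; split.
    by rewrite lerNl ler_pdivlMr//; lra.
  by rewrite ler_pdivlMr//; lra.
have n0 : `|0 : R| < e by rewrite normr0.
have n1 : `|e / 2| < e by rewrite gtr0_norm.
have n2 : `|- (e / 2)| < e by rewrite normrN gtr0_norm.
split; apply: key.
- by have := hu (e / 2, 0) (h (_, _) n1 n0); rewrite /= mulr0 addr0.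
- by have := hu (- (e / 2), 0) (h (_, _) n2 n0); rewrite /= mulr0 addr0.
- by have := hu (0, e / 2) (h (_, _) n0 n1); rewrite /= mulr0 add0r.
- by have := hu (0, - (e / 2)) (h (_, _) n0 n2); rewrite /= mulr0 add0r.
Qed.

(** The edge at [v] determines the point [q] of the dual polygon where [v] and its
    successor are tight. It is extreme, so [l q] is an extreme point of a lattice
    polygon, hence a lattice point. *)
Lemma index_dual (s : seq (int * int)) (l : nat) (v : int * int) :
  convex_ccw s -> has_index (hull s) l -> v \in s ->
  exists z : int * int, l%:Z * (next s v - v).1 = z.1 * det2 v (next s v) /\
    l%:Z * (next s v - v).2 = z.2 * det2 v (next s v).
Proof.
move=> cs [[l0 [[S [_ SE]] _]] _] vs.
have us : uniq s by case: cs.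
have csR := convex_ccw_lat cs.
have vR : lat v \in map lat s by rewrite map_f.
have ns : next s v \in s by rewrite mem_next.
have d0 : 0 < det2 v (next s v) by case: cs => _ _ dt _; exact: dt.
set n := next s v in ns d0 *.
pose dR : R := (det2 v n)%:~R.
have dR0 : 0 < dR by rewrite ltr0z.
have dRn : dR != 0 by rewrite gt_eqF.
have dE : dR = v.1%:~R * n.2%:~R - v.2%:~R * n.1%:~R by rewrite /dR /det2 rmorphB !rmorphM.
pose E := dual_vertex (map lat s) (lat v).
pose q : R * R := (- E.2, E.1).
have EE : E = ((n.1%:~R - v.1%:~R) / dR, (n.2%:~R - v.2%:~R) / dR).
  by rewrite /E /dual_vertex next_lat// cross_lat.
have dq (w : R * R) : dot q w = - cross w E by rewrite /dot /q /cross /=; ring.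
have qd : dual_polygon (hull s) q.
  rewrite dual_hull => w ws; rewrite dq lerN2; exact: cross_edge_le1.
have ext : vertices [set l%:R *: u | u in dual_polygon (hull s)] (l%:R *: q).
  split; first by exists q.
  move=> _ _ t [a ha <-] [b hb <-] /andP[t0 t1] e.
  have lR : l%:R != 0 :> R by rewrite pnatr_eq0 -lt0n.
  have {}e : q = t *: a + (1 - t) *: b.
    apply: (scalerI lR); rewrite e scalerDr !scalerA.
    by congr (_ *: _ + _ *: _); rewrite mulrC.
  congr (_ *: _).
  have t1' : 0 < 1 - t by lra.
  have e1 : q.1 = t * a.1 + (1 - t) * b.1 by rewrite e.
  have e2 : q.2 = t * a.2 + (1 - t) * b.2 by rewrite e.
  have tight w : w \in s -> dot q (lat w) = -1 -> dot a (lat w) = -1 /\ dot b (lat w) = -1.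
    move=> ws dw; have wP : hull s (lat w) by apply: conv_hull_sub; exists w.
    have := ha _ wP; have := hb _ wP; rewrite -/(dot a (lat w)) -/(dot b (lat w)) => hb' ha'.
    have eq : t * (dot a (lat w) + 1) + (1 - t) * (dot b (lat w) + 1) = 0.
      have -> : t * (dot a (lat w) + 1) + (1 - t) * (dot b (lat w) + 1) =
        (t * a.1 + (1 - t) * b.1) * (lat w).1 + (t * a.2 + (1 - t) * b.2) * (lat w).2 + 1 by rewrite /dot; ring.
      by rewrite -e1 -e2; move: dw; rewrite /dot; lra.
    have A0 : 0 <= t * (dot a (lat w) + 1) by apply: mulr_ge0; lra.
    have B0 : 0 <= (1 - t) * (dot b (lat w) + 1) by apply: mulr_ge0; lra.
    have A1 : t * (dot a (lat w) + 1) = 0 by lra.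
    have B1 : (1 - t) * (dot b (lat w) + 1) = 0 by lra.
    move/eqP: A1; rewrite mulf_eq0 (gt_eqF t0) /= => /eqP A1.
    move/eqP: B1; rewrite mulf_eq0 (gt_eqF t1') /= => /eqP B1.
    by split; lra.
  have [av bv] : dot a (lat v) = -1 /\ dot b (lat v) = -1.
    by apply: tight => //; rewrite dq cross_edge_l.
  have [an bn] : dot a (lat n) = -1 /\ dot b (lat n) = -1.
    by apply: tight => //; rewrite dq /E -next_lat// cross_edge_r.
  apply/subr0_eq/eqP; rewrite -pair_eqE /=.
  apply/andP; split; apply/eqP; apply: (mulIf dRn); rewrite mul0r.
    have -> : (a.1 - b.1) * dR = (dot a (lat v) - dot b (lat v)) * n.2%:~R - (dot a (lat n) - dot b (lat n)) * v.2%:~R.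
      by rewrite dE /dot /=; ring.
    by rewrite av bv an bn !subrr !mul0r subrr.
  have -> : (a.2 - b.2) * dR = (dot a (lat n) - dot b (lat n)) * v.1%:~R - (dot a (lat v) - dot b (lat v)) * n.1%:~R.
    by rewrite dE /dot /=; ring.
  by rewrite av bv an bn !subrr !mul0r subrr.
have SE' : [set l%:R *: u | u in dual_polygon (hull s)] = conv_hull (lat @` S) := SE.
rewrite SE' in ext; have [z _ zE] := vertices_hull ext.
have z1 : z.1%:~R = l%:R * - E.2 :> R by rewrite -[LHS]/((lat z).1) zE.
have z2 : z.2%:~R = l%:R * E.1 :> R by rewrite -[LHS]/((lat z).2) zE.
exists (z.2, - z.1); split; apply: (@intr_inj R); rewrite /= !rmorphM /= ?rmorphN rmorphB /= -/dR.
  by rewrite z2 EE /=; field.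
by rewrite z1 EE /=; field.
Qed.

End Fano.

(** * Kaehler-Einstein Fano polygons of index at most 17 *)

Section Classify.
Variable R : realType.
Local Notation lat := (@lat R).
Local Notation hull s := (conv_hull (lat @` [set` s])).

(** Written for lattice points, as this is the form that clearing denominators
    turns into an identity of integers. *)
Definition balanced (s : seq (int * int)) : Prop :=
  let t := map lat s in
  \sum_(v <- t) cross (dual_vertex t v) (dual_vertex t (next t v)) *:
    (dual_vertex t v + dual_vertex t (next t v)) = 0 :> R * R.

Lemma ke_balanced (s : seq (int * int)) : convex_ccw s -> (hull s)° 0 ->
  kahler_einstein (hull s) -> balanced s.
Proof.
move=> cs i0; have [M bM] := dual_bounded i0.
rewrite /kahler_einstein dual_hull in bM *.
exact: barycenter_edges (convex_ccw_lat R cs) bM.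
Qed.

Lemma dual_vertex_lat s (v : int * int) : convex_ccw s -> v \in s ->
  dual_vertex (map lat s) (lat v) =
  ((next s v - v).1%:~R / (det2 v (next s v))%:~R, (next s v - v).2%:~R / (det2 v (next s v))%:~R).
Proof.
case=> us _ _ _ vs; rewrite /dual_vertex next_lat// cross_lat.
by rewrite /= !rmorphB.
Qed.

Lemma cross_dual_vertex_lat s (v w : int * int) : convex_ccw s -> v \in s ->
  cross (lat w) (dual_vertex (map lat s) (lat v)) =
  (det2 w (next s v - v))%:~R / (det2 v (next s v))%:~R.
Proof.
move=> cs vs; rewrite dual_vertex_lat// {1}/cross /= !mulrA -mulrBl; congr (_ / _).
by rewrite /det2 /= [in RHS]rmorphB !rmorphM.
Qed.

Lemma balanced_slab s (v w : int * int) : convex_ccw s -> balanced s ->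
  v \in s -> w \in s ->
  - 2 * det2 v (next s v) <= det2 w (next s v - v) /\
  (size s <> 3%N -> - 2 * det2 v (next s v) < det2 w (next s v - v)).
Proof.
move=> cs bal vs ws; have csR := convex_ccw_lat R cs.
have vR : lat v \in map lat s by rewrite map_f.
have wR : lat w \in map lat s by rewrite map_f.
have d0 : 0 < (det2 v (next s v))%:~R :> R by rewrite ltr0z; case: cs => _ _ dt _; exact: dt.
split.
  have := minkowski csR bal vR wR; rewrite cross_dual_vertex_lat// ler_pdivlMr//.
  by rewrite -(ler_int R) rmorphM rmorphN.
move=> s3; have := minkowski_strict csR bal _ vR wR; rewrite size_map => /(_ s3).
by rewrite cross_dual_vertex_lat// ltr_pdivlMr// -(ltr_int R) rmorphM rmorphN.
Qed.

Lemma balanced_int_polygon (s : seq (int * int)) (l : int) : convex_ccw s -> balanced s ->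
  0 < l -> size s <> 3%N ->
  (forall v, v \in s -> lat_gcd v = 1) ->
  (forall v, v \in s -> exists z : int * int,
     l * (next s v - v).1 = z.1 * det2 v (next s v) /\
     l * (next s v - v).2 = z.2 * det2 v (next s v)) ->
  exists E, int_polygon l E s.
Proof.
move=> cs bal l0 s3 prim dual; have [us sz dt left] := cs.
(* these divisions are exact *)
pose E v : int * int := (divz (l * (next s v - v).1) (det2 v (next s v)),
   divz (l * (next s v - v).2) (det2 v (next s v))).
have du v : v \in s -> l * (next s v - v).1 = (E v).1 * det2 v (next s v) /\
    l * (next s v - v).2 = (E v).2 * det2 v (next s v).
  move=> vs; have [z [e1 e2]] := dual v vs.
  have dn : det2 v (next s v) != 0 by rewrite gt_eqF// dt.
  by rewrite /E e1 e2 /= !mulzK.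
have lR : (l%:~R : R) != 0 by rewrite intr_eq0 gt_eqF.
have edE v : v \in s -> dual_vertex (map lat s) (lat v) = ((E v).1%:~R / l%:~R, (E v).2%:~R / l%:~R).
  move=> vs; rewrite dual_vertex_lat//; have [e1 e2] := du v vs.
  have dR : (det2 v (next s v))%:~R != 0 :> R by rewrite intr_eq0 gt_eqF// dt.
  congr pair; apply: (mulfI lR); rewrite mulrA -rmorphM.
    by rewrite e1 rmorphM /= mulfK//; field.
  by rewrite e2 rmorphM /= mulfK//; field.
exists E; split => //.
- move=> v w vs ws wv wn; have [_ ->//] := balanced_slab cs bal vs ws.
  by have := left v w vs ws wv wn; rewrite /cross /det2 /=; lra.
move: bal; rewrite /balanced big_map big_seq => bal.
have term v : v \in s ->
  cross (dual_vertex (map lat s) (lat v)) (dual_vertex (map lat s) (next (map lat s) (lat v))) *: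
  (dual_vertex (map lat s) (lat v) + dual_vertex (map lat s) (next (map lat s) (lat v))) =
  ((l%:~R ^+ 3)^-1 * (det2 (E v) (E (next s v)) * ((E v).1 + (E (next s v)).1))%:~R,
   (l%:~R ^+ 3)^-1 * (det2 (E v) (E (next s v)) * ((E v).2 + (E (next s v)).2))%:~R).
  move=> vs; have ns : next s v \in s by rewrite mem_next.
  rewrite next_lat// !edE//; apply/eqP; rewrite -pair_eqE /=.
  apply/andP; split; apply/eqP; rewrite /GRing.scale /cross /det2 /= !(rmorphM, rmorphD, rmorphN) /=; field; exact: lR.
rewrite (eq_bigr _ term) in bal.
have l3 : (l%:~R ^+ 3)^-1 != 0 :> R by rewrite invr_eq0 expf_neq0.
split; apply: (@intr_inj R); apply: (mulfI l3); rewrite mulr0 rmorph_sum mulr_sumr big_seq.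
  by have := congr1 fst bal; rewrite (raddf_sum fst).
by have := congr1 snd bal; rewrite (raddf_sum snd).
Qed.

(** Minkowski's inequality bounds the sum of any two of the three determinants by
    twice the third one, so that all three are equal; they are the barycentric
    coordinates of the origin. *)
Lemma triangle_sum (s : seq (int * int)) : convex_ccw s -> balanced s -> size s = 3%N ->
  exists z1 z2 z3 : int * int, [/\ s = [:: z1; z2; z3], z1 + z2 + z3 = 0 & cross z1 z2 != 0].
Proof.
move=> cs bal; have sl := fun v w => @balanced_slab s v w cs bal; have [us _ dt _] := cs.
case: s cs bal sl us dt => [|z1 [|z2 [|z3 [|]]]]// cs bal sl us dt _; exists z1, z2, z3.
have n1 : next [:: z1; z2; z3] z1 = z2 by apply: (@next_cat_cons _ [::]).
have n2 : next [:: z1; z2; z3] z2 = z3 by apply: (@next_cat_cons _ [:: z1]).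
have n3 : next [:: z1; z2; z3] z3 = z1 by apply: (@next_rcons _ z1 z3 [:: z2]).
have m1 : z1 \in [:: z1; z2; z3] by rewrite !inE eqxx.
have m2 : z2 \in [:: z1; z2; z3] by rewrite !inE eqxx orbT.
have m3 : z3 \in [:: z1; z2; z3] by rewrite !inE eqxx !orbT.
have := dt _ m1; have := dt _ m2; have := dt _ m3; rewrite n1 n2 n3 => d3 d2 d1.
have [s1 _] := sl _ _ m1 m3; have [s2 _] := sl _ _ m2 m1; have [s3 _] := sl _ _ m3 m2.
rewrite n1 n2 n3 in s1 s2 s3.
have eq12 : cross z1 z2 = cross z2 z3 by move: s1 s2 s3; rewrite /det2 /cross /=; lra.
have eq23 : cross z1 z2 = cross z3 z1 by move: s1 s2 s3; rewrite /det2 /cross /=; lra.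
have c0 : cross z1 z2 != 0 by rewrite gt_eqF.
split => //; apply/eqP; rewrite -pair_eqE /=; apply/andP; split; apply/eqP; apply: (mulIf c0); rewrite mul0r.
  have -> : (z1.1 + z2.1 + z3.1) * cross z1 z2 = z1.1 * (cross z1 z2 - cross z2 z3) + z2.1 * (cross z1 z2 - cross z3 z1).
    by rewrite /cross; ring.
  by rewrite -eq12 -eq23 !subrr !mulr0 addr0.
have -> : (z1.2 + z2.2 + z3.2) * cross z1 z2 = z1.2 * (cross z1 z2 - cross z2 z3) + z2.2 * (cross z1 z2 - cross z3 z1).
  by rewrite /cross; ring.
by rewrite -eq12 -eq23 !subrr !mulr0 addr0.
Qed.

Lemma ke_classification (P : set (R * R)) (l : nat) : fano_polygon P ->
  kahler_einstein P -> has_index P l -> (l <= 17)%N ->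
  exists s, [/\ convex_ccw s, ccw_vertices P s, P = hull s,
    forall v, v \in s -> lat_gcd v = 1 &
    (exists z1 z2 z3 : int * int, [/\ s = [:: z1; z2; z3], z1 + z2 + z3 = 0 & cross z1 z2 != 0])
    \/ irotation s].
Proof.
move=> fP ke hl l17; have [s [cs ccw PE prim]] := fano_ccw fP.
exists s; split => //.
have l0 : (0 < l)%N by case: hl => -[].
have i0 : (hull s)° 0 by rewrite -PE; case: fP.
rewrite PE in ke hl; have bal := ke_balanced cs i0 ke.
have [s3|s3] := eqVneq (size s) 3%N; [left; exact: triangle_sum|right].
have du v : v \in s -> _ := fun vs => index_dual cs hl vs.
have l0z : 0 < l%:Z by rewrite ltz_nat.
have [E ip] := balanced_int_polygon cs bal l0z (elimN eqP s3) prim du.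
apply: int_polygon_rotation ip; first by rewrite !lez_nat l0.
by case: cs => _ sz _ _; rewrite ltn_neqAle eq_sym s3.
Qed.

End Classify.

(** * Rotations of lattice polygons *)

Section Rotations.
Variable R : realType.
Local Notation lat := (@lat R).
Local Notation hull s := (conv_hull (lat @` [set` s])).

Definition rotation_like (F : pzRingType) (a b c d : F) : Prop :=
  a * d - b * c = 1 /\ ([/\ a = -1, b = 0, c = 0 & d = -1] \/ a + d = -1).

(** Used to pass to the adjugate, which is the inverse. If the trace is [-1], the
    map has order 3, so that its inverse is its square. *)
Lemma rotation_like_inv (a b c d : R) (P : set (R * R)) : rotation_like a b c d ->
  (forall x, P x -> P (lin2 a b c d x)) ->
  forall x, P x -> P (lin2 d (- b) (- c) a x).
Proof.
move=> [dt [[-> -> -> ->]|tr]] h x Px; first by rewrite oppr0; exact: h.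
have := h _ (h _ Px); congr (P _); rewrite /lin2 /=.
have dE : d = -1 - a by lra.
have bc : b * c = a * d - 1 by lra.
(* the entries of the adjugate are those of the square *)
have e1 : d = a * a + b * c by rewrite bc dE; ring.
have e2 : a = c * b + d * d by rewrite [c * b]mulrC bc dE; ring.
have e3 : - b = a * b + b * d by rewrite dE; ring.
have e4 : - c = c * a + d * c by rewrite dE; ring.
by congr pair; [rewrite [in RHS]e1 e3|rewrite [in RHS]e2 e4]; ring.
Qed.

(** The transposed map leaves the dual polygon invariant. *)
Lemma ke_of_rotation (P : set (R * R)) (a b c d : R) : fano_polygon P ->
  rotation_like a b c d -> (forall x, P x -> P (lin2 a b c d x)) -> kahler_einstein P.
Proof.
move=> fP rl h; have h' := rotation_like_inv rl h; have [dt kind] := rl.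
have [s [cs _ PE _]] := fano_ccw fP.
have [M bM] : exists M : R, forall u, dual_polygon P u -> `|u.1| <= M /\ `|u.2| <= M.
  by apply: dual_bounded; case: fP.
rewrite /kahler_einstein; apply: (@barycenter_invariant R _ M a c b d) => //.
- rewrite PE dual_hull; exact: measurable_dual_of.
- by rewrite [c * b]mulrC.
- by case: kind => [[-> _ _ ->]|->]; apply/eqP; lra.
move=> u; split => hu v Pv.
  have := hu _ (h' _ Pv).
  have <- : (a * d - b * c) * (u.1 * v.1 + u.2 * v.2) = u.1 * v.1 + u.2 * v.2 by rewrite dt mul1r.
  by congr (_ <= _); rewrite /lin2 /=; ring.
have := hu _ (h _ Pv); congr (_ <= _); rewrite /lin2 /=; ring.
Qed.

Lemma lat_ilin (a b c d : int) v :
  lat (ilin a b c d v) = lin2 a%:~R b%:~R c%:~R d%:~R (lat v).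
Proof. by rewrite /lat /ilin /lin2 /= !rmorphD !rmorphM. Qed.

Lemma lin2K (a b c d : R) : a * d - b * c = 1 ->
  cancel (lin2 a b c d) (lin2 d (- b) (- c) a).
Proof.
move=> dt [x y]; rewrite /lin2 /=; congr pair.
  by transitivity ((a * d - b * c) * x); [ring|rewrite dt mul1r].
by transitivity ((a * d - b * c) * y); [ring|rewrite dt mul1r].
Qed.

Lemma lin2VK (a b c d : R) : a * d - b * c = 1 ->
  cancel (lin2 d (- b) (- c) a) (lin2 a b c d).
Proof.
move=> dt [x y]; rewrite /lin2 /=; congr pair.
  by transitivity ((a * d - b * c) * x); [ring|rewrite dt mul1r].
by transitivity ((a * d - b * c) * y); [ring|rewrite dt mul1r].
Qed.

Lemma det2_ilin (a b c d : int) v w : a * d - b * c = 1 ->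
  det2 (ilin a b c d v) (ilin a b c d w) = det2 v w.
Proof.
move=> dt; transitivity ((a * d - b * c) * det2 v w); last by rewrite dt mul1r.
by rewrite /det2 /ilin /=; ring.
Qed.

Lemma ilin_inj (a b c d : int) : a * d - b * c = 1 -> injective (ilin a b c d).
Proof.
move=> dt; apply: (can_inj (g := ilin d (- b) (- c) a)) => -[x y]; rewrite /ilin /=.
congr pair.
  by transitivity ((a * d - b * c) * x); [ring|rewrite dt mul1r].
by transitivity ((a * d - b * c) * y); [ring|rewrite dt mul1r].
Qed.

Lemma ilinB (a b c d : int) v w : ilin a b c d (v - w) = ilin a b c d v - ilin a b c d w.
Proof. by rewrite /ilin; apply/eqP; rewrite -pair_eqE /=; apply/andP; split; apply/eqP; ring. Qed.

Lemma ilinD (a b c d : int) v w : ilin a b c d (v + w) = ilin a b c d v + ilin a b c d w.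
Proof. by rewrite /ilin; apply/eqP; rewrite -pair_eqE /=; apply/andP; split; apply/eqP; ring. Qed.

Lemma lat_gcd_ilin (a b c d : int) v : a * d - b * c = 1 ->
  lat_gcd (ilin a b c d v) = lat_gcd v.
Proof.
case: v => x y dt; rewrite /lat_gcd /ilin /=.
have dtZ : Z.sub (Z.mul (Z_of_int a) (Z_of_int d)) (Z.mul (Z_of_int b) (Z_of_int c)) = Zpos xH by lia.
by have := zlin_gcd dtZ (Z_of_int x) (Z_of_int y); lia.
Qed.

Definition rotation_invariant (P : set (R * R)) : Prop :=
  exists a b c d : int, rotation_like a b c d /\
    forall x, P x -> P (lin2 a%:~R b%:~R c%:~R d%:~R x).

Lemma rotation_like_intr (a b c d : int) : rotation_like a b c d ->
  rotation_like (a%:~R : R) b%:~R c%:~R d%:~R.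
Proof.
case=> dt kind; split; first by rewrite -!rmorphM -rmorphB dt.
by case: kind => [[-> -> -> ->]|tr]; [left|right; rewrite -rmorphD tr].
Qed.

Lemma irotation_hull s : irotation s -> rotation_invariant (hull s).
Proof.
case=> a [b [c [d [dt kind mem]]]]; exists a, b, c, d; split; first by split.
apply: hull_lin2 => _ [v vs <-]; exists (ilin a b c d v); first exact: mem.
by rewrite lat_ilin.
Qed.

(** Neither kind of rotation has the eigenvalue 1. *)
Lemma rotation_symmetric (P : set (R * R)) : rotation_invariant P -> symmetric_polygon P.
Proof.
case=> a [b [c [d [rl h]]]] z fixed.
have rlR := rotation_like_intr rl; have [dtR _] := rlR; have [dt kind] := rl.
pose A : 'M[int]_2 := \matrix_(i, j)
  (if i == 0 then (if j == 0 then a else b) else (if j == 0 then c else d)).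
have AE x : lin_act A x = lin2 a%:~R b%:~R c%:~R d%:~R x by rewrite /lin_act !mxE.
have autA : automorphism P A.
  split; first rewrite unitmxE (expand_det_row _ 0) !big_ord_recl big_ord0 /cofactor !det_mx11 !mxE /=.
    by rewrite addr0 expr0 expr1 mul1r mulN1r mulrN dt unitr1.
  apply/seteqP; split => [_ [x Px <-]|x Px]; first by rewrite AE; exact: h.
  exists (lin2 d%:~R (- b%:~R) (- c%:~R) a%:~R x); first exact: rotation_like_inv rlR h _ Px.
  by rewrite AE lin2VK.
have := fixed A autA; rewrite AE -lat_ilin => /lat_inj.
case: z {fixed} => x y; rewrite /ilin /= => -[e1 e2].
have t2 : 2 - (a + d) != 0 by case: kind => [[-> _ _ ->]|->].
congr pair; apply: (mulIf t2); rewrite mul0r.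
  have -> : x * (2 - (a + d)) = (x - (a * x + b * y)) * (1 - d) + b * (y - (c * x + d * y)) - (1 - (a * d - b * c)) * - x by ring.
  by rewrite e1 e2 dt !subrr !mul0r mulr0 subr0 addr0.
have -> : y * (2 - (a + d)) = (y - (c * x + d * y)) * (1 - a) + c * (x - (a * x + b * y)) - (1 - (a * d - b * c)) * - y by ring.
by rewrite e1 e2 dt !subrr !mul0r mulr0 subr0 addr0.
Qed.

Lemma vertices_lin2 (P : set (R * R)) (a b c d : R) v : rotation_like a b c d ->
  (forall x, P x -> P (lin2 a b c d x)) -> vertices P v -> vertices P (lin2 a b c d v).
Proof.
move=> rl h [Pv ext]; split; first exact: h.
have [dt _] := rl; have h' := rotation_like_inv rl h.
move=> x y t Px Py t01 e; apply: (can_inj (lin2VK dt)).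
apply: (ext _ _ t (h' _ Px) (h' _ Py) t01).
by rewrite -lin2_comb -e lin2K.
Qed.

Lemma rotation_like_adj (F : comPzRingType) (a b c d : F) : rotation_like a b c d ->
  rotation_like d (- b) (- c) a.
Proof.
case=> dt kind; split; first by rewrite -dt; ring.
by case: kind => [[-> -> -> ->]|tr]; [left; rewrite oppr0|right; rewrite addrC].
Qed.

Lemma ccw_vertices_ilin (P : set (R * R)) (a b c d : int) s : rotation_like a b c d ->
  (forall x, P x -> P (lin2 a%:~R b%:~R c%:~R d%:~R x)) ->
  ccw_vertices P s -> ccw_vertices P (map (ilin a b c d) s).
Proof.
move=> rl h [us vE left]; have [dt kind] := rl.
have rlR := rotation_like_intr rl; have [dtR _] := rlR.
have inj := ilin_inj dt.
split; first by rewrite map_inj_uniq.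
- rewrite -vE; apply/seteqP; split => _ [v vs <-].
    move: vs => /= /mapP[w ws ->]; rewrite lat_ilin.
    have : vertices P (lin2 a%:~R b%:~R c%:~R d%:~R (lat w)).
      by apply: vertices_lin2 => //; rewrite -vE; exists w.
    by rewrite -vE.
  have : vertices P (lin2 d%:~R (- b%:~R) (- c%:~R) a%:~R (lat v)).
    apply: vertices_lin2; first exact: rotation_like_adj.
      exact: rotation_like_inv rlR h.
    by rewrite -vE; exists v.
  rewrite -vE => -[w ws we]; exists (ilin a b c d w); first by rewrite /= map_f.
  by rewrite lat_ilin we lin2VK.
move=> _ _ /mapP[v vs ->] /mapP[w ws ->]; rewrite (next_map inj us).
by rewrite -!ilinB det2_ilin// left.
Qed.

Lemma B_points_lin2 (P : set (R * R)) (a b c d : int) u : rotation_like a b c d ->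
  (forall x, P x -> P (lin2 a%:~R b%:~R c%:~R d%:~R x)) ->
  B_points P u -> B_points P (lin2 a%:~R b%:~R c%:~R d%:~R u).
Proof.
move=> rl h [s [v [ccw vs ->]]]; have [dt kind] := rl; have [us _ _] := ccw.
exists (map (ilin a b c d) s), (ilin a b c d v); split.
- exact: ccw_vertices_ilin.
- by rewrite map_f.
rewrite (next_map (ilin_inj dt) us) -ilinD lat_gcd_ilin// lat_ilin.
by apply/eqP; rewrite -pair_eqE /lin2 /=; apply/andP; split; apply/eqP; rewrite /GRing.scale/=; ring.
Qed.

End Rotations.

(** * The B-transformation *)

Section BTransform.
Variable R : realType.
Local Notation lat := (@lat R).
Local Notation hull s := (conv_hull (lat @` [set` s])).

Lemma lat0 : lat 0 = 0.
Proof. by apply/eqP; rewrite -pair_eqE /= eqxx. Qed.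

(** Extreme points of the hull lie in [X], and 0 is not extreme because it is the
    midpoint of a small segment in the hull. *)
Lemma fano_hull (X : set (int * int)) : finite_set X ->
  (forall z, X z -> z != 0 -> lat_gcd z = 1) -> (conv_hull (lat @` X))° 0 ->
  fano_polygon (conv_hull (lat @` X)).
Proof.
move=> fX prim i0; split => //; first by split; [exists X|exists 0].
move=> v vv; have [z Xz zE] := vertices_hull vv; exists z => //.
apply: prim => //; apply/eqP => z0.
have [e e0 h] := (proj1 (interior0P _)) i0.
have v0 : v = 0 by rewrite -zE z0 lat0.
have e2 : `|e / 2| < e by rewrite gtr0_norm; lra.
have n0 : `|0 : R| < e by rewrite normr0.
have [_ /(_ (e / 2, 0) (- (e / 2), 0) 2^-1)] := vv.
have P1 : conv_hull (lat @` X) (e / 2, 0) by exact: h.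
have P2 : conv_hull (lat @` X) (- (e / 2), 0) by apply: h => //=; rewrite normrN.
move=> /(_ P1 P2)/(_ _ _)/wrap[]; first by apply/andP; split; lra.
  rewrite v0; apply/eqP; rewrite -pair_eqE /=; apply/andP; split; apply/eqP; rewrite /GRing.scale/=; lra.
by move=> -[h1]; clear -e0 h1; lra.
Qed.

(** The integer division is exact, and it maps 0 to 0. *)
Definition reduced (z : int * int) : int * int :=
  (divz z.1 (lat_gcd z), divz z.2 (lat_gcd z)).

Lemma lat_reduced (z : int * int) : (lat_gcd z)%:~R^-1 *: lat z = lat (reduced z).
Proof.
case: z => x y; rewrite /reduced /lat_gcd /=.
have [g0|g0] := eqVneq (gcdz x y) 0.
  have /andP[/eqP-> /eqP->] : (x == 0) && (y == 0) by rewrite -gcdz_eq0 g0.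
  by rewrite !div0z; apply/eqP; rewrite -pair_eqE /lat /= /GRing.scale/= !mulr0 !eqxx.
have gR : (gcdz x y)%:~R != 0 :> R by rewrite intr_eq0.
apply/eqP; rewrite -pair_eqE /lat /=; apply/andP; split; apply/eqP;
  rewrite /GRing.scale/=; apply: (mulfI gR); rewrite mulrA divff// mul1r -rmorphM mulrC divzK//.
- exact: dvdz_gcdl.
- exact: dvdz_gcdr.
Qed.

Lemma reduced_prim (z : int * int) : reduced z != 0 -> lat_gcd (reduced z) = 1.
Proof.
case: z => x y; rewrite /reduced /lat_gcd /= => nz.
have g0 : gcdz x y != 0.
  apply: contra_neq nz => g0; have /andP[/eqP-> /eqP->] : (x == 0) && (y == 0) by rewrite -gcdz_eq0 g0.
  by rewrite !div0z.
apply: (mulIf g0); rewrite mul1r.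
have gp : 0 <= gcdz x y by [].
rewrite -[X in _ * X](ger0_norm gp) -abszE mulz_gcdl !divzK ?dvdz_gcdl ?dvdz_gcdr//.
Qed.

Lemma B_points_lattice (P : set (R * R)) (s0 : seq (int * int)) : ccw_vertices P s0 ->
  exists X : set (int * int), [/\ finite_set X, B_points P = lat @` X &
    forall z, X z -> z != 0 -> lat_gcd z = 1].
Proof.
move=> [_ vE _]; pose X := [set z | exists s v, [/\ ccw_vertices P s, v \in s & z = reduced (v + next s v)]].
exists X; split.
- apply: (@sub_finite_set _ _ [set` [seq reduced (v + w) | v <- s0, w <- s0]]); last exact: finite_seq.
  move=> _ [s [v [[_ sE _] vs ->]]] /=.
  have mem w : w \in s -> w \in s0.
    move=> ws; have : (lat @` [set` s0]) (lat w) by rewrite vE -sE; exists w.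
    by case=> w' ws' /lat_inj <-.
  by apply/allpairsP; exists (v, next s v); split; rewrite //= mem// mem_next.
- apply/seteqP; split => [u [s [v [ccw vs ->]]]|_ [_ [s [v [ccw vs ->]]] <-]].
    by exists (reduced (v + next s v)); [exists s, v|rewrite -lat_reduced].
  by exists s, v; split => //; rewrite lat_reduced.
- by move=> _ [s [v [_ _ ->]]]; exact: reduced_prim.
Qed.

Lemma B_transform_fano (P : set (R * R)) : fano_polygon P ->
  (B_transform P)° 0 -> fano_polygon (B_transform P).
Proof.
move=> fP; have [s [_ ccw _ _]] := fano_ccw fP.
have [X [fX XE prim]] := B_points_lattice ccw.
by rewrite /B_transform XE => i0; exact: fano_hull.
Qed.

(** A map of order 3 has no real eigenvector: the quadratic form
    [cross p (A p)] has the discriminant [(a + d) ^ 2 - 4 = -3]. *)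
Lemma order3_form_neq0 (a b c d : R) (p : R * R) : a * d - b * c = 1 -> a + d = -1 ->
  p != 0 -> cross p (lin2 a b c d p) != 0.
Proof.
move=> dt tr; apply: contra_neq; rewrite /cross /lin2 /=; case: p => x y /= h.
(* completing the square in [4 c] times the form *)
have sq : (2 * c * x + (d - a) * y) ^+ 2 + 3 * y ^+ 2 = 0.
  have -> : (2 * c * x + (d - a) * y) ^+ 2 + 3 * y ^+ 2 =
    4 * c * (x * (c * x + d * y) - y * (a * x + b * y)) +
    y ^+ 2 * ((a + d) ^+ 2 - 4 * (a * d - b * c) + 3) by ring.
  by rewrite h tr dt; ring.
have y0 : y = 0.
  have s1 := sqr_ge0 (2 * c * x + (d - a) * y); have s2 := sqr_ge0 y.
  by apply/eqP; rewrite -sqrf_eq0; apply/eqP; lra.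
move: sq; rewrite y0 mulr0 addr0 expr0n /= mulr0 addr0 => /eqP.
rewrite sqrf_eq0 => /eqP cx.
have c0 : c != 0.
  apply/eqP => c0; have dE : d = -1 - a by lra.
  have : a ^+ 2 + a + 1 = 0 by move: dt; rewrite c0 dE; lra.
  by have := sqr_ge0 (2 * a + 1); lra.
have -> : x = 0.
  by apply: (mulfI c0); lra.
by [].
Qed.

(** Otherwise, for consecutive vertices [v], [w], [x], the vertices [v], [x] and
    [- w] lie on a line in the direction of [v + w], and [- w] lies between the
    other two, which is impossible for a vertex. *)
Lemma central_corner (s : seq (int * int)) : convex_ccw s ->
  (forall v, v \in s -> - v \in s) ->
  exists v, v \in s /\ cross (v + next s v) (next s v + next s (next s v)) != 0.
Proof.
move=> cs cen; have [us sz dt left] := cs.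
have [v vs] : exists v, v \in s by case: (s) sz => // v t _; exists v; rewrite mem_head.
exists v; split => //; set w := next s v; set x := next s w; apply/eqP => c0.
have ws : w \in s by rewrite mem_next.
have xs : x \in s by rewrite mem_next.
have us' : - w \in s by exact: cen.
have d1 : 0 < cross v w by exact: dt.
have d2 : 0 < cross w x by exact: dt.
set u := - w in us'; set n := next s u.
have vu : v != u.
  apply/eqP => e; move: d1; rewrite e /u /cross /=; lra.
have xu : x != u.
  apply/eqP => e; move: d2; rewrite e /u /cross /=; lra.
have A0 : 0 <= cross (n - u) (v - u) by exact: left_of_next.
have B0 : 0 <= cross (n - u) (x - u) by exact: left_of_next.
(* [x - u] is a negative multiple of [v - u], so the edge at [u] cannot have
   both of them on its left unless both lie on it *)
have rel : cross v w * cross (n - u) (x - u) = - (cross w x * cross (n - u) (v - u)).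
  have -> : cross v w * cross (n - u) (x - u) =
    cross v w * cross (n - u) (x + w) by rewrite /u opprK.
  have -> : cross (n - u) (v - u) = cross (n - u) (v + w) by rewrite /u opprK.
  move: (n - u) c0 => m; rewrite /cross /= => c0.
  apply/eqP; rewrite -subr_eq0; apply/eqP.
  transitivity ((m.1 * w.2 - m.2 * w.1) * ((v.1 + w.1) * (w.2 + x.2) - (v.2 + w.2) * (w.1 + x.1))).
    ring.
  by rewrite c0 mulr0.
have A1 : cross w x * cross (n - u) (v - u) = 0.
  have := mulr_ge0 (ltW d1) B0; have := mulr_ge0 (ltW d2) A0; lra.
have B1 : cross v w * cross (n - u) (x - u) = 0 by rewrite rel A1 oppr0.
have zero (k y : int) : 0 < k -> k * y = 0 -> y = 0.
  by move=> k0 /eqP; rewrite mulf_eq0 (gt_eqF k0) => /eqP.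
have vn : v = n.
  by apply/eqP/negPn/negP => vn; have := left u v us' vs vu vn; rewrite (zero _ _ d2 A1) ltxx.
have xn : x = n.
  by apply/eqP/negPn/negP => xn; have := left u x us' xs xu xn; rewrite (zero _ _ d1 B1) ltxx.
by have := prev_neq_next cs ws; rewrite (prev_next us) -/x vn xn eqxx.
Qed.

(** The rotation permutes the points that span the transform. Under a map of order
    3 the orbit of any of these points is a triangle around the origin; under [-1]
    two of them that are not proportional, and their negatives, surround it. *)
Lemma rotation_invariant_B (P : set (R * R)) : fano_polygon P -> rotation_invariant P ->
  fano_polygon (B_transform P) /\ rotation_invariant (B_transform P).
Proof.
move=> fP [a [b [c [d [rl h]]]]].
have inv x : B_transform P x -> B_transform P (lin2 a%:~R b%:~R c%:~R d%:~R x).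
  by apply: hull_lin2 => u; exact: B_points_lin2.
split; last by exists a, b, c, d.
apply: B_transform_fano => //.
have [s [cs ccw PE prim]] := fano_ccw fP; have [us sz dt left] := cs.
have cB : convex_set (B_transform P) := @conv_hull_convex _ _.
have bp v : v \in s -> B_transform P (lat (reduced (v + next s v))).
  by move=> vs; apply: conv_hull_sub; exists s, v; rewrite lat_reduced.
have red_neq0 z : z != 0 -> (lat_gcd z)%:~R^-1 != 0 :> R.
  move=> z0; rewrite invr_eq0 intr_eq0 /lat_gcd gcdz_eq0; apply: contra z0 => /andP[/eqP e1 /eqP e2].
  by rewrite [z]surjective_pairing e1 e2.
have [dtR kindR] := rotation_like_intr R rl; have [_ kind] := rl.
case: kind => [[a1 b0 c0 d1]|tr].
  have neg x : B_transform P x -> B_transform P (- x).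
    move=> /inv; rewrite a1 b0 c0 d1; congr (B_transform P _).
    by apply/eqP; rewrite -pair_eqE /lin2 /=; apply/andP; split; apply/eqP; ring.
  have cen v : v \in s -> - v \in s.
    move=> vs; have : vertices P (lat v) by rewrite PE vertices_ccw//; exists v.
    move/(vertices_lin2 (rotation_like_intr R rl) h).
    rewrite -lat_ilin {1}PE vertices_ccw// => -[w ws /lat_inj e].
    suff -> : - v = w by [].
    rewrite e a1 b0 c0 d1 /ilin; apply/eqP; rewrite -pair_eqE /=; apply/andP; split; apply/eqP; ring.
  have [v [vs nz]] := central_corner cs cen.
  set w := next s v in nz; set x := next s w in nz.
  have ws : w \in s by rewrite mem_next.
  have n1 : v + w != 0 by apply: contra_neq nz => ->; rewrite /cross !mul0r subrr.
  have n2 : w + x != 0 by apply: contra_neq nz => ->; rewrite /cross !mulr0 subrr.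
  have b1 := bp v vs; have b2 := bp w ws.
  apply: (interior_triangle cB b1 b2 (k := 2^-1)) => //.
    set p := lat _; set q := lat _.
    have -> : - 2^-1 *: (p + q) = 2^-1 *: (- p) + (1 - 2^-1) *: (- q).
      by apply/eqP; rewrite -pair_eqE /=; apply/andP; split; apply/eqP; rewrite /GRing.scale/=; lra.
    apply: conv_hullE; [lra|lra|exact: neg|exact: neg].
  rewrite -!lat_reduced.
  have crossZ (g1 g2 : R) (p q : R * R) : cross (g1 *: p) (g2 *: q) = g1 * g2 * cross p q.
    by rewrite /cross /= /GRing.scale /=; ring.
  by rewrite crossZ cross_lat !mulf_neq0 ?intr_eq0// red_neq0.
have [v vs] : exists v, v \in s by case: (s) sz => // v t _; exists v; rewrite mem_head.
have nz : v + next s v != 0.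
  apply/eqP => /eqP; rewrite addrC addr_eq0 => /eqP e; have := dt v vs.
  by rewrite e /cross /=; lra.
set z := v + next s v in nz.
have pz : lat (reduced z) != 0.
  rewrite -lat_reduced scaler_eq0 negb_or red_neq0//=.
  by apply: contra nz => /eqP; rewrite -lat0 => /lat_inj ->.
have b1 := bp v vs; rewrite -/z in b1.
have trR : (a%:~R + d%:~R : R) = -1 by rewrite -rmorphD tr.
apply: (interior_triangle cB b1 (inv _ b1) (k := 1)) => //.
  have := inv _ (inv _ b1); congr (B_transform P _).
  have dE : (d%:~R : R) = -1 - a%:~R by lra.
  have bc : (b%:~R * c%:~R : R) = a%:~R * d%:~R - 1 by lra.
  move: (lat (reduced z)) => [x y]; apply/eqP; rewrite -pair_eqE /lin2 /=.
  apply/andP; split; apply/eqP; rewrite /GRing.scale /=.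
    transitivity ((a%:~R * a%:~R + b%:~R * c%:~R) * x + b%:~R * (a%:~R + d%:~R) * y : R); first by ring.
    by rewrite bc trR dE; ring.
  transitivity (c%:~R * (a%:~R + d%:~R) * x + (b%:~R * c%:~R + d%:~R * d%:~R) * y : R); first by ring.
  by rewrite bc trR dE; ring.
exact: order3_form_neq0.
Qed.

(** Primitive vertices with sum 0: these are the Kaehler-Einstein Fano triangles,
    and integrality of [B] is immediate in this form. *)
Definition centered_triangle (P : set (R * R)) : Prop :=
  exists z1 z2 z3 : int * int, [/\ z1 + z2 + z3 = 0, cross z1 z2 != 0,
    forall z, z \in [:: z1; z2; z3] -> lat_gcd z = 1 & P = hull [:: z1; z2; z3]].

Lemma centered_triangle_fano P : centered_triangle P -> fano_polygon P.
Proof.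
case=> z1 [z2 [z3 [sum nz prim PE]]]; rewrite PE; apply: fano_hull.
- exact: finite_seq.
- by move=> z zs _; exact: prim.
have m z : z \in [:: z1; z2; z3] -> hull [:: z1; z2; z3] (lat z).
  by move=> zs; apply: conv_hull_sub; exists z.
apply: (@interior_triangle _ _ (lat z1) (lat z2) 1) => //.
- exact: conv_hull_convex.
- by apply: m; rewrite !inE eqxx.
- by apply: m; rewrite !inE eqxx orbT.
- have -> : -1 *: (lat z1 + lat z2) = lat z3.
    have -> : z3 = - (z1 + z2) by apply/eqP; rewrite eq_sym eqr_oppLR -addr_eq0 sum.
    by apply/eqP; rewrite -pair_eqE /lat /= /GRing.scale/= !rmorphN !rmorphD !mulN1r !eqxx.
  by apply: m; rewrite !inE eqxx !orbT.
by rewrite cross_lat intr_eq0.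
Qed.

(** The real linear map that permutes the three vertices cyclically has determinant
    1 and trace [-1], although its entries need not be integers. *)
Lemma centered_triangle_ke P : centered_triangle P -> kahler_einstein P.
Proof.
move=> tP; have fP := centered_triangle_fano tP.
case: tP => z1 [z2 [z3 [sum nz prim PE]]].
have z3E : z3 = - (z1 + z2) by apply/eqP; rewrite eq_sym eqr_oppLR -addr_eq0 sum.
pose x1 : R := z1.1%:~R; pose y1 : R := z1.2%:~R.
pose x2 : R := z2.1%:~R; pose y2 : R := z2.2%:~R.
pose x3 : R := - (x1 + x2); pose y3 : R := - (y1 + y2).
pose D := x1 * y2 - y1 * x2.
have D0 : D != 0.
  by have := nz; rewrite -(intr_eq0 R) /cross rmorphB !rmorphM.
have l1 : lat z1 = (x1, y1) by [].
have l2 : lat z2 = (x2, y2) by [].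
have l3 : lat z3 = (x3, y3) by rewrite z3E /lat /= !rmorphN !rmorphD.
pose a := (x2 * y2 - x3 * y1) / D; pose b := (x3 * x1 - x2 * x2) / D.
pose c := (y2 * y2 - y3 * y1) / D; pose d := (y3 * x1 - y2 * x2) / D.
have D0' : x1 * y2 - y1 * x2 != 0 by [].
apply: (@ke_of_rotation _ _ a b c d) => //.
  split; first by rewrite /a /b /c /d /x3 /y3 /D; field.
  by right; rewrite /a /d /x3 /y3 /D; field.
rewrite PE; apply: hull_lin2 => _ [z zs <-].
have e1 : lin2 a b c d (lat z1) = lat z2.
  by rewrite l1 l2 /lin2 /a /b /c /d /D /=; congr pair; field.
have e2 : lin2 a b c d (lat z2) = lat z3.
  by rewrite l2 l3 /lin2 /a /b /c /d /D /=; congr pair; field.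
have e3 : lin2 a b c d (lat z3) = lat z1.
  by rewrite l1 l3 /lin2 /a /b /c /d /x3 /y3 /D /=; congr pair; field.
move: zs => /=; rewrite !inE => /or3P[] /eqP->.
- by exists z2; rewrite //= !inE eqxx orbT.
- by exists z3; rewrite //= !inE eqxx !orbT.
- by exists z1; rewrite //= !inE eqxx.
Qed.

(** The sum of two vertices is the negative of the third one, which is primitive,
    so that [B(P) = - P]. *)
Lemma centered_triangle_B P : centered_triangle P -> centered_triangle (B_transform P).
Proof.
move=> tP; have fP := centered_triangle_fano tP.
case: tP => z1 [z2 [z3 [sum nz prim PE]]].
pose zs := [:: z1; z2; z3].
have [s [cs ccw PEs _]] := fano_ccw fP; have [us sz _ _] := cs.
have vz v : vertices P (lat v) -> v \in zs.
  by rewrite PE => /vertices_hull[w ws /lat_inj <-].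
have perm t : ccw_vertices P t -> perm_eq t zs.
  case=> ut tE _.
  have ts : {subset t <= zs} by move=> v vt; apply: vz; rewrite -tE; exists v.
  have st : {subset s <= t}.
    move=> v vs; have : vertices P (lat v) by rewrite PEs vertices_ccw//; exists v.
    by rewrite -tE => -[w wt /lat_inj <-].
  have s3 : (3 <= size t)%N by apply: leq_trans sz _; exact: uniq_leq_size.
  have [_ e] := uniq_min_size ut ts s3.
  by apply: uniq_perm => //; rewrite -(eq_uniq _ e)//; apply/eqP; rewrite eqn_leq uniq_leq_size.
have sum_perm t : ccw_vertices P t -> \sum_(z <- t) z = 0.
  by move=> ct; rewrite (perm_big _ (perm t ct)) /zs /= !big_cons big_nil addr0 addrA.
have gcdN (z : int * int) : lat_gcd (- z) = lat_gcd z by rewrite /lat_gcd /= gcdNz gcdzN.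
have third t (v : int * int) : ccw_vertices P t -> v \in t -> v + next t v = - prev t v.
  move=> ct vt; have pt := perm t ct; have st := sum_perm t ct.
  have := perm_size pt; case: ct => ut _ _.
  case: t pt st ut vt => [|x [|y [|w [|]]]]//= pt st ut vt _.
  have nx : next [:: x; y; w] x = y by apply: (@next_cat_cons _ [::]).
  have ny : next [:: x; y; w] y = w by apply: (@next_cat_cons _ [:: x]).
  have nw : next [:: x; y; w] w = x by apply: (@next_rcons _ x w [:: y]).
  have px : prev [:: x; y; w] x = w by rewrite -{2}nw prev_next.
  have py : prev [:: x; y; w] y = x by rewrite -{2}nx prev_next.
  have pw : prev [:: x; y; w] w = y by rewrite -{2}ny prev_next.
  move: st; rewrite !big_cons big_nil addr0 => st.
  have opp (p q r : int * int) : p + q + r = 0 -> p + q = - r.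
    by move=> /eqP; rewrite addr_eq0 => /eqP.
  move: vt; rewrite !inE => /or3P[] /eqP->.
  - apply: etrans (congr1 (fun q => x + q) nx) _; apply: etrans (esym (congr1 -%R px)).
    by apply: opp; rewrite -addrA.
  - apply: etrans (congr1 (fun q => y + q) ny) _; apply: etrans (esym (congr1 -%R py)).
    by apply: opp; rewrite addrC.
  - apply: etrans (congr1 (fun q => w + q) nw) _; apply: etrans (esym (congr1 -%R pw)).
    by apply: opp; rewrite -addrA addrC -addrA.
have BE : B_points P = lat @` [set` [:: - z1; - z2; - z3]].
  have memN (z : int * int) : (- z \in [:: - z1; - z2; - z3]) = (z \in zs).
    by rewrite !inE !eqr_opp.
  apply/seteqP; split => [u [t [v [ct vt ->]]]|_ [z zN <-]].
    have pt : prev t v \in zs by rewrite -(perm_mem (perm t ct)) mem_prev.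
    rewrite (third t v ct vt) gcdN prim// invr1 scale1r.
    by exists (- prev t v) => //=; rewrite memN.
  have zzs : - z \in zs by rewrite -memN opprK.
  have zs' : - z \in s by rewrite (perm_mem (perm s ccw)).
  have ns : next s (- z) \in s by rewrite mem_next.
  exists s, (next s (- z)); split => //.
  by rewrite (third s _ ccw ns) prev_next// opprK -[z]opprK gcdN prim// invr1 scale1r opprK.
exists (- z1), (- z2), (- z3); split.
- by rewrite -!opprD sum oppr0.
- by move: nz; congr (_ != _); rewrite /cross /=; ring.
- by move=> z; rewrite !inE => /or3P[] /eqP->; rewrite gcdN prim// !inE eqxx ?orbT.
- by rewrite /B_transform BE.
Qed.

Lemma rotation_invariant_ke (P : set (R * R)) : fano_polygon P -> rotation_invariant P -> kahler_einstein P.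
Proof.
move=> fP [a [b [c [d [rl h]]]]].
exact: ke_of_rotation fP (rotation_like_intr R rl) h.
Qed.

Lemma type_B_infty_of (C : set (R * R) -> Prop) : (forall P, C P -> fano_polygon P) ->
  (forall P, C P -> C (B_transform P)) -> forall P : set (R * R), C P -> type_B_infty P.
Proof.
move=> CF CB P CP m _ k _; apply: CF.
by elim: k => //= k IH; exact: CB.
Qed.

Lemma triangle_of_size3 (P : set (R * R)) s : ccw_vertices P s -> size s = 3%N -> triangle P.
Proof.
move=> [us vE _] s3; rewrite /triangle -vE.
apply: card_eq_trans (inj_card_eq _) _; first by move=> v w _ _; exact: lat_inj.
have -> : [set` s] = nth 0 s @` `I_3.
  apply/seteqP; split => [v vs|_ [i i3 <-]]; last by rewrite /= mem_nth// s3.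
  by exists (index v s); [rewrite /= -s3 index_mem|rewrite nth_index].
apply: inj_card_eq => i j; rewrite !inE /= => i3 j3 /eqP.
by rewrite nth_uniq ?s3// => /eqP.
Qed.

End BTransform.

Theorem theorem3p15 (R : realType) (P : set (R * R)) (l : nat)
    (hP : fano_polygon P) (hKE : kahler_einstein P)
    (hindex : has_index P l) (hl : (l <= 17)%N) :
  (type_B_infty P /\ kahler_einstein (B_transform P)) /\
  (~ symmetric_polygon P -> triangle P).
Proof.
have [s [cs ccw PE prim []]] := ke_classification hP hKE hindex hl.
  move=> [z1 [z2 [z3 [sE sum nz]]]].
  have tP : centered_triangle P.
    by exists z1, z2, z3; split => //; [rewrite -sE|rewrite PE sE].
  split; last by move=> _; apply: triangle_of_size3 ccw _; rewrite sE.
  split; last exact/centered_triangle_ke/centered_triangle_B.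
  exact: (type_B_infty_of (@centered_triangle_fano R) (@centered_triangle_B R)).
move=> /(irotation_hull R); rewrite -PE => rP.
have [fB rB] := rotation_invariant_B hP rP.
split; last by move=> /(_ (rotation_symmetric rP)).
split; last exact: rotation_invariant_ke.
apply: (@type_B_infty_of R (fun Q => fano_polygon Q /\ rotation_invariant Q)) => //.
- by move=> Q [].
- by move=> Q [fQ rQ]; exact: rotation_invariant_B.
Qed.
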